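(* The space $Z(\mathcal J)$ is asymptotically Hilbertian, but it fails the $E(n,n,K)$-property: there is no constant $K\geq 1$ such that its natural basis $(v_j)_{j=1}^\infty$ has the $E(n,n,K)$-property for every $n\in\mathbb N$. In particular, $Z(\mathcal J)$ fails the property $(H)$ and it is not a weak Hilbert space.
   Context: All Banach spaces are complex; isomorphic means linearly homeomorphic, $d$ is the Banach-Mazur distance, and $d_E=d(E,\ell_2^{\dim E})$ for a finite-dimensional space $E$. **Derived spaces.** Let $\omega$ be the space of all complex sequences with coordinatewise convergence and $(e_j)$ the unit vectors. Let $X$ be a Banach sequence space and let its dual $X^*$ be regarded as a sequence space through the bilinear pairing $\langle x,y\rangle=\sum_j x_jy_j$; assume $(e_j)$ is an unconditional basis of both $X$ and $X^*$. Let $\mathbb S=\{z\in\mathbb C:0\le \mathrm{Re}\, z\le 1\}$. $\mathcal F_\infty(X,X^* )$ is the space of functions $F:\mathbb S\to\omega$ that are bounded and continuous on $\mathbb S$, analytic in the interior of $\mathbb S$, and such that $t\mapsto F(it)\in X$ and $t\mapsto F(1+it)\in X^*$ are bounded continuous functions, with norm $\|F\|=\max(\sup_t\|F(it)\|_X,\sup_t\|F(1+it)\|_{X^*})$. The interpolation space $(X,X^* )_{1/2}=\{F(1/2):F\in\mathcal F_\infty(X,X^* )\}$ carries the quotient norm. When $(X,X^* )_{1/2}=\ell_2$ (with equivalent norms), the derived space $Z(X)$ is the space of pairs $(x,y)\in\omega\times\omega$ for which $\|(x,y)\|_{Z(X)}=\inf\{\|F\|:F\in\mathcal F_\infty(X,X^*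 ),\ F(1/2)=y,\ F'(1/2)=x\}$ is finite. Its natural basis is $(v_j)_{j\ge1}$ with $v_{2j-1}=(e_j,0)$, $v_{2j}=(0,e_j)$. **The space $\mathcal J$.** For $n\ge 4$ let $k_n=2^{n+1}$ and let $p_n,p_n^*$ be given by $\frac1{p_n}-\frac12=\frac1{\sqrt n}=\frac12-\frac1{p_n^*}$. Then $\mathcal J=\ell_2(\ell_{p_n}^{k_n})$ is the $\ell_2$-sum of the spaces $\ell_{p_n}^{k_n}$, with its natural unit vector basis, so that $\mathcal J^*=\ell_2(\ell_{p_n^*}^{k_n})$ and $(\mathcal J,\mathcal J^* )_{1/2}=\ell_2$. **Properties.** - A space $X$ is asymptotically Hilbertian if there is $C>0$ such that for every $n\in\mathbb N$ there is a finite-codimensional subspace $X_n$ of $X$ so that every $n$-dimensional subspace $E$ of $X_n$ satisfies $d_E\le C$. - $X$ has the property $(H)$ if for each $\lambda>1$ there is $K(\lambda)$ such that for any $n$ and any $\lambda$-unconditional normalized basic sequence $(u_j)_{j=1}^n$ in $X$ one has $K(\lambda)^{-1}\sqrt n\le\|\sum_{j=1}^nu_j\|\le K(\lambda)\sqrt n$. - $X$ is a weak Hilbert space if there are $0<\delta_0<1$ and a constant $C$ such that every finite-dimensional subspace $E$ of $X$ contains a subspace $F$ with $\dim F\ge\delta_0\dim E$ and $d_F\le C$ for which there is a projection $P:X\to F$ with $\|P\|\le C$. - A basis $(b_j)_{j\ge1}$ of a Banach space is $(m,K)$-euclidean (also for a family indexed by a subset of $\mathbb N$) if for every subset $A$ of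 the index set with $|A|\le m$, $(b_j)_{j\in A}$ is $K$-equivalent to the unit vector basis of $\ell_2^{|A|}$. The basis has the $E(n,m,K)$-property if there is $I\subseteq\mathbb N$ with $|I|=n$ such that $\{b_j:j\in\mathbb N\setminus I\}$ is $(m,K)$-euclidean. *)

(* Defs.v *)
From mathcomp Require Import all_boot all_order all_algebra.
From mathcomp Require Import all_classical all_reals all_analysis.
From mathcomp Require Import complex finmap.
Set Implicit Arguments.
Unset Strict Implicit.
Unset Printing Implicit Defensive.
Import Order.TTheory GRing.Theory Num.Theory numFieldNormedType.Exports.
Local Open Scope classical_set_scope.
Local Open Scope ring_scope.
Local Open Scope complex_scope.

(* R[i]^o is R[i] as a normed space over itself; this alias is what carries
   the topology used for limits and complex derivatives below. The modulus is
   the real-valued Normc.normc, because `|z| lives in R[i]. *)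
Notation Cplx R := (R[i]^o).
Notation modc := Normc.normc.

(* A complex normed space is presented as an extended norm N : V -> \bar R on
   a C-vector space V; the space itself is the set [space N] of the vectors of
   finite norm, and its subspaces are sets of vectors of V. *)
Section NormedSpaces.
Context {R : realType}.
Implicit Types (V W : lmodType R[i]).

Definition space V (N : V -> \bar R) : set V := [set x | (N x < +oo)%E].

Definition lincomb V n (b : 'I_n -> V) (c : 'I_n -> R[i]) : V :=
  \sum_(i < n) c i *: b i.

Definition has_dim V (E : set V) (n : nat) : Prop :=
  exists b : 'I_n -> V,
    (forall c, lincomb b c = 0 -> forall i, c i = 0) /\ E = range (lincomb b).

Definition linear_subspace V (Y : set V) : Prop :=
  Y 0 /\ forall (a : R[i]) x y, Y x -> Y y -> Y (a *: x + y).

Definition closed_in V (N : V -> \bar R) (Y : set V) : Prop :=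
  forall (u : nat -> V) x, (forall k, Y (u k)) -> space N x ->
    (fun k => N (u k - x)) @ \oo --> (0%E : \bar R) -> Y x.

Definition finite_codim V (N : V -> \bar R) (Y : set V) : Prop :=
  exists n (w : 'I_n -> V), (forall i, space N (w i)) /\
    forall x, space N x -> exists c, Y (x - lincomb w c).

Definition linear_on V W (E : set V) (T : V -> W) : Prop :=
  forall (a : R[i]) x y, E x -> E y -> T (a *: x + y) = a *: T x + T y.

Definition op_norm V W (N : V -> \bar R) (M : W -> \bar R) (E : set V)
    (T : V -> W) : \bar R :=
  ereal_sup [set M (T x) | x in E `&` [set x | (N x <= 1)%E]].

(* T and S are total functions used only on E and G, where they are mutually
   inverse isomorphisms. *)
Definition bm_dist V W (N : V -> \bar R) (M : W -> \bar R)
    (E : set V) (G : set W) : \bar R :=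
  ereal_inf [set d | exists (T : V -> W) (S : W -> V),
    [/\ linear_on E T,
        forall x, E x -> G (T x) /\ S (T x) = x,
        forall y, G y -> E (S y) /\ T (S y) = y,
        (op_norm N M E T < +oo)%E /\ (op_norm M N G S < +oo)%E &
        d = (op_norm N M E T * op_norm M N G S)%E]].

Definition ell2_norm n (x : 'rV[R[i]]_n) : \bar R :=
  (Num.sqrt (\sum_(i < n) modc (x ord0 i) ^+ 2))%:E.

(* For E of dimension n this is d_E. *)
Definition hilbert_dist V (N : V -> \bar R) (E : set V) (n : nat) : \bar R :=
  bm_dist N (@ell2_norm n) E [set: 'rV[R[i]]_n].

Definition asymptotically_hilbertian V (N : V -> \bar R) : Prop :=
  exists C : R, 0 < C /\ forall n : nat, exists Y : set V,
    [/\ Y `<=` space N, linear_subspace Y, closed_in N Y, finite_codim N Y &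
        forall E, E `<=` Y -> has_dim E n -> (hilbert_dist N E n <= C%:E)%E].

(* Unconditionality with respect to unimodular complex multipliers. *)
Definition unconditional V (N : V -> \bar R) n (lam : R) (u : 'I_n -> V) :=
  forall a eps : 'I_n -> R[i], (forall i, modc (eps i) = 1) ->
    (N (lincomb u (fun i => eps i * a i)%R) <= lam%:E * N (lincomb u a))%E.

Definition property_H V (N : V -> \bar R) : Prop :=
  forall lam : R, 1 < lam -> exists K : R, 0 < K /\
    forall n (u : 'I_n -> V), (forall i, N (u i) = 1%E) ->
      unconditional N lam u ->
      ((K^-1 * Num.sqrt n%:R)%:E <= N (\sum_(i < n) u i)%R)%E /\
      (N (\sum_(i < n) u i)%R <= (K * Num.sqrt n%:R)%:E)%E.

Definition weak_hilbert V (N : V -> \bar R) : Prop :=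
  exists delta C : R, [/\ 0 < delta, delta < 1 &
    forall (E : set V) n, E `<=` space N -> has_dim E n ->
      exists (G : set V) m,
        [/\ G `<=` E, has_dim G m, delta * n%:R <= m%:R,
            (hilbert_dist N G m <= C%:E)%E &
            exists P : V -> V,
              [/\ linear_on (space N) P,
                  forall x, space N x -> G (P x),
                  forall x, G x -> P x = x &
                  (op_norm N N (space N) P <= C%:E)%E]]].

(* The family (b j), j in D. *)
Definition euclidean V (N : V -> \bar R) (b : nat -> V) (D : set nat)
    (m : nat) (K : R) : Prop :=
  forall A : {fset nat}, [set` A] `<=` D -> (#|` A| <= m)%N ->
  forall a : nat -> R[i],
    let s := Num.sqrt (\sum_(j <- A) modc (a j) ^+ 2) in
    ((K^-1 * s)%:E <= N (\sum_(j <- A) a j *: b j)%R)%E /\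
    (N (\sum_(j <- A) a j *: b j)%R <= (K * s)%:E)%E.

Definition E_property V (N : V -> \bar R) (b : nat -> V) (n m : nat) (K : R)
    : Prop :=
  exists I : {fset nat}, #|` I| = n /\ euclidean N b (~` [set` I]) m K.

End NormedSpaces.

Section DerivedSpaces.
Variable R : realType.

Definition omega : lmodType R[i] := nat -> Cplx R.

Definition unit_vec (j : nat) : omega := fun k => (k == j)%:R.

(* Operator norm of y as a functional on X, through <x, y> = \sum_j x_j y_j;
   it is +oo unless the series converges for every x in X. *)
Definition dual_norm (N : omega -> \bar R) (y : omega) : \bar R :=
  ereal_inf [set M%:E | M in [set M : R | 0 <= M /\
    forall x : omega, space N x -> exists2 s : Cplx R,
      series (fun j => x j * y j) @ \oo --> s &
      ((modc s)%:E <= M%:E * N x)%E]].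

Definition strip : set (Cplx R) := [set z | 0 <= complex.Re z <= 1].

(* F is a total function used only on the strip. Boundedness, continuity and
   analyticity into omega are coordinatewise; analytic means complex
   differentiable on the open strip. *)
Record calF (N0 N1 : omega -> \bar R) (F : Cplx R -> omega) : Prop := CalF {
  calF_bounded : forall j, exists M : R, forall z, strip z -> modc (F z j) <= M;
  calF_continuous : forall j, {within strip, continuous (fun z => F z j)};
  calF_analytic : forall j (z : Cplx R), 0 < complex.Re z < 1 ->
    derivable (fun z' => F z' j) z 1;
  calF_mem0 : forall t : R, space N0 (F (0 +i* t));
  calF_mem1 : forall t : R, space N1 (F (1 +i* t));
  calF_cont0 : forall t : R,
    (fun s : R => N0 (F (0 +i* s) - F (0 +i* t))) @ t --> (0%E : \bar R);
  calF_cont1 : forall t : R,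
    (fun s : R => N1 (F (1 +i* s) - F (1 +i* t))) @ t --> (0%E : \bar R);
  calF_bounded0 :
    (ereal_sup (range (fun t : R => N0 (F (0%R +i* t)))) < +oo)%E;
  calF_bounded1 :
    (ereal_sup (range (fun t : R => N1 (F (1%R +i* t)))) < +oo)%E }.

Definition calF_norm (N0 N1 : omega -> \bar R) (F : Cplx R -> omega) : \bar R :=
  maxe (ereal_sup (range (fun t : R => N0 (F (0 +i* t)))))
       (ereal_sup (range (fun t : R => N1 (F (1 +i* t))))).

Definition half_pt : Cplx R := (2^-1 : R)%:C.

(* The extended norm of Z(X), where X = space N. *)
Definition Z_norm (N : omega -> \bar R) (xy : (omega * omega)%type) : \bar R :=
  ereal_inf [set calF_norm N (dual_norm N) F | F in
    [set F | [/\ calF N (dual_norm N) F, F half_pt = xy.2 &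
                 forall j, 'D_1 (fun z : Cplx R => F z j) half_pt = xy.1 j]]].

(* Indexed from 0: v_1, v_2, ... are Z_basis 0, Z_basis 1, ... *)
Definition Z_basis (j : nat) : (omega * omega)%type :=
  if odd j then (0, unit_vec j./2) else (unit_vec j./2, 0).

Definition J_dim (n : nat) : nat := (2 ^ n.+1)%N.

Definition J_exp (n : nat) : R := (2^-1 + (Num.sqrt n%:R)^-1)^-1.

(* The blocks n = 4, 5, ... occupy consecutive intervals of coordinates. *)
Definition J_offset (n : nat) : nat := (\sum_(4 <= m < n) J_dim m)%N.

Definition J_block_norm (n : nat) (x : omega) : R :=
  (\sum_(i < J_dim n) modc (x (J_offset n + i)%N) `^ J_exp n)
    `^ (J_exp n)^-1.

Definition J_norm (x : omega) : \bar R :=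
  sqrte (\sum_(4 <= n <oo) (J_block_norm n x ^+ 2)%:E)%E.

Definition ZJ_norm : (omega * omega)%type -> \bar R := Z_norm J_norm.

End DerivedSpaces.

(* Main.v *)
Require Import Defs.
From mathcomp Require Import all_boot all_order all_algebra.
From mathcomp Require Import all_classical all_reals all_analysis.
From mathcomp Require Import complex finmap ring lra.

(** Complex interpolation between J and its dual at 1/2 presents Z(J) as a
twisted sum of two copies of l_2. For y in l_2 let ext y be the function with
value y at 1/2 which on the block n is the classical extremal function of the
couple formed by l_p and its dual, and let Omega y be its derivative at 1/2:
on the block n,

  (Omega y)_j = - (4 / sqrt n) log (|y_j| / |y|_n) y_j,

where |y|_n is the l_2-norm of y on that block. Up to a constant the norm of
(x, y) is |y|_2 + |x - Omega y|_2. The upper bound (Z_norm_upper) comes from an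
explicit competitor built from ext. For the lower bound (Z_norm_lower) a
competitor F is paired with the extremal function of a finitely supported test
sequence, reflected in the line Re z = 1/2; the three lines theorem bounds the
resulting scalar function, whose value at 1/2 tests y, and Cauchy's estimate
bounds its derivative there, which tests x - Omega y. Both facts about analytic
functions rest on Cauchy's theorem for rectangles. What follows uses little else
than this equivalent expression of the norm.

Asymptotically Hilbertian. Omega is homogeneous and almost additive: on the sum
of m vectors supported beyond the block N the squared error is at most a multiple
of m ^ 3 / N times the sum of the squared norms (Omega_quasilinear). So on an
n-dimensional subspace of vectors supported far enough, Omega is, up to an error
bounded by |y|_2, the linear map with the same values on a basis whose second
components are orthogonal. Replacing Omega by that map makes the norm euclidean,
with universal constants (euclidean_frame).

The failures. The block n has k = 2 ^ (n + 1) coordinates, so that the logarithm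
in Omega is of order n on spread vectors and Omega itself of order sqrt n. Hence
(l1_block), for y supported on that block,

  |y|_1 <= C sqrt (k / n) ||(0, y)||,

which improves on the Cauchy-Schwarz inequality by a factor sqrt n. If m is
proportional to k, then m of the vectors (0, e_j) of the block have a sum of
l_1-norm m, whose norm therefore cannot be of order sqrt m uniformly in n
(block_count_bound). This contradicts the E(n, n, K)-property, because half of
the coordinates of the block survive the removal of 2 ^ n indices, and the
property (H), because the vectors (0, e_j) are unconditional: Omega commutes with
unimodular multipliers. If Z(J) were a weak Hilbert space, the span of the block
would contain a euclidean subspace of dimension m proportional to k,
complemented by a bounded projection. The identity of l_2^m would factor through
the span, and its trace m is estimated by Cauchy-Schwarz on the coordinates of
the block; Khinchine's inequality turns l1_block into a bound for the
coordinates of the subspace, and again n stays bounded. *)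

Set Implicit Arguments.
Unset Strict Implicit.
Unset Printing Implicit Defensive.
Import Order.TTheory GRing.Theory Num.Theory numFieldNormedType.Exports.
Local Open Scope classical_set_scope.
Local Open Scope ring_scope.
Local Open Scope complex_scope.

(** * Moduli and complex derivatives *)

Section Modulus.
Variable R : realType.
Implicit Types z w : R[i].

Lemma modcE z : modc z = Num.sqrt (complex.Re z ^+ 2 + complex.Im z ^+ 2).
Proof. by case: z. Qed.

Lemma sqr_modc z : modc z ^+ 2 = complex.Re z ^+ 2 + complex.Im z ^+ 2.
Proof. by rewrite modcE sqr_sqrtr // addr_ge0 // sqr_ge0. Qed.

Lemma modc_ge0 z : 0 <= modc z.
Proof. by rewrite modcE sqrtr_ge0. Qed.

Lemma modcM z w : modc (z * w) = modc z * modc w.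
Proof. exact: Normc.normcM. Qed.

Lemma modcN z : modc (- z) = modc z.
Proof. exact: (@normcN R z). Qed.

Lemma modcD z w : modc (z + w) <= modc z + modc w.
Proof. exact: (@le_normcD R z w). Qed.

Lemma modcB z w : modc (z - w) <= modc z + modc w.
Proof. by rewrite -(modcN w) modcD. Qed.

Lemma modc_distC z w : modc (z - w) = modc (w - z).
Proof. by rewrite -modcN opprB. Qed.

Lemma modcV z : modc z^-1 = (modc z)^-1.
Proof. exact: Normc.normcV. Qed.

Lemma modc0 : modc (0 : R[i]) = 0.
Proof. exact: Normc.normc0. Qed.

Lemma modc1 : modc (1 : R[i]) = 1.
Proof. exact: Normc.normc1. Qed.

Lemma modc_real (x : R) : modc x%:C = `|x|.
Proof. by rewrite modcE /= expr0n addr0 sqrtr_sqr. Qed.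

Lemma modc_eq0 z : (modc z == 0) = (z == 0).
Proof.
apply/eqP/eqP => [|->]; first exact: Normc.eq0_normc.
exact: modc0.
Qed.

Lemma modc_gt0 z : (0 < modc z) = (z != 0).
Proof. by rewrite lt_neqAle modc_ge0 andbT eq_sym modc_eq0. Qed.

Lemma modc_conj z : modc (conjc z) = modc z.
Proof. by case: z => a b; rewrite !modcE /= sqrrN. Qed.

Lemma mul_conjc z : z * conjc z = (modc z ^+ 2)%:C.
Proof.
rewrite sqr_modc; case: z => a b /=; apply/eqP; rewrite eq_complex /=.
by apply/andP; split; apply/eqP; ring.
Qed.

Lemma normr_Re_le z : `|complex.Re z| <= modc z.
Proof.
rewrite modcE -sqrtr_sqr ler_sqrt ?lerDl ?sqr_ge0 //.
by rewrite addr_ge0 // sqr_ge0.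
Qed.

Lemma normr_Im_le z : `|complex.Im z| <= modc z.
Proof.
rewrite modcE -sqrtr_sqr ler_sqrt ?lerDr ?sqr_ge0 //.
by rewrite addr_ge0 // sqr_ge0.
Qed.

Lemma Re_le_modc z : complex.Re z <= modc z.
Proof. exact: le_trans (ler_norm _) (normr_Re_le z). Qed.

Lemma modc_le_ReIm z : modc z <= `|complex.Re z| + `|complex.Im z|.
Proof.
rewrite -ler_sqr ?nnegrE ?modc_ge0 ?addr_ge0 // sqr_modc sqrrD !real_normK ?num_real //.
by rewrite lerD2r lerDl mulrn_wge0 // mulr_ge0.
Qed.

Lemma modc_sum (I : Type) (s : seq I) (P : pred I) (f : I -> R[i]) :
  modc (\sum_(i <- s | P i) f i) <= \sum_(i <- s | P i) modc (f i).
Proof.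
elim/big_rec2 : _ => [|i y x _ h]; first by rewrite modc0.
by rewrite (le_trans (modcD _ _)) // lerD2l.
Qed.

Lemma lt_normC_modc z (e : R) : (`|z| < e%:C) = (modc z < e).
Proof. by rewrite -ltcR. Qed.

Lemma posc_real (e : R[i]) : 0 < e -> exists2 d : R, 0 < d & e = d%:C.
Proof.
case: e => a b; rewrite ltcE /= => /andP[/eqP -> a0]; by exists a.
Qed.

Lemma cvgc_modcP (T : Type) (F : set_system T) (FF : Filter F)
    (f : T -> Cplx R) (l : Cplx R) :
  f @ F --> l <-> forall e : R, 0 < e -> \forall t \near F, modc (f t - l) < e.
Proof.
split=> [/cvgrPdist_lt h e e0|h].
  have /h : 0 < e%:C by rewrite ltcR.
  by apply: filterS => t; rewrite lt_normC_modc modc_distC.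
apply/cvgrPdist_lt => e /posc_real[d d0 ->].
by move: (h d d0); apply: filterS => t; rewrite lt_normC_modc modc_distC.
Qed.

Lemma nbhsc_modcP (z : Cplx R) (A : set (Cplx R)) :
  nbhs z A <-> exists2 d : R, 0 < d & forall w, modc (w - z) < d -> A w.
Proof.
split=> [/nbhs_ballP[e /= /posc_real[d d0 ->]] h|[d d0 h]].
  exists d => // w wd; apply: h.
  by rewrite /ball /= lt_normC_modc modc_distC.
apply/nbhs_ballP; exists d%:C => /=; first by rewrite ltcR.
by move=> w; rewrite /ball /= lt_normC_modc modc_distC => /h.
Qed.

(** Differentiability as one inequality for the real modulus, valid at the base
point too: composition and local estimates then need no limits of quotients. *)
Definition cdiff (f : R[i] -> R[i]) (z l : R[i]) : Prop :=
  forall e : R, 0 < e -> exists2 d : R, 0 < d &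
    forall w, modc (w - z) < d -> modc (f w - f z - l * (w - z)) <= e * modc (w - z).

Lemma cdiffP (f : Cplx R -> Cplx R) (z l : Cplx R) :
  cdiff f z l <-> is_derive z (1 : Cplx R) f l.
Proof.
have -> : is_derive z (1 : Cplx R) f l <->
    (h^-1 *: ((f \o shift z) (h *: (1 : Cplx R)) - f z) @[h --> (0 : Cplx R)^'] --> l).
  split => [[fz <-] //|h]; split; first by apply/cvg_ex; exists l.
  exact/cvg_lim.
have E (w : Cplx R) : w != z ->
    modc ((w - z)^-1 * (f w - f z) - l) = modc (f w - f z - l * (w - z)) / modc (w - z).
  move=> wz; have wz0 : w - z != 0 by rewrite subr_eq0.
  rewrite -modcV -modcM mulrBl mulfK //.
  by rewrite mulrC.
rewrite cvgc_modcP; split=> [h e e0|h e e0].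
  have e20 : 0 < e / 2 by rewrite divr_gt0.
  have [d d0 dh] := h _ e20.
  near_simpl; rewrite /= near_withinE; apply/nbhsc_modcP; exists d => // w.
  rewrite subr0 => wd w0.
  rewrite /= /shift /= /GRing.scale /= mulr1.
  have wzz : w + z != z by rewrite -subr_eq0 addrK.
  have := E _ wzz; rewrite addrK => ->.
  have := dh (w + z); rewrite addrK => /(_ wd) h'.
  rewrite ltr_pdivrMr ?modc_gt0 // (le_lt_trans h') //.
  by rewrite ltr_pM2r ?modc_gt0 // ltr_pdivrMr // ltr_pMr // ltr1n.
have := h _ e0; near_simpl; rewrite /= near_withinE => /nbhsc_modcP[d d0 dh].
exists d => // w wd; have [->|wz] := eqVneq w z.
  by rewrite !subrr mulr0 subr0 modc0 mulr0.
have := dh (w - z); rewrite subr0 => /(_ wd).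
rewrite subr_eq0 => /(_ wz); rewrite /= /shift /= /GRing.scale /= mulr1 subrK E //.
by rewrite ltr_pdivrMr ?modc_gt0 ?subr_eq0 // => /ltW.
Unshelve. all: by end_near. Qed.

Lemma derivable_cdiff (f : Cplx R -> Cplx R) (z : Cplx R) :
  derivable f z 1 -> exists l, cdiff f z l.
Proof. by move=> h; exists ('D_1 f z); apply/cdiffP; split. Qed.

Lemma cdiff_derivable (f : Cplx R -> Cplx R) (z l : Cplx R) :
  cdiff f z l -> derivable f z 1.
Proof. by move=> /cdiffP[]. Qed.

Lemma cdiff_derive (f : Cplx R -> Cplx R) (z l : Cplx R) :
  cdiff f z l -> 'D_1 f z = l.
Proof. by move=> /cdiffP[]. Qed.

Lemma cdiffM (f g : R[i] -> R[i]) z a b : cdiff f z a -> cdiff g z b ->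
  cdiff (fun w => f w * g w) z (a * g z + f z * b).
Proof.
move=> /cdiffP fa /cdiffP gb; apply/cdiffP.
have -> : a * g z + f z * b = (f z : Cplx R) *: (b : Cplx R) + (g z : Cplx R) *: (a : Cplx R).
  by rewrite addrC (mulrC a).
exact: (@is_deriveM (R[i]) (Cplx R) f g).
Qed.

Lemma cdiffD (f g : R[i] -> R[i]) z a b : cdiff f z a -> cdiff g z b ->
  cdiff (fun w => f w + g w) z (a + b).
Proof.
by move=> /cdiffP fa /cdiffP gb; apply/cdiffP; exact: (@is_deriveD R[i] (Cplx R) (Cplx R) f g).
Qed.

Lemma cdiff_eq (f g : R[i] -> R[i]) z a : (forall w, f w = g w) ->
  cdiff f z a -> cdiff g z a.
Proof. by move=> /funext ->. Qed.

Lemma cdiff_cst c z : cdiff (fun=> c) z 0.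
Proof.
move=> e e0; exists 1 => // w _.
by rewrite subrr mul0r subr0 modc0 mulr_ge0 ?modc_ge0 // ltW.
Qed.

Lemma cdiff_id z : cdiff id z 1.
Proof.
move=> e e0; exists 1 => // w _.
by rewrite mul1r subrr modc0 mulr_ge0 ?modc_ge0 // ltW.
Qed.

Lemma cdiff_sum (I : Type) (s : seq I) (f : I -> R[i] -> R[i]) z (l : I -> R[i]) :
  (forall i, cdiff (f i) z (l i)) ->
  cdiff (fun w => \sum_(i <- s) f i w) z (\sum_(i <- s) l i).
Proof.
move=> h; elim: s => [|i s IH].
  rewrite big_nil; apply: cdiff_eq (cdiff_cst 0 z) => w; by rewrite big_nil.
rewrite big_cons; apply: cdiff_eq (cdiffD (h i) IH) => w; by rewrite big_cons.
Qed.

Lemma cdiff_lip (f : R[i] -> R[i]) z l : cdiff f z l ->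
  exists2 d : R, 0 < d &
    forall w, modc (w - z) < d -> modc (f w - f z) <= (modc l + 1) * modc (w - z).
Proof.
move=> /(_ 1 ltr01)[d d0 h]; exists d => // w /h.
rewrite mul1r => h'; rewrite mulrDl mul1r -modcM.
rewrite -[X in modc X](subrK (l * (w - z))) addrC.
by rewrite (le_trans (modcD _ _)) // lerD2l.
Qed.

Definition ccont (f : R[i] -> R[i]) (z : R[i]) : Prop :=
  forall e : R, 0 < e -> exists2 d : R, 0 < d &
    forall w, modc (w - z) < d -> modc (f w - f z) < e.

Lemma cdiff_ccont f z l : cdiff f z l -> ccont f z.
Proof.
move=> /cdiff_lip[d d0 h] e e0.
have k0 : 0 < modc l + 1 by rewrite ltr_wpDl ?modc_ge0.
exists (Num.min d (e / (modc l + 1))); first by rewrite lt_min d0 divr_gt0.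
move=> w; rewrite lt_min => /andP[/h h1]; rewrite ltr_pdivlMr // mulrC => h2.
exact: le_lt_trans h1 h2.
Qed.

Lemma cdiff_comp (f g : R[i] -> R[i]) z a b : cdiff g z b -> cdiff f (g z) a ->
  cdiff (fun w => f (g w)) z (a * b).
Proof.
move=> gb fa e e0.
have [d1 d10 h1] := cdiff_lip gb.
have k0 : 0 < modc b + 1 by rewrite ltr_wpDl ?modc_ge0.
have l0 : 0 < modc a + 1 by rewrite ltr_wpDl ?modc_ge0.
have e1 : 0 < e / 2 / (modc b + 1) by rewrite !divr_gt0.
have e2 : 0 < e / 2 / (modc a + 1) by rewrite !divr_gt0.
have [d2 d20 h2] := fa _ e1.
have [d3 d30 h3] := gb _ e2.
have [d4 d40 h4] := cdiff_ccont gb d20.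
exists (Num.min (Num.min d1 d3) d4); first by rewrite !lt_min d10 d30 d40.
move=> w; rewrite !lt_min => /andP[/andP[w1 w3] w4].
have -> : f (g w) - f (g z) - a * b * (w - z) =
  (f (g w) - f (g z) - a * (g w - g z)) + a * (g w - g z - b * (w - z)) by ring.
rewrite (le_trans (modcD _ _)) // (splitr e) mulrDl lerD //.
  rewrite (le_trans (h2 _ (h4 _ w4))) //.
  rewrite (le_trans (ler_wpM2l (ltW e1) (h1 _ w1))) //.
  by rewrite mulrA divfK // gt_eqF.
rewrite modcM (le_trans (ler_wpM2l (modc_ge0 a) (h3 _ w3))) //.
rewrite mulrA ler_wpM2r ?modc_ge0 // mulrA ler_pdivrMr // mulrC.
by rewrite ler_wpM2l ?divr_ge0 ?ltW // ltrDl.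
Qed.

End Modulus.

(** * Cauchy's theorem on rectangles *)

Section Goursat.
Variable R : realType.

(** Integrals of continuous functions only enter through increments of a
primitive: additivity is then a telescoping identity and every estimate is an
instance of the mean value theorem. *)
Definition primitive (G g : R -> R) (a b : R) : Prop :=
  forall x, a <= x <= b -> is_derive x (1 : R) G (g x).

Lemma primitive_exists (g : R -> R) (a b : R) :
  continuous g -> exists G, primitive G g a b.
Proof.
move=> gc; exists (fun x => \int[lebesgue_measure]_(t in `[a - 1, x]) g t)%R.
move=> x /andP[ax xb].
have ax' : a - 1 < x by rewrite ltrBlDr (le_lt_trans ax) // ltrDl.
have xb' : x < b + 1 by rewrite (le_lt_trans xb) // ltrDl.
have ig : (@lebesgue_measure R).-integrable `[a - 1, b + 1] (EFin \o g).
  apply: continuous_compact_integrable; first exact: segment_compact.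
  exact: continuous_subspaceT.
have [dF <-] := continuous_FTC1_closed xb' ig ax' (gc x).
by rewrite derive1E; split.
Qed.

Lemma primitive_MVT (G g : R -> R) (a b s t : R) :
  primitive G g a b -> a <= s -> s <= t -> t <= b ->
  exists2 c, s <= c <= t & G t - G s = g c * (t - s).
Proof.
move=> Gg as_ st tb.
have dG x : s <= x <= t -> is_derive x (1 : R) G (g x).
  by move=> /andP[sx xt]; apply: Gg; rewrite (le_trans as_ sx) (le_trans xt tb).
have [x||x /[!in_itv]/= cst ->] := @MVT_segment R G g s t st.
- by rewrite in_itv /= => /andP[sx xt]; apply: dG; rewrite !ltW.
- by apply: derivable_within_continuous => x; rewrite in_itv /= => /dG[].
- by exists x.
Qed.

Lemma primitive_mean (G g : R -> R) (a b s t m e : R) :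
  primitive G g a b -> a <= s -> s <= t -> t <= b ->
  (forall x, s <= x <= t -> `|g x - m| <= e) ->
  `|G t - G s - m * (t - s)| <= e * (t - s).
Proof.
move=> Gg as_ st tb ge; have [c cst ->] := primitive_MVT Gg as_ st tb.
by rewrite -mulrBl normrM (ger0_norm (_ : 0 <= t - s)) ?subr_ge0 //
  ler_wpM2r ?subr_ge0 // ge.
Qed.

Lemma primitiveB (G g H h : R -> R) (a b : R) :
  primitive G g a b -> primitive H h a b ->
  primitive (fun x => G x - H x) (fun x => g x - h x) a b.
Proof.
by move=> Gg Hh x xab; have := Gg x xab; have := Hh x xab => ? ?;
  exact: (@is_deriveB R R R G H).
Qed.

Section Bisection.
Variable I : R -> R -> R -> R -> R.
Variables a b c d : R.
Hypothesis Ix : forall x1 x2 x3 y1 y2, I x1 x3 y1 y2 = I x1 x2 y1 y2 + I x2 x3 y1 y2.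
Hypothesis Iy : forall x1 x2 y1 y2 y3, I x1 x2 y1 y3 = I x1 x2 y1 y2 + I x1 x2 y2 y3.
Hypothesis ab : a <= b.
Hypothesis cd : c <= d.
Hypothesis Ismall : forall x0 y0, a <= x0 <= b -> c <= y0 <= d ->
  forall e, 0 < e -> exists2 r, 0 < r & forall x1 x2 y1 y2,
    a <= x1 -> x1 <= x0 <= x2 -> x2 <= b -> c <= y1 -> y1 <= y0 <= y2 -> y2 <= d ->
    x2 - x1 <= r -> y2 - y1 <= r ->
    `|I x1 x2 y1 y2| <= e * (x2 - x1 + (y2 - y1)) ^+ 2.

Let J (q : (R * R) * (R * R)) := I q.1.1 q.1.2 q.2.1 q.2.2.

(** The first quarter carrying at least a quarter of |I|. *)
Let next (q : (R * R) * (R * R)) : (R * R) * (R * R) :=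
  let: ((x1, x2), (y1, y2)) := q in
  let mx := (x1 + x2) / 2 in let my := (y1 + y2) / 2 in
  if `|J q| <= 4 * `|I x1 mx y1 my| then ((x1, mx), (y1, my)) else
  if `|J q| <= 4 * `|I mx x2 y1 my| then ((mx, x2), (y1, my)) else
  if `|J q| <= 4 * `|I x1 mx my y2| then ((x1, mx), (my, y2)) else
  ((mx, x2), (my, y2)).

Let nextJ q : `|J q| <= 4 * `|J (next q)|.
Proof.
case: q => [[x1 x2] [y1 y2]]; rewrite /next.
set mx := (x1 + x2) / 2; set my := (y1 + y2) / 2.
case: ifPn => [h //|]; rewrite -ltNge => h1.
case: ifPn => [h //|]; rewrite -ltNge => h2.
case: ifPn => [h //|]; rewrite -ltNge => h3.
have : `|J ((x1, x2), (y1, y2))| <= `|I x1 mx y1 my| + `|I mx x2 y1 my| +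
    `|I x1 mx my y2| + `|I mx x2 my y2|.
  rewrite /J /= (Iy x1 x2 y1 my y2) (Ix x1 mx x2 y1 my) (Ix x1 mx x2 my y2).
  by rewrite addrA (le_trans (ler_normD _ _)) // lerD2r (le_trans (ler_normD _ _)) //
    lerD2r ler_normD.
move: h1 h2 h3; rewrite {4}/J /=; lra.
Qed.

Let next_spec q : q.1.1 <= q.1.2 -> q.2.1 <= q.2.2 ->
  [/\ q.1.1 <= (next q).1.1, (next q).1.2 <= q.1.2, q.2.1 <= (next q).2.1,
      (next q).2.2 <= q.2.2 & (next q).1.2 - (next q).1.1 = (q.1.2 - q.1.1) / 2 /\
      (next q).2.2 - (next q).2.1 = (q.2.2 - q.2.1) / 2].
Proof.
case: q => [[x1 x2] [y1 y2]] /= h1 h2.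
by do 3 (case: ifP => _ /=; first by do !split => //=; lra); do !split => //=; lra.
Qed.

Let Q k := iter k next ((a, b), (c, d)).

Let Q_spec k : [/\ a <= (Q k).1.1, (Q k).1.2 <= b, c <= (Q k).2.1, (Q k).2.2 <= d &
  [/\ (Q k).1.2 - (Q k).1.1 = (b - a) / 2 ^+ k, (Q k).2.2 - (Q k).2.1 = (d - c) / 2 ^+ k &
  `|J (Q 0%N)| <= 4 ^+ k * `|J (Q k)|]].
Proof.
elim: k => [|k [h1 h2 h3 h4 [h5 h6 h7]]]; first by split=> //=; rewrite !expr0 !divr1 mul1r.
have p2 : 0 < (2 : R) ^+ k by rewrite exprn_gt0.
have w1 : (Q k).1.1 <= (Q k).1.2 by rewrite -(subr_ge0 (Q k).1.1) h5 divr_ge0 ?(ltW p2) // subr_ge0.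
have w2 : (Q k).2.1 <= (Q k).2.2 by rewrite -(subr_ge0 (Q k).2.1) h6 divr_ge0 ?(ltW p2) // subr_ge0.
have [n1 n2 n3 n4 [n5 n6]] := next_spec w1 w2.
have -> : Q k.+1 = next (Q k) by [].
split; [exact: le_trans h1 n1|exact: le_trans n2 h2|exact: le_trans h3 n3|
  exact: le_trans n4 h4|].
rewrite n5 n6 h5 h6 !exprSr invfM !mulrA; split => //.
rewrite (le_trans h7) // -mulrA ler_wpM2l ?exprn_ge0 //; exact: nextJ.
Qed.

Let Q_le k : (Q k).1.1 <= (Q k).1.2 /\ (Q k).2.1 <= (Q k).2.2.
Proof.
have [_ _ _ _ [h5 h6 _]] := Q_spec k.
by rewrite -(subr_ge0 (Q k).1.1) -(subr_ge0 (Q k).2.1) h5 h6 !divr_ge0 ?exprn_ge0 // subr_ge0.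
Qed.

Let Q_mono k l : (k <= l)%N -> [/\ (Q k).1.1 <= (Q l).1.1, (Q l).1.2 <= (Q k).1.2,
  (Q k).2.1 <= (Q l).2.1 & (Q l).2.2 <= (Q k).2.2].
Proof.
elim: l => [|l IH]; first by rewrite leqn0 => /eqP ->.
rewrite leq_eqVlt => /predU1P[-> //|]; rewrite ltnS => /IH[h1 h2 h3 h4].
have [w1 w2] := Q_le l.
have [n1 n2 n3 n4 _] := next_spec w1 w2.
split; [exact: le_trans h1 n1|exact: le_trans n2 h2|exact: le_trans h3 n3|exact: le_trans n4 h4].
Qed.

Let nested (u v : nat -> R) : (forall k l, u k <= v l) ->
  exists x, forall k, u k <= x <= v k.
Proof.
move=> uv; exists (sup (range u)) => k.
have ub : has_ubound (range u) by exists (v 0%N) => _ [i _ <-].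
apply/andP; split; first by apply: ub_le_sup => //; exists k.
by apply: ge_sup => [|_ [i _ <-] //]; exists (u 0%N), 0%N.
Qed.

(** Goursat's argument for an additive function I of rectangles. One of the four
quarters of a rectangle carries at least a quarter of I, so a nonzero total would
survive, relatively to the squared diameter, at the common point of a nested
sequence of rectangles. *)
Lemma additive_rect_eq0 : I a b c d = 0.
Proof.
have [x xP] : exists x, forall k, (Q k).1.1 <= x <= (Q k).1.2.
  apply: nested => k l; have [n1 _ _ _] := Q_mono (leq_maxl k l).
  have [_ n2 _ _] := Q_mono (leq_maxr k l); have [h _] := Q_le (maxn k l).
  exact: le_trans n1 (le_trans h n2).
have [y yP] : exists y, forall k, (Q k).2.1 <= y <= (Q k).2.2.
  apply: nested => k l; have [_ _ n1 _] := Q_mono (leq_maxl k l).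
  have [_ _ _ n2] := Q_mono (leq_maxr k l); have [_ h] := Q_le (maxn k l).
  exact: le_trans n1 (le_trans h n2).
set S := (b - a + (d - c)) ^+ 2.
have S0 : 0 <= S by exact: sqr_ge0.
apply/eqP; rewrite -normr_eq0 eq_le normr_ge0 andbT; apply/ler_addgt0Pr => e e0; rewrite add0r.
have e1 : 0 < e / (S + 1) by rewrite divr_gt0 // ltr_wpDl.
have [r r0 rP] := Ismall (xP 0%N) (yP 0%N) e1.
have [k [k1 k2]] : exists k, (b - a) / 2 ^+ k <= r /\ (d - c) / 2 ^+ k <= r.
  set B := (b - a + (d - c)) / r; exists (Num.bound B).
  have B0 : 0 <= B by rewrite divr_ge0 ?(ltW r0) // addr_ge0 // subr_ge0.
  have B2 : B <= 2 ^+ Num.bound B.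
    by rewrite (le_trans (ltW (archi_boundP B0))) // -natrX ler_nat ltnW // ltn_expl.
  by split; rewrite ler_pdivrMr ?exprn_gt0 // mulrC -ler_pdivrMr // (le_trans _ B2) //
    ler_pM2r ?invr_gt0 // ?lerDl ?lerDr subr_ge0.
have [h1 h2 h3 h4 [h5 h6 h7]] := Q_spec k.
have := rP _ _ _ _ h1 (xP k) h2 h3 (yP k) h4.
rewrite h5 h6 => /(_ k1 k2); rewrite -mulrDl expr_div_n -/S => h.
have p4 : 0 < (4 : R) ^+ k by rewrite exprn_gt0.
rewrite -[I _ _ _ _]/(J (Q 0%N)) (le_trans h7) //.
apply: (le_trans (ler_wpM2l (ltW p4) h)).
have -> : ((2 : R) ^+ k) ^+ 2 = 4 ^+ k by rewrite -exprM mulnC exprM -natrX.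
rewrite mulrCA (mulrCA (4 ^+ k)) mulfV ?gt_eqF // mulr1.
by rewrite mulrAC ler_pdivrMr ?ltr_wpDl // ler_wpM2l ?ltW // ltrDl.
Qed.

End Bisection.

(** U and V are the real and imaginary parts of a function that is differentiable
at every point, with derivative A - i B at (x0, y0). Up to o (diameter ^ 2) the
circulation of V dx + U dy around a small rectangle is that of its linear
approximation, which is zero by the Cauchy-Riemann equations. *)
Lemma goursat (U V PU PV : R -> R -> R) (a b c d : R) : a <= b -> c <= d ->
  (forall x, a <= x <= b -> primitive (PU x) (U x) c d) ->
  (forall y, c <= y <= d -> primitive (PV y) (V^~ y) a b) ->
  (forall x0 y0, a <= x0 <= b -> c <= y0 <= d -> exists A B, forall e, 0 < e ->
     exists2 r, 0 < r & forall x y, a <= x <= b -> c <= y <= d ->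
       `|x - x0| <= r -> `|y - y0| <= r ->
       `|U x y - U x0 y0 - (A * (x - x0) + B * (y - y0))| <= e * (`|x - x0| + `|y - y0|) /\
       `|V x y - V x0 y0 - (A * (y - y0) - B * (x - x0))| <= e * (`|x - x0| + `|y - y0|)) ->
  PU b d - PU b c - (PU a d - PU a c) = PV d b - PV d a - (PV c b - PV c a).
Proof.
move=> ab cd hU hV loc; apply/eqP; rewrite -subr_eq0; apply/eqP.
pose I x1 x2 y1 y2 := PU x2 y2 - PU x2 y1 - (PU x1 y2 - PU x1 y1) -
  (PV y2 x2 - PV y2 x1 - (PV y1 x2 - PV y1 x1)).
apply: (@additive_rect_eq0 I) => //; rewrite /I; [by move=> *; ring|by move=> *; ring|].
move=> x0 y0 x0P y0P e e0; have [A [B AB]] := loc _ _ x0P y0P.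
have [|r r0 rP] := AB (e / 4); first by rewrite divr_gt0.
exists r => // x1 x2 y1 y2 ax1 /andP[x10 x02] x2b cy1 /andP[y10 y02] y2d xr yr.
have x12 := le_trans x10 x02; have y12 := le_trans y10 y02.
set s := x2 - x1; set t := y2 - y1.
have s0 : 0 <= s by rewrite subr_ge0.
have t0 : 0 <= t by rewrite subr_ge0.
have N x y : x1 <= x <= x2 -> y1 <= y <= y2 ->
   `|U x y - U x0 y0 - (A * (x - x0) + B * (y - y0))| <= e / 4 * (s + t) /\
   `|V x y - V x0 y0 - (A * (y - y0) - B * (x - x0))| <= e / 4 * (s + t).
  move=> /andP[xa xb] /andP[ya yb].
  have xs : `|x - x0| <= s by rewrite ler_norml /s; clear -xa xb x10 x02; apply/andP; split; lra.
  have ys : `|y - y0| <= t by rewrite ler_norml /t; clear -ya yb y10 y02; apply/andP; split; lra.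
  have [||||N1 N2] := rP x y; [by clear -xa xb ax1 x2b; apply/andP; split; lra|
    by clear -ya yb cy1 y2d; apply/andP; split; lra|
    by rewrite (le_trans xs)|by rewrite (le_trans ys)|].
  by split; [apply: le_trans N1 _|apply: le_trans N2 _];
    rewrite ler_wpM2l ?lerD // divr_ge0 // ltW.
have x1i : a <= x1 <= b by rewrite ax1 (le_trans x12).
have x2i : a <= x2 <= b by rewrite x2b (le_trans ax1).
have y1i : c <= y1 <= d by rewrite cy1 (le_trans y12).
have y2i : c <= y2 <= d by rewrite y2d (le_trans cy1).
have x1j : x1 <= x1 <= x2 by rewrite lexx.
have x2j : x1 <= x2 <= x2 by rewrite lexx andbT.
have y1j : y1 <= y1 <= y2 by rewrite lexx.
have y2j : y1 <= y2 <= y2 by rewrite lexx andbT.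
have EU : `|(PU x2 y2 - PU x1 y2) - (PU x2 y1 - PU x1 y1) - A * s * t| <= e / 2 * (s + t) * t.
  apply: (primitive_mean (primitiveB (hU _ x2i) (hU _ x1i)) cy1 y12 y2d) => y yi.
  have [N1 _] := N _ _ x1j yi; have [N2 _] := N _ _ x2j yi.
  have -> : U x2 y - U x1 y - A * s = (U x2 y - U x0 y0 - (A * (x2 - x0) + B * (y - y0))) -
     (U x1 y - U x0 y0 - (A * (x1 - x0) + B * (y - y0))) by rewrite /s; ring.
  rewrite (le_trans (ler_normB _ _)) // (le_trans (lerD N2 N1)) //; lra.
have EV : `|(PV y2 x2 - PV y1 x2) - (PV y2 x1 - PV y1 x1) - A * t * s| <= e / 2 * (s + t) * s.
  apply: (primitive_mean (primitiveB (hV _ y2i) (hV _ y1i)) ax1 x12 x2b) => x xi.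
  have [_ N1] := N _ _ xi y1j; have [_ N2] := N _ _ xi y2j.
  have -> : V x y2 - V x y1 - A * t = (V x y2 - V x0 y0 - (A * (y2 - y0) - B * (x - x0))) -
     (V x y1 - V x0 y0 - (A * (y1 - y0) - B * (x - x0))) by rewrite /t; ring.
  rewrite (le_trans (ler_normB _ _)) // (le_trans (lerD N2 N1)) //; lra.
have -> : PU x2 y2 - PU x2 y1 - (PU x1 y2 - PU x1 y1) -
  (PV y2 x2 - PV y2 x1 - (PV y1 x2 - PV y1 x1)) =
  ((PU x2 y2 - PU x1 y2) - (PU x2 y1 - PU x1 y1) - A * s * t) -
  ((PV y2 x2 - PV y1 x2) - (PV y2 x1 - PV y1 x1) - A * t * s) by ring.
rewrite (le_trans (ler_normB _ _)) // (le_trans (lerD EU EV)) //.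
have -> : e / 2 * (s + t) * t + e / 2 * (s + t) * s = (e / 2) * (s + t) ^+ 2 by ring.
by rewrite ler_wpM2r ?sqr_ge0 // ler_pdivrMr // ler_peMr ?ltW // ltr1n.
Qed.

End Goursat.

(** * The complex exponential and the mean value inequality *)

Section ComplexExp.
Variable R : realType.
Implicit Types z w : R[i].

Definition cexp z : R[i] :=
  (expR (complex.Re z))%:C * (cos (complex.Im z) +i* sin (complex.Im z)).

Lemma modc_cexp z : modc (cexp z) = expR (complex.Re z).
Proof.
rewrite /cexp modcM modc_real ger0_norm ?expR_ge0 //.
by rewrite modcE /= cos2Dsin2 sqrtr1 mulr1.
Qed.

Lemma cexpD z w : cexp (z + w) = cexp z * cexp w.
Proof.
case: z => a b; case: w => c d; rewrite /cexp /= expRD cosD sinD.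
by apply/eqP; rewrite eq_complex /=; apply/andP; split; apply/eqP; ring.
Qed.

Lemma cexp0 : cexp 0 = 1.
Proof. by rewrite /cexp /= expR0 cos0 sin0 mul1r. Qed.

Lemma is_derive_lin (f : R -> R) (x l e : R) : is_derive x (1 : R) f l -> 0 < e ->
  exists2 d, 0 < d & forall h, `|h| < d -> `|f (x + h) - f x - l * h| <= e * `|h|.
Proof.
move=> [df <-] e0.
have : (h^-1 *: ((f \o shift x) (h *: (1 : R)) - f x) @[h --> (0 : R)^'] --> 'D_1 f x) by [].
move=> /cvgrPdist_le /(_ _ e0); rewrite near_withinE => /nbhs_ballP[d /= d0 dh].
exists d => // h hd; have [->|h0] := eqVneq h 0.
  by rewrite addr0 subrr mulr0 subr0 normr0 mulr0.
have := dh h; rewrite /ball /= sub0r normrN => /(_ hd h0).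
rewrite /shift /= /GRing.scale /= mulr1 distrC => h1.
have -> : f (x + h) - f x - 'D_1 f x * h = (h^-1 * (f (h + x) - f x) - 'D_1 f x) * h.
  by rewrite mulrBl mulrAC mulVf // mul1r (addrC h).
by rewrite normrM ler_wpM2r.
Qed.

Lemma cdiff_cexp z : cdiff cexp z (cexp z).
Proof.
suff H : cdiff cexp 0 1.
  have H1 : cdiff (fun w => w + (- z)) z (1 + 0) by exact: cdiffD (cdiff_id z) (cdiff_cst _ _).
  have H2 : cdiff cexp (z - z) 1 by rewrite subrr.
  have := cdiffM (cdiff_cst (cexp z) z) (cdiff_comp H1 H2).
  rewrite mul0r add0r addr0 !mulr1; apply: cdiff_eq => w.
  by rewrite -cexpD addrC subrK.
(* The four error terms of the real and imaginary parts add up to 6 k |w|. *)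
move=> e e0; pose k := Num.min (e / 6) 1.
have k0 : 0 < k by rewrite lt_min divr_gt0 // ltr01.
have [d1 d10 h1] := is_derive_lin (is_derive_expR (0 : R)) k0.
have [d2 d20 h2] := is_derive_lin (is_derive_cos (0 : R)) k0.
have [d3 d30 h3] := is_derive_lin (is_derive_sin (0 : R)) k0.
exists (Num.min (Num.min d1 d2) (Num.min d3 (k / 2))).
  by rewrite !lt_min d10 d20 d30 divr_gt0.
move=> w; rewrite subr0 !lt_min => /andP[/andP[w1 w2] /andP[w3 w4]].
have xw := normr_Re_le w; have yw := normr_Im_le w.
have k1 : k <= 1 by rewrite ge_min lexx orbT.
have k6 : k <= e / 6 by rewrite ge_min lexx.
have m0 := modc_ge0 w; rewrite cexp0 mul1r (le_trans (modc_le_ReIm _)) //.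
move: w1 w2 w3 w4 xw yw m0; move: (modc w) => m.
case: w => x y; rewrite /cexp /= => w1 w2 w3 w4 xw yw m0.
have {}h1 := h1 _ (le_lt_trans xw w1).
have {}h2 := h2 _ (le_lt_trans yw w2).
have {}h3 := h3 _ (le_lt_trans yw w3).
move: h1 h2 h3; rewrite !add0r expR0 sin0 cos0 oppr0 mul0r !mul1r !subr0 !addr0 => h1 h2 h3.
rewrite !mul0r !subr0 !addr0.
have ex : `|expR x - 1| <= 2 * m.
  rewrite -[expR x - 1](subrK x) (le_trans (ler_normD _ _)) //.
  rewrite (le_trans (lerD h1 (lexx _))) // mulrDl mul1r lerD // (le_trans _ xw) //.
  by rewrite ler_piMl.
have -> : expR x * cos y - 1 - x = expR x * (cos y - 1) + (expR x - 1 - x) by ring.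
have -> : expR x * sin y - y = expR x * (sin y - y) + (expR x - 1) * y by ring.
have e2 : `|expR x| <= 2.
  rewrite -[expR x](subrK 1) (le_trans (ler_normD _ _)) // normr1; lra.
have b1 : `|expR x * (cos y - 1)| <= 2 * (k * m).
  by rewrite normrM ler_pM // (le_trans h2) // ler_wpM2l // ltW.
have b2 : `|expR x * (sin y - y)| <= 2 * (k * m).
  by rewrite normrM ler_pM // (le_trans h3) // ler_wpM2l // ltW.
have b3 : `|(expR x - 1) * y| <= k * m.
  by rewrite normrM ler_pM //; lra.
have b4 : `|expR x - 1 - x| <= k * m by rewrite (le_trans h1) // ler_wpM2l // ltW.
have km : k * m <= e / 6 * m by rewrite ler_wpM2r.
have t1 := ler_normD (expR x * (cos y - 1)) (expR x - 1 - x).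
have t2 := ler_normD (expR x * (sin y - y)) ((expR x - 1) * y).
lra.
Qed.

Lemma dist_min_le (x y c : R) : `|Num.min x c - Num.min y c| <= `|x - y|.
Proof.
have h1 := ler_norm (x - y); have h2 := ler_norm (y - x); rewrite distrC in h2.
by rewrite ler_norml; case: (leP x c) => ?; case: (leP y c) => ?; apply/andP; split; lra.
Qed.

(** Along the circles of center z0 the function f (z0 + exp w) is holomorphic
and 2 pi i periodic in w, so the Cauchy theorem on [ln s, ln r] x [0, 2 pi]
equates its means over the radii s and r; letting s go to 0 only uses the
continuity of f at z0. *)
Lemma center_le_circle (f : R[i] -> R[i]) (z0 : R[i]) (rho r m : R) : 0 < r -> r < rho ->
  (forall z, 0 < modc (z - z0) < rho -> exists l, cdiff f z l) -> ccont f z0 ->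
  (forall z, modc (z - z0) = r -> complex.Re (f z) <= m) -> complex.Re (f z0) <= m.
Proof.
move=> r0 rrho df cf fm; rewrite leNgt; apply/negP => mf.
pose e := (complex.Re (f z0) - m) / 2.
have e0 : 0 < e by rewrite divr_gt0 // subr_gt0.
have [d d0 dP] := cf _ e0.
pose s := Num.min r (d / 2).
have s0 : 0 < s by rewrite lt_min r0 divr_gt0.
have sr : s <= r by rewrite ge_min lexx.
have sd : s < d by rewrite gt_min; apply/orP; right; rewrite ltr_pdivrMr // ltr_pMr // ltr1n.
pose pt (x y : R) : R[i] := x +i* y.
pose h (w : R[i]) := f (z0 + cexp w).
have mh w : modc (z0 + cexp w - z0) = expR (complex.Re w) by rewrite addrC addKr modc_cexp.
have dh w : complex.Re w <= ln r -> exists l, cdiff h w l.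
  move=> wr; have [|l fl] := df (z0 + cexp w).
    rewrite mh expR_gt0 /= (le_lt_trans _ rrho) //.
    by rewrite -[leRHS]lnK ?ler_expR // posrE.
  exists (l * (0 + cexp w)).
  exact: (@cdiff_comp R f (fun w => z0 + cexp w) w l (0 + cexp w)
    (cdiffD (cdiff_cst _ _) (cdiff_cexp _)) fl).
pose U (x y : R) := complex.Re (h (pt x y)); pose V (x y : R) := complex.Im (h (pt x y)).
have ch w : complex.Re w <= ln r -> forall k, 0 < k -> exists2 t, 0 < t &
    forall w', modc (w' - w) < t -> `|complex.Re (h w') - complex.Re (h w)| < k /\
      `|complex.Im (h w') - complex.Im (h w)| < k.
  move=> /dh[l /cdiff_ccont hl] k k0; have [t t0 tP] := hl _ k0; exists t => // w' /tP h1.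
  have h2 := normr_Re_le (h w' - h w); have h3 := normr_Im_le (h w' - h w).
  by split; [apply: le_lt_trans h1; move: h2|apply: le_lt_trans h1; move: h3];
    case: (h w) => ? ?; case: (h w').
have contU x : x <= ln r -> continuous (U x).
  move=> xr y; apply/cvgrPdist_lt => k k0; have [t t0 tP] := ch (pt x y) xr _ k0.
  apply/nbhs_ballP; exists t => //= y'; rewrite /ball /= => yt.
  rewrite distrC; apply: (tP (pt x y') _).1.
  rewrite (le_lt_trans (modc_le_ReIm _)) //= subrr normr0 add0r.
  by rewrite distrC.
(* Truncated at ln r: h is only controlled on the half plane Re w <= ln r. *)
have contV y : continuous (fun x => V (Num.min x (ln r)) y).
  move=> x; apply/cvgrPdist_lt => k k0.
  have xr : complex.Re (pt (Num.min x (ln r)) y) <= ln r by rewrite /= ge_min lexx orbT.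
  have [t t0 tP] := ch _ xr _ k0.
  apply/nbhs_ballP; exists t => //= x'; rewrite /ball /= => xt.
  rewrite distrC; apply: (tP (pt (Num.min x' (ln r)) y) _).2.
  rewrite (le_lt_trans (modc_le_ReIm _)) //= subrr normr0 addr0 (le_lt_trans _ xt) //.
  by rewrite distrC; exact: dist_min_le.
pose p2 : R := pi *+ 2.
have p20 : 0 < p2 by rewrite mulrn_wgt0 // pi_gt0.
have lnsr : ln s <= ln r by rewrite ler_ln // posrE.
have [PU hPU] : exists PU : R -> R -> R, forall x, ln s <= x <= ln r -> primitive (PU x) (U x) 0 p2.
  suff /choice[PU hPU] : forall x, exists P, ln s <= x <= ln r -> primitive P (U x) 0 p2.
    by exists PU.
  move=> x.
  have [xr|xr] := leP x (ln r); last by exists (fun=> 0); rewrite andbF.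
  by have [G hG] := primitive_exists 0 p2 (contU x xr); exists G.
have [PV hPV] : exists PV : R -> R -> R, forall y, primitive (PV y) (V^~ y) (ln s) (ln r).
  suff /choice[PV hPV] : forall y, exists P, primitive P (V^~ y) (ln s) (ln r) by exists PV.
  move=> y.
  have [G hG] := primitive_exists (ln s) (ln r) (contV y); exists G => x xi.
  by have := hG x xi; rewrite min_l //; case/andP: xi.
have := @goursat R U V PU PV (ln s) (ln r) 0 p2 lnsr (ltW p20) hPU (fun y _ => hPV y).
have -> : PV p2 (ln r) - PV p2 (ln s) - (PV 0 (ln r) - PV 0 (ln s)) = 0.
  have := @primitive_mean R _ _ (ln s) (ln r) (ln s) (ln r) 0 0
    (primitiveB (hPV p2) (hPV 0)) (lexx _) lnsr (lexx _).
  rewrite !mul0r subr0.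
  have -> : PV p2 (ln r) - PV p2 (ln s) - (PV 0 (ln r) - PV 0 (ln s)) =
    PV p2 (ln r) - PV 0 (ln r) - (PV p2 (ln s) - PV 0 (ln s)) by ring.
  move=> H; apply/eqP; rewrite -normr_le0; apply: H => x _.
  by rewrite /V /pt /h /cexp /= cos2pi sin2pi cos0 sin0 !subrr normr0.
have sP : ln s <= ln s <= ln r by rewrite lexx.
have rP : ln s <= ln r <= ln r by rewrite lexx andbT.
have [c1 _ ->] := primitive_MVT (hPU _ rP) (lexx _) (ltW p20) (lexx _).
have [c2 _ ->] := primitive_MVT (hPU _ sP) (lexx _) (ltW p20) (lexx _).
have U1 : U (ln r) c1 <= m by apply: fm; rewrite mh /= lnK // posrE.
have U2 : complex.Re (f z0) - e < U (ln s) c2.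
  have := dP (z0 + cexp (pt (ln s) c2)); rewrite mh /= lnK ?posrE // => /(_ sd) h1.
  have := le_lt_trans (normr_Re_le _) h1; rewrite /U /h.
  case: (f z0) => ? ?; case: (f _) => ? ? /=; rewrite ltr_norml => /andP[? ?]; lra.
rewrite !subr0 -mulrBl => H; have : (U (ln r) c1 - U (ln s) c2) * p2 = 0.
  apply: H => x0 y0 /andP[_ x0r] _; have [l hl] := dh (pt x0 y0) x0r.
  exists (complex.Re l), (- complex.Im l) => k k0.
  have [t t0 tP] := hl _ k0; exists (t / 4); first by rewrite divr_gt0.
  move=> x y _ _ xt yt.
  have E := modc_le_ReIm (pt x y - pt x0 y0).
  have {}tP : modc (h (pt x y) - h (pt x0 y0) - l * (pt x y - pt x0 y0)) <=
      k * (`|x - x0| + `|y - y0|).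
    apply: le_trans (tP _ _) _; first by rewrite (le_lt_trans E) //=; lra.
    by rewrite ler_wpM2l // ltW.
  have T1 := le_trans (normr_Re_le _) tP; have T2 := le_trans (normr_Im_le _) tP.
  move: T1 T2; rewrite /U /V; case: (h (pt x y)) => ? ?; case: (h (pt x0 y0)) => ? ?.
  case: (l) => lr li /= T1 T2.
  split; [apply: le_trans T1|apply: le_trans T2]; rewrite le_eqVlt; apply/orP; left;
    apply/eqP; congr (`|_|); ring.
move/eqP; rewrite mulf_eq0 (gt_eqF p20) orbF subr_eq0 => /eqP U12.
move: U1 U2; rewrite U12 /e; lra.
Qed.
End ComplexExp.

(** * Cauchy's estimate and the three lines theorem *)

Section ThreeLines.
Variable R : realType.
Implicit Types z w : R[i].

Lemma cdiffV (f : R[i] -> R[i]) z a : f z != 0 -> cdiff f z a ->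
  cdiff (fun w => (f w)^-1) z (- f z ^- 2 * a).
Proof.
move=> fz /cdiffP[df <-]; apply/cdiffP.
have H := @der_inv (R[i]) (Cplx R) (f : Cplx R -> R[i]) z 1 fz df.
by split; [apply/cvg_ex; eexists; exact: H|exact/cvg_lim/H].
Qed.

Lemma cdiff_near (f g : R[i] -> R[i]) z a r : 0 < r ->
  (forall w, modc (w - z) < r -> f w = g w) -> cdiff f z a -> cdiff g z a.
Proof.
move=> r0 fg h e e0; have [d d0 dP] := h e e0.
exists (Num.min r d); first by rewrite lt_min r0.
move=> w; rewrite lt_min => /andP[wr wd]; rewrite -!fg ?dP //.
by rewrite subrr modc0.
Qed.

Lemma phase (l : R[i]) : exists2 u : R[i], modc u = 1 & u * l = (modc l)%:C.
Proof.
have [->|l0] := eqVneq l 0; first by exists 1; rewrite ?modc1 // mulr0 modc0.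
exists (conjc l / (modc l)%:C).
  rewrite modcM modcV modc_real modc_conj ger0_norm ?modc_ge0 // mulfV //.
  by rewrite gt_eqF // modc_gt0.
rewrite mulrAC (mulrC (conjc l)) mul_conjc.
have m0 : modc l != 0 by rewrite gt_eqF // modc_gt0.
by apply/eqP; rewrite eq_complex /=; apply/andP; split; apply/eqP; field.
Qed.

(** At a zero of h, Cauchy's estimate for the derivative is the mean value
inequality for the difference quotient, which is continuous there. *)
Lemma cauchy_at_zero (h : R[i] -> R[i]) (z0 l : R[i]) (rho r M : R) : 0 < r -> r < rho ->
  (forall z, modc (z - z0) < rho -> exists l, cdiff h z l) -> h z0 = 0 -> cdiff h z0 l ->
  (forall z, modc (z - z0) = r -> modc (h z) <= M) -> modc l <= M / r.
Proof.
move=> r0 rrho dh h0 hl hM; have [u u1 ul] := phase l.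
pose f w := if w == z0 then u * l else u * h w / (w - z0).
have -> : modc l = complex.Re (f z0) by rewrite /f eqxx ul.
apply: (@center_le_circle R f z0 rho r) => //.
- move=> z /andP[z1 z2]; have [k hk] := dh _ z2.
  rewrite modc_gt0 in z1.
  have H1 : cdiff (fun w => u * h w) z (0 * h z + u * k) by exact: cdiffM (cdiff_cst _ _) hk.
  have H2 : cdiff (fun w => w + (- z0)) z (1 + 0) by exact: cdiffD (cdiff_id _) (cdiff_cst _ _).
  exists ((0 * h z + u * k) * (z - z0)^-1 + (u * h z) * (- (z - z0) ^- 2 * (1 + 0))).
  apply: (@cdiff_near (fun w => u * h w * (w + - z0)^-1) f z _ (modc (z - z0))).
  - by rewrite modc_gt0.
  - move=> w wz; rewrite /f; case: eqP => // wz0.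
    by move: wz; rewrite wz0 modc_distC ltxx.
  - exact: (@cdiffM R (fun w => u * h w) (fun w => (w + - z0)^-1) z _ _ H1
      (@cdiffV (fun w => w + - z0) z _ z1 H2)).
- move=> e e0; have [|d d0 dP] := hl (e / 2); first by rewrite divr_gt0.
  exists d => // w wd; rewrite /f eqxx; case: eqP => [_|/eqP wz]; first by rewrite subrr modc0.
  have wz0 : w - z0 != 0 by rewrite subr_eq0.
  have -> : u * h w / (w - z0) - u * l = u * (h w - h z0 - l * (w - z0)) / (w - z0).
    by rewrite h0; field.
  rewrite !modcM u1 mul1r modcV ltr_pdivrMr ?modc_gt0 // (le_lt_trans (dP _ wd)) //.
  by rewrite ltr_pM2r ?modc_gt0 // ltr_pdivrMr // ltr_pMr // ltr1n.
- move=> z zr; rewrite (le_trans (Re_le_modc _)) // /f.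
  case: eqP => [zz|_]; first by move: zr r0; rewrite zz subrr modc0 => <-; rewrite ltxx.
  by rewrite !modcM u1 mul1r modcV zr ler_wpM2r ?hM // invr_ge0 ltW.
Qed.

Definition strip_cont (h : R[i] -> R[i]) : Prop :=
  forall z, strip z -> forall e : R, 0 < e -> exists2 d : R, 0 < d &
    forall w, strip w -> modc (w - z) < d -> modc (h w - h z) < e.

(** Dividing by 1 + eps z makes h vanish at infinity and does not increase its
modulus. The maximum over a rectangle of the real part, to which a small multiple
of |z - z1| ^ 2 is added, is then attained at an interior point; the mean value
inequality fails there, because the circle means of |z - z1| ^ 2 exceed its value
at the center. *)
Lemma three_lines (h : R[i] -> R[i]) (M c : R) : 0 <= c ->
  (forall z, strip z -> modc (h z) <= M) -> strip_cont h ->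
  (forall z, 0 < complex.Re z < 1 -> exists l, cdiff h z l) ->
  (forall t : R, modc (h (0 +i* t)) <= c) -> (forall t : R, modc (h (1 +i* t)) <= c) ->
  forall z, strip z -> modc (h z) <= c.
Proof.
move=> c0 hM hc hd h0 h1 z1 z1s; rewrite leNgt; apply/negP => cz1.
pose eta := modc (h z1) - c.
have eta0 : 0 < eta by rewrite subr_gt0.
(* Small enough for the value at z1 to stay above c after the division. *)
pose eps := eta / (c * modc z1 + 1).
have den0 : 0 < c * modc z1 + 1 by rewrite ltr_wpDl // mulr_ge0 // modc_ge0.
have eps0 : 0 < eps by rewrite divr_gt0.
pose q z : R[i] := 1 + eps%:C * z.
have Req z : strip z -> 1 <= complex.Re (q z).
  case: z => x y /andP[/= x0 _]; rewrite mul0r subr0 lerDl mulr_ge0 // ltW //.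
have q1 z : strip z -> 1 <= modc (q z) by move=> /Req h2; exact: le_trans h2 (Re_le_modc _).
have q0 z : strip z -> q z != 0.
  by move=> /q1 h2; rewrite -modc_gt0 (lt_le_trans _ h2).
have qIm z : eps * `|complex.Im z| <= modc (q z).
  apply: le_trans (normr_Im_le _); case: z => x y /=.
  by rewrite mul0r addr0 add0r normrM (gtr0_norm eps0).
have [u u1 uk] := phase (h z1 / q z1).
pose k z := u * (h z / q z).
pose v := modc (h z1 / q z1).
have kM z : modc (k z) = modc (h z) / modc (q z) by rewrite /k !modcM u1 mul1r modcV.
have kz1 : complex.Re (k z1) = v by rewrite /k uk.
have qz1 : modc (q z1) <= 1 + eps * modc z1.
  by rewrite (le_trans (modcD _ _)) // modc1 modcM modc_real (gtr0_norm eps0).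
have cv : c < v.
  rewrite /v modcM modcV ltr_pdivlMr ?(lt_le_trans ltr01 (q1 _ z1s)) //.
  rewrite (le_lt_trans (ler_wpM2l c0 qz1)) // mulrDr mulr1 -ltrBDl -/eta.
  have -> : c * (eps * modc z1) = eta * (c * modc z1 / (c * modc z1 + 1)) by rewrite /eps; ring.
  by rewrite gtr_pMr // ltr_pdivrMr // mul1r ltrDl.
have v0 : 0 < v by exact: le_lt_trans cv.
have kle z : strip z -> modc (k z) <= modc (h z).
  move=> zs; rewrite kM ler_pdivrMr ?(lt_le_trans ltr01 (q1 _ zs)) //.
  by rewrite ler_peMr ?modc_ge0 ?q1.
have M0 : 0 <= M by exact: le_trans (modc_ge0 _) (hM _ z1s).
have ev0 : 0 <= eps * v by rewrite ltW // mulr_gt0.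
have M20 : 0 <= 2 * M / (eps * v) by rewrite divr_ge0 // mulr_ge0.
(* At height T the quotient is at most M / (eps T) <= v / 2. *)
pose T := 2 * M / (eps * v) + `|complex.Im z1| + 1.
have T0 : 0 < T by rewrite ltr_wpDl // addr_ge0.
have kT z : strip z -> `|complex.Im z| = T -> modc (k z) <= v / 2.
  move=> zs zT; rewrite kM ler_pdivrMr ?(lt_le_trans ltr01 (q1 _ zs)) //.
  rewrite (le_trans (hM _ zs)) // (le_trans _ (ler_wpM2l (ltW (divr_gt0 v0 _)) (qIm z))) // zT.
  have -> : M = v / 2 * (eps * (2 * M / (eps * v))) by field; rewrite !gt_eqF.
  by rewrite ler_pM2l ?divr_gt0 // ler_pM2l // /T -addrA lerDl addr_ge0 //.
pose c' := Num.max c (v / 2).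
have c'v : c' < v by rewrite gt_max cv ltr_pdivrMr // ltr_pMr // ltr1n.
have c'0 : 0 <= c' by rewrite le_max c0.
pose D := 1 + 4 * T ^+ 2.
have D0 : 0 < D by rewrite ltr_pwDl // mulr_ge0 // sqr_ge0.
pose d := (v - c') / (2 * D).
have d0 : 0 < d by rewrite divr_gt0 ?mulr_gt0 // subr_gt0.
have dD : c' + d * D < v.
  have -> : d * D = (v - c') / 2 by rewrite /d; field; rewrite gt_eqF.
  lra.
pose g (z : R[i]) := complex.Re (k z) + d * ((complex.Re z - complex.Re z1) ^+ 2 + (complex.Im z - complex.Im z1) ^+ 2).
pose A : set (R * R) := `[0, 1]%classic `*` `[- T, T]%classic.
have AP p : A p <-> 0 <= p.1 <= 1 /\ - T <= p.2 <= T by rewrite /A /setX /= !in_itv.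
have z1A : A (complex.Re z1, complex.Im z1).
  apply/AP; split => //=; rewrite -ler_norml /T -addrA addrCA lerDl addr_ge0 //.
have kd z : 0 < complex.Re z < 1 -> exists l, cdiff k z l.
  move=> zi; have [l hl] := hd z zi.
  have zs : strip z by rewrite /strip /=; case/andP: zi => ? ?; rewrite !ltW.
  have Q : cdiff q z (0 + (0 * z + eps%:C * 1)).
    exact: cdiffD (cdiff_cst _ _) (cdiffM (cdiff_cst _ _) (cdiff_id _)).
  eexists; exact: cdiffM (cdiff_cst _ _) (cdiffM hl (cdiffV (q0 _ zs) Q)).
have kc : strip_cont k.
  move=> z zs e e0.
  have e1 : 0 < e / 2 / (modc (q z) + 1) by rewrite !divr_gt0 // ltr_wpDl ?modc_ge0.
  have [t1 t10 t1P] := hc z zs _ e1.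
  have e2 : 0 < e / 2 / (eps * modc (h z) + 1).
    by rewrite !divr_gt0 // ltr_wpDl // mulr_ge0 ?modc_ge0 // (ltW eps0).
  exists (Num.min t1 (e / 2 / (eps * modc (h z) + 1))); first by rewrite lt_min t10.
  move=> w ws; rewrite lt_min => /andP[w1 w2].
  have qw := q0 _ ws; have qz := q0 _ zs.
  have -> : k w - k z = u * (((h w - h z) * q z - h z * (eps%:C * (w - z))) / (q w * q z)).
    by rewrite /k; move: qw qz; rewrite /q => ? ?; field; apply/andP.
  rewrite !modcM u1 mul1r modcV modcM ltr_pdivrMr; last first.
    by rewrite mulr_gt0 // (lt_le_trans ltr01) // q1.
  apply: (@lt_le_trans _ _ e); last first.
    by rewrite ler_peMr ?(ltW e0) // mulr_ege1 // q1.
  rewrite (le_lt_trans (modcB _ _)) // !modcM modc_real (gtr0_norm eps0) (splitr e).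
  rewrite ltrD //.
    rewrite (@le_lt_trans _ _ (modc (h w - h z) * (modc (q z) + 1))) //.
      by rewrite ler_wpM2l ?modc_ge0 // lerDl.
    by rewrite -ltr_pdivlMr ?t1P // ltr_wpDl ?modc_ge0.
  have -> : modc (h z) * (eps * modc (w - z)) = modc (w - z) * (eps * modc (h z)) by ring.
  rewrite (@le_lt_trans _ _ (modc (w - z) * (eps * modc (h z) + 1))) //.
    by rewrite ler_wpM2l ?modc_ge0 // lerDl.
  by rewrite -ltr_pdivlMr // ltr_wpDl // mulr_ge0 ?modc_ge0 // (ltW eps0).
have gc : {within A, continuous (fun p : R * R => g (p.1 +i* p.2))}.
  apply/subspace_continuousP => p /AP[p1 p2].
  have H1 : (fun p' : R * R => complex.Re (k (p'.1 +i* p'.2))) @ within A (nbhs p) -->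
      complex.Re (k (p.1 +i* p.2)).
    apply/cvgrPdist_lt => e e0; rewrite near_withinE.
    have [t t0 tP] := kc (p.1 +i* p.2) p1 _ e0.
    apply/nbhs_ballP; exists (t / 2); first by rewrite /= divr_gt0.
    move=> p'; rewrite /ball /= /prod_ball /ball /= => -[b1 b2] /AP[p'1 p'2].
    have := tP (p'.1 +i* p'.2) p'1; rewrite modc_distC => H.
    have {}H := H (le_lt_trans (modc_le_ReIm _) (_ : _ < t)).
    rewrite modc_distC in H; apply: le_lt_trans (H _); last by rewrite /=; lra.
    apply: le_trans (normr_Re_le _).
    by case: (k _) => ? ?; case: (k _).
  have c1 : (fun p' : R * R => p'.1) @ within A (nbhs p) --> p.1.
    by apply: cvg_within_filter; exact: cvg_fst.
  have c2 : (fun p' : R * R => p'.2) @ within A (nbhs p) --> p.2.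
    by apply: cvg_within_filter; exact: cvg_snd.
  rewrite /g /=; apply: cvgD => //; apply: cvgMr; apply: cvgD.
    by rewrite !expr2; apply: cvgM; apply: cvgB => //; exact: cvg_cst.
  by rewrite !expr2; apply: cvgM; apply: cvgB => //; exact: cvg_cst.
have Ac : compact A by apply: compact_setX; exact: segment_compact.
have An : A !=set0 by eexists; exact: z1A.
have [[x0 y0] /set_mem pA pmax] := compact_EVT_max An Ac gc.
pose z0 : R[i] := x0 +i* y0.
have {}pmax z : 0 <= complex.Re z <= 1 -> - T <= complex.Im z <= T -> g z <= g z0.
  move=> xz yz; have := pmax (complex.Re z, complex.Im z) => /(_ _) /=.
  case: z xz yz => x y /= xz yz; apply.
  by apply/mem_set/AP.
have [/= x0P y0P] := (AP (x0, y0)).1 pA.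
have z0s : strip z0 by [].
have gz0 : v <= g z0.
  rewrite -kz1; have [/= a b] := (AP _).1 z1A; have := pmax z1 a b.
  by rewrite {1}/g !subrr !expr0n /= addr0 mulr0 addr0.
have kz0 : v <= modc (k z0) + d * D.
  rewrite (le_trans gz0) // /g lerD ?Re_le_modc // ler_wpM2l ?(ltW d0) //=.
  have [/= /andP[a b] /andP[a' b']] := (AP _).1 z1A.
  move: x0P y0P => /andP[x0P0 x0P1] /andP[y0P0 y0P1]; rewrite /D lerD //.
    rewrite -[leRHS](expr1n _ 2) -[leLHS]real_normK ?num_real // ler_pXn2r ?nnegrE // ler_norml.
    by clear -x0P0 x0P1 a b; apply/andP; split; lra.
  have -> : 4 * T ^+ 2 = (2 * T) ^+ 2 by ring.
  have T20 : 0 <= 2 * T by rewrite mulr_ge0 // (ltW T0).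
  rewrite -[leLHS]real_normK ?num_real // ler_pXn2r ?nnegrE // ler_norml.
  by clear -y0P0 y0P1 a' b'; apply/andP; split; lra.
have kz0' : c' < modc (k z0) by rewrite -(ltrD2r (d * D)) (lt_le_trans dD).
have x0i : 0 < x0 < 1.
  move: x0P => /andP[a b]; rewrite !lt_neqAle a b !andbT eq_sym; apply/andP; split; apply/eqP => E.
    move: kz0'; rewrite ltNge le_max /z0 E (le_trans (kle _ _)) ?h0 //.
    by rewrite /strip /= lexx ler01.
  move: kz0'; rewrite ltNge le_max /z0 E (le_trans (kle _ _)) ?h1 //.
  by rewrite /strip /= lexx ler01.
have y0i : - T < y0 < T.
  rewrite -ltr_norml lt_neqAle ler_norml y0P andbT; apply/eqP => E.
  by move: kz0'; rewrite ltNge le_max (kT z0) // orbT.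
pose rho := Num.min (Num.min x0 (1 - x0)) (Num.min (T - y0) (T + y0)).
have rho0 : 0 < rho.
  rewrite !lt_min; clear -x0i y0i; case/andP: x0i => ? ?; case/andP: y0i => ? ?.
  by apply/andP; split; apply/andP; split; lra.
have inR z : modc (z - z0) < rho -> 0 < complex.Re z < 1 /\ - T <= complex.Im z <= T.
  rewrite !lt_min => /andP[/andP[a1 a2] /andP[a3 a4]].
  have := normr_Re_le (z - z0); have := normr_Im_le (z - z0).
  move: (modc (z - z0)) a1 a2 a3 a4 => mm a1 a2 a3 a4.
  clear -a1 a2 a3 a4; case: z => x y /=; rewrite !ler_norml => /andP[? ?] /andP[? ?].
  by split; apply/andP; split; lra.
pose r := rho / 2.
have r0 : 0 < r by rewrite divr_gt0.
have rrho : r < rho by rewrite ltr_pdivrMr // ltr_pMr // ltr1n.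
(* The linear part at z0 of d |z - z1| ^ 2, so that on the circle of radius r the
   maximality of z0 reads Re f <= Re (k z0) - d r ^ 2. *)
pose a := (2 * d)%:C * conjc (z0 - z1).
pose f z := k z + a * (z - z0).
have : complex.Re (f z0) <= complex.Re (k z0) - d * r ^+ 2.
  apply: (@center_le_circle R f z0 rho r) => //.
  - move=> z /andP[_ /inR[zi _]]; have [l hl] := kd _ zi; eexists.
    exact: cdiffD hl (cdiffM (cdiff_cst a z) (cdiffD (cdiff_id z) (cdiff_cst (- z0) z))).
  - have [l hl] := kd z0 x0i; apply: cdiff_ccont.
    exact: cdiffD hl (cdiffM (cdiff_cst a z0) (cdiffD (cdiff_id z0) (cdiff_cst (- z0) z0))).
  move=> z zr; have [|zi1 zi2] := inR z; first by rewrite zr.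
  have zi3 : 0 <= complex.Re z <= 1 by case/andP: zi1 => ? ?; rewrite !ltW.
  have := pmax z zi3 zi2; rewrite /g /f -zr sqr_modc /a /z0.
  clear.
  by case: (k z) => ? ?; case: (k _) => ? ?; case: (z) => x y; case: (z1) => x1 y1 /=; lra.
by rewrite /f subrr mulr0 addr0 leNgt gtrBl // mulr_gt0 // exprn_gt0.
Qed.
End ThreeLines.

(** * The blocks of J *)

Section Blocks.
Variable R : realType.

Definition eps (n : nat) : R := (Num.sqrt n%:R)^-1.

(** The index of the block of the coordinate j: since J_offset n + 32 = 2 ^ n.+1,
the block n consists of the j with 2 ^ n.+1 <= j + 32 < 2 ^ n.+2. *)
Definition blk (j : nat) : nat := (trunc_log 2 (j + 32)).-1.

Lemma J_offsetS n : (4 <= n)%N -> J_offset n.+1 = (J_offset n + J_dim n)%N.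
Proof. by move=> n4; rewrite /J_offset big_nat_recr. Qed.

Lemma J_offsetE n : (4 <= n)%N -> (J_offset n + 32 = 2 ^ n.+1)%N.
Proof.
elim: n => // n IH; rewrite leq_eqVlt => /predU1P[[<-]|]; first by rewrite /J_offset big_geq.
rewrite ltnS => n4; rewrite J_offsetS // addnAC IH // /J_dim addnn -mul2n.
by rewrite [in RHS]expnS.
Qed.

Lemma blkE n i : (4 <= n)%N -> (i < J_dim n)%N -> blk (J_offset n + i) = n.
Proof.
move=> n4 iJ; rewrite /blk addnAC J_offsetE // (@trunc_log_eq 2 n.+1) // leq_addr /=.
by rewrite (expnS 2 n.+1) mul2n -addnn ltn_add2l.
Qed.

Lemma blk_ge4 j : (4 <= blk j)%N.
Proof.
have h : (5 <= trunc_log 2 (j + 32))%N by rewrite trunc_log_max // leq_addl.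
by rewrite /blk; case: trunc_log h.
Qed.

Lemma blk_offset j : exists2 i, (i < J_dim (blk j))%N & j = (J_offset (blk j) + i)%N.
Proof.
have := @trunc_log_bounds 2 (j + 32) isT; rewrite addn_gt0 orbT => /(_ isT) /=.
have h := blk_ge4 j; have e : trunc_log 2 (j + 32) = (blk j).+1.
  by rewrite /blk prednK // (leq_trans _ (_ : 5 <= _)%N) // trunc_log_max // leq_addl.
rewrite e -(J_offsetE h) leq_add2r => /andP[h1 h2].
exists (j - J_offset (blk j))%N; last by rewrite subnKC.
rewrite ltn_subLR // -(ltn_add2r 32) addnAC J_offsetE //.
by rewrite /J_dim addnn -mul2n -expnS.
Qed.

Lemma leq_J_offset m n : (m <= n)%N -> (J_offset m <= J_offset n)%N.
Proof.
move=> mn; have [n4|n4] := leqP n 4; last first.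
  elim: n mn n4 => // n IH; rewrite leq_eqVlt => /predU1P[-> //|]; rewrite ltnS => mn n4.
  rewrite J_offsetS //; have [n4'|n4'] := leqP n 4; last by rewrite (leq_trans (IH mn n4')) // leq_addr.
  by have -> : J_offset m = 0%N by rewrite /J_offset big_geq // (leq_trans mn).
by rewrite [J_offset m]big_geq // (leq_trans mn).
Qed.

Lemma blk_lt j N : (4 <= N)%N -> (blk j < N)%N = (j < J_offset N)%N.
Proof.
move=> N4; have [i iJ ->] := blk_offset j; have b4 := blk_ge4 j; move: (blk j) iJ b4 => b iJ b4.
rewrite blkE //; have [bN|Nb] := ltnP b N.
  by rewrite (leq_trans _ (leq_J_offset bN)) // J_offsetS // ltn_add2l.
by apply/esym; rewrite ltnNge (leq_trans (leq_J_offset Nb)) ?leq_addr.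
Qed.

Lemma J_offset_unbounded M : exists2 N, (4 <= N)%N & (M <= J_offset N)%N.
Proof.
exists (blk M).+1; first by rewrite leqW // blk_ge4.
by rewrite ltnW // -blk_lt // leqW // blk_ge4.
Qed.

Lemma sum_blocks (V : nmodType) (a : nat -> V) N : (4 <= N)%N ->
  \sum_(j < J_offset N) a j = \sum_(4 <= n < N) \sum_(i < J_dim n) a (J_offset n + i)%N.
Proof.
elim: N => // N IH; rewrite leq_eqVlt => /predU1P[[<-]|].
  by rewrite [RHS]big_geq // [J_offset 4]big_geq // big_ord0.
rewrite ltnS => N4; rewrite big_nat_recr //= -IH // J_offsetS //.
by rewrite big_split_ord /=; congr (_ + _); apply: eq_bigr.
Qed.

Lemma eps_ge0 n : 0 <= eps n. Proof. by rewrite invr_ge0 sqrtr_ge0. Qed.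

Lemma sqr_eps n : eps n ^+ 2 = n%:R^-1.
Proof. by rewrite exprVn sqr_sqrtr. Qed.

Lemma eps_le_half n : (4 <= n)%N -> eps n <= 2^-1.
Proof.
move=> n4; rewrite lef_pV2 ?posrE ?sqrtr_gt0 ?ltr0n ?(leq_trans _ n4) //.
by rewrite -(@ler_sqr R) ?nnegrE ?sqrtr_ge0 // sqr_sqrtr // -natrX ler_nat.
Qed.

(** The reciprocal of p_n, so that 1 - theta n is the reciprocal of the conjugate
exponent. *)
Definition theta (n : nat) : R := 2^-1 + eps n.

Lemma J_expE n : J_exp R n = (theta n)^-1. Proof. by []. Qed.

Lemma theta_gt0 n : 0 < theta n. Proof. by rewrite ltr_wpDr ?eps_ge0 // invr_gt0. Qed.

Lemma theta_le1 n : (4 <= n)%N -> theta n <= 1.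
Proof. move=> /eps_le_half; rewrite /theta; lra. Qed.

Lemma young_powR (a w t : R) : 0 <= a -> 0 <= w -> 0 < t -> t <= 1 ->
  a `^ t * w `^ (1 - t) <= t * a + (1 - t) * w.
Proof.
move=> a0 w0 t0 t1; have t1' : 0 <= 1 - t by rewrite subr_ge0.
have [->|an] := eqVneq a 0; first by rewrite powR0 ?gt_eqF // mul0r mulr0 add0r mulr_ge0.
have [->|wn] := eqVneq w 0.
  have [->|tn] := eqVneq t 1; first by rewrite subrr powRr0 powRr1 // mul0r addr0 !mul1r mulr1.
  by rewrite powR0 ?subr_eq0 1?eq_sym // !mulr0 addr0 mulr_ge0 // ltW.
have {an}a0 : 0 < a by rewrite lt_neqAle eq_sym an.
have {wn}w0 : 0 < w by rewrite lt_neqAle eq_sym wn.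
rewrite /powR !gt_eqF // -expRD; move Em : (_ + _) => m.
have h1 : expR m * (1 + (ln a - m)) <= a.
  rewrite -[leRHS](@lnK R) // -[ln a in leRHS](subrKC m) [leRHS]expRD.
  by rewrite ler_wpM2l ?expR_ge0 // expR_ge1Dx.
have h2 : expR m * (1 + (ln w - m)) <= w.
  rewrite -[leRHS](@lnK R) // -[ln w in leRHS](subrKC m) [leRHS]expRD.
  by rewrite ler_wpM2l ?expR_ge0 // expR_ge1Dx.
have := lerD (ler_wpM2l (ltW t0) h1) (ler_wpM2l t1' h2); apply: le_trans.
rewrite le_eqVlt; apply/orP; left; apply/eqP; rewrite -Em; ring.
Qed.

Section FiniteSums.
Variable k : nat.
Implicit Types (a w b : 'I_k -> R).

(** Hoelder's inequality for the exponents 1/t and 1/(1 - t), with a normalised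
second factor; the convention x `^ 0 = 1 covers t = 1, which occurs for n = 4. *)
Lemma holder_weight a w t : 0 < t -> t <= 1 -> (forall i, 0 <= a i) -> (forall i, 0 <= w i) ->
  \sum_i w i <= 1 ->
  \sum_i a i * w i `^ (1 - t) <= (\sum_i a i `^ t^-1) `^ t.
Proof.
move=> t0 t1 a0 w0 w1; set S := \sum_i a i `^ t^-1.
have S0 : 0 <= S by apply: sumr_ge0 => i _; exact: powR_ge0.
have tn : t != 0 by rewrite gt_eqF.
have [S00|Sn] := eqVneq S 0.
  rewrite S00 powR0 // big1 // => i _.
  have : a i `^ t^-1 == 0.
    have := S00; rewrite /S => /eqP; rewrite psumr_eq0 => [/allP|? _]; last exact: powR_ge0.
    by apply; rewrite mem_index_enum.
  by rewrite powR_eq0 => /andP[/eqP -> _]; rewrite mul0r.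
have {Sn}S0 : 0 < S by rewrite lt_neqAle eq_sym Sn.
have E i : a i = S `^ t * (a i `^ t^-1 / S) `^ t.
  rewrite -powRM ?powR_ge0 ?divr_ge0 ?powR_ge0 // ?ltW // mulrC divfK ?gt_eqF //.
  by rewrite -powRrM mulVf // powRr1.
rewrite (eq_bigr (fun i => S `^ t * ((a i `^ t^-1 / S) `^ t * w i `^ (1 - t)))); last first.
  by move=> i _; rewrite {1}E mulrA.
rewrite -mulr_sumr ler_piMr ?powR_ge0 //.
apply: (@le_trans _ _ (\sum_i (t * (a i `^ t^-1 / S) + (1 - t) * w i))).
  apply: ler_sum => i _; apply: young_powR => //; by rewrite divr_ge0 ?powR_ge0 // ltW.
rewrite big_split /= -!mulr_sumr -mulr_suml -/S mulfV ?gt_eqF // mulr1.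
rewrite -[leRHS](subrKC t) lerD2l ler_piMr // subr_ge0 //.
Qed.

End FiniteSums.

Lemma cauchy_schwarz_sum (I : Type) (s : seq I) (P : pred I) (f g : I -> R) (A B : R) :
  0 <= A -> 0 <= B ->
  \sum_(i <- s | P i) f i ^+ 2 <= A ^+ 2 -> \sum_(i <- s | P i) g i ^+ 2 <= B ^+ 2 ->
  \sum_(i <- s | P i) f i * g i <= A * B.
Proof.
move=> A0 B0 hA hB.
(* The geometric mean is below the arithmetic one with weight t; the best t is
   B / A, here perturbed because A and B may vanish. *)
have H t : 0 < t -> \sum_(i <- s | P i) f i * g i <= (A ^+ 2 * t + B ^+ 2 / t) / 2.
  move=> t0; apply: (@le_trans _ _ (\sum_(i <- s | P i) (f i ^+ 2 * t + g i ^+ 2 / t) / 2)).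
    apply: ler_sum => i _; rewrite ler_pdivlMr //.
    have := sqr_ge0 (f i * t - g i); rewrite -(ler_pM2r (_ : 0 < t^-1)) ?invr_gt0 // mul0r.
    have -> : (f i * t - g i) ^+ 2 / t = f i ^+ 2 * t + g i ^+ 2 / t - f i * g i * 2.
      by field; rewrite gt_eqF.
    by rewrite subr_ge0.
  rewrite -mulr_suml big_split /= -!mulr_suml ler_wpM2r ?invr_ge0 // lerD //.
    by rewrite ler_wpM2r // ltW.
  by rewrite ler_wpM2r // invr_ge0 ltW.
apply/ler_addgt0Pr => e e0.
have A1 : 0 < A + 1 by rewrite ltr_wpDl.
pose d := e / (A + B + 1); have d0 : 0 < d by rewrite divr_gt0 // ltr_wpDl // addr_ge0.
have Bd : 0 < B + d by rewrite ltr_wpDl.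
have Ad : 0 < A + d by rewrite ltr_wpDl.
apply: (le_trans (H ((B + d) / (A + d)) (divr_gt0 Bd Ad))).
have h1 : A ^+ 2 * ((B + d) / (A + d)) <= A * (B + d).
  rewrite expr2 -mulrA ler_wpM2l // mulrA ler_pdivrMr // mulrC ler_wpM2l // ?lerDl ltW //.
have h2 : B ^+ 2 / ((B + d) / (A + d)) <= B * (A + d).
  rewrite invf_div expr2 -mulrA ler_wpM2l // mulrA ler_pdivrMr // mulrC ler_wpM2l // ?lerDl ltW //.
have h3 : (A + B) * d <= e * 2.
  rewrite /d mulrA ler_pdivrMr ?ltr_wpDl ?addr_ge0 //; have := addr_ge0 A0 B0; nra.
lra.
Qed.

Definition block2 (n : nat) (y : omega R) : R :=
  Num.sqrt (\sum_(i < J_dim n) modc (y (J_offset n + i)%N) ^+ 2).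

Lemma block2_ge0 n y : 0 <= block2 n y. Proof. exact: sqrtr_ge0. Qed.

Lemma sqr_block2 n y : block2 n y ^+ 2 = \sum_(i < J_dim n) modc (y (J_offset n + i)%N) ^+ 2.
Proof. by rewrite sqr_sqrtr // sumr_ge0 // => i _; rewrite sqr_ge0. Qed.

Lemma modc_le_block2 (y : omega R) j : modc (y j) <= block2 (blk j) y.
Proof.
have [i iJ {1}->] := blk_offset j.
rewrite -ler_sqr ?nnegrE ?modc_ge0 ?block2_ge0 // sqr_block2 (bigD1 (Ordinal iJ)) //=.
by rewrite lerDl sumr_ge0 // => ? _; rewrite sqr_ge0.
Qed.

(** The l_2-norm is at most |c|, as a family of inequalities between finite sums. *)
Definition l2le (y : omega R) (c : R) : Prop :=
  forall M, \sum_(j < M) modc (y j) ^+ 2 <= c ^+ 2.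

Lemma l2leP (y : omega R) c : 
  l2le y c <-> forall N, (4 <= N)%N -> \sum_(4 <= n < N) block2 n y ^+ 2 <= c ^+ 2.
Proof.
split=> [h N N4|h M].
  by rewrite (eq_bigr _ (fun n _ => sqr_block2 n y)) -(sum_blocks (fun j => modc (y j) ^+ 2)) // h.
have [N N4 MN] := J_offset_unbounded M; apply: le_trans (h N N4).
rewrite (eq_bigr _ (fun n _ => sqr_block2 n y)) -(sum_blocks (fun j => modc (y j) ^+ 2)) //.
rewrite -(big_mkord xpredT (fun j => modc (y j) ^+ 2)) -(big_mkord xpredT (fun j => modc (y j) ^+ 2)).
by rewrite (big_cat_nat (leq0n M) MN) //= lerDl sumr_ge0 // => ? _; rewrite sqr_ge0.
Qed.

Lemma l2le_coord (y : omega R) c j : 0 <= c -> l2le y c -> modc (y j) <= c.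
Proof.
move=> c0 /(_ j.+1); rewrite big_ord_recr /= => h.
rewrite -ler_sqr ?nnegrE ?modc_ge0 // (le_trans _ h) // lerDr sumr_ge0 // => ? _.
by rewrite sqr_ge0.
Qed.

Lemma l2leW (y : omega R) c d : 0 <= c -> c <= d -> l2le y c -> l2le y d.
Proof.
by move=> c0 cd h M; rewrite (le_trans (h M)) // ler_pXn2r // nnegrE // (le_trans c0).
Qed.

Lemma J_block_norm_ge0 n (x : omega R) : 0 <= J_block_norm n x.
Proof. exact: powR_ge0. Qed.

Lemma J_norm_leP (x : omega R) c : 0 <= c ->
  (J_norm x <= c%:E)%E <-> forall N, \sum_(4 <= n < N) J_block_norm n x ^+ 2 <= c ^+ 2.
Proof.
move=> c0; have s0 n : (0 <= (J_block_norm n x ^+ 2)%:E)%E by rewrite lee_fin sqr_ge0.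
have -> : c%:E = sqrte ((c ^+ 2)%:E) by rewrite /sqrte /= sqrtr_sqr ger0_norm.
rewrite /J_norm lee_sqrt ?lee_fin ?sqr_ge0 //; split=> [h N|h].
  rewrite -lee_fin -sumEFin; apply: le_trans h.
  by apply: nneseries_lim_ge => n _ _; exact: s0.
apply: lime_le; first by apply: is_cvg_nneseries => n _ _; exact: s0.
by near=> N; rewrite sumEFin lee_fin.
Unshelve. all: by end_near. Qed.

Lemma J_norm_ge0 (x : omega R) : (0 <= J_norm x)%E. Proof. exact: sqrte_ge0. Qed.

Lemma J_block_le (x : omega R) c n : 0 <= c -> (J_norm x <= c%:E)%E -> (4 <= n)%N ->
  J_block_norm n x <= c.
Proof.
move=> c0 /(J_norm_leP _ c0)/(_ n.+1) + n4; rewrite big_nat_recr //= => h.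
rewrite -ler_sqr ?nnegrE ?J_block_norm_ge0 // (le_trans _ h) // lerDr sumr_ge0 // => ? _.
by rewrite sqr_ge0.
Qed.

Lemma modc_le_J_block (x : omega R) j : modc (x j) <= J_block_norm (blk j) x.
Proof.
have [i iJ {1}->] := blk_offset j; rewrite /J_block_norm J_expE invrK.
set n := blk j; have t0 : 0 < theta n := theta_gt0 n; have tn : theta n != 0 by rewrite gt_eqF.
rewrite -[leLHS]powRr1 ?modc_ge0 // -(mulVf tn) powRrM.
apply: ge0_ler_powR; rewrite ?(ltW t0) // ?nnegrE ?powR_ge0 //.
  by apply: sumr_ge0 => ? _; exact: powR_ge0.
rewrite (bigD1 (Ordinal iJ)) //= lerDl; apply: sumr_ge0 => ? _; exact: powR_ge0.
Qed.

(** Norms on a block are bounded through weights because weights, unlike the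
vectors, can be averaged: this gives a common majorant for two vectors. *)
Lemma J_block_le_weight n (x : omega R) (w : 'I_(J_dim n) -> R) (s : R) : 0 <= s ->
  (forall i, 0 <= w i) -> \sum_i w i <= 1 ->
  (forall i : 'I_(J_dim n), modc (x (J_offset n + i)%N) <= s * w i `^ theta n) ->
  J_block_norm n x <= s.
Proof.
move=> s0 w0 w1 h; rewrite /J_block_norm J_expE invrK.
have t0 := theta_gt0 n; have tn : theta n != 0 by rewrite gt_eqF.
have H : \sum_(i < J_dim n) modc (x (J_offset n + i)%N) `^ (theta n)^-1 <= s `^ (theta n)^-1.
  apply: (@le_trans _ _ (\sum_(i < J_dim n) s `^ (theta n)^-1 * w i)).
    apply: ler_sum => i _.
    have -> : w i = (w i `^ theta n) `^ (theta n)^-1 by rewrite -powRrM mulfV // powRr1.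
    rewrite -powRM ?powR_ge0 //.
    apply: ge0_ler_powR; rewrite ?invr_ge0 ?nnegrE ?modc_ge0 ?mulr_ge0 ?powR_ge0 //.
    by rewrite (ltW t0).
  by rewrite -mulr_sumr ler_piMr ?powR_ge0.
rewrite -[leRHS]powRr1 // -(mulVf tn) powRrM; apply: ge0_ler_powR => //; rewrite ?(ltW t0) ?nnegrE ?powR_ge0 //.
by apply: sumr_ge0 => ? _; exact: powR_ge0.
Qed.

(** On each block these weights sum to 1, or to 0 if y vanishes there. *)
Definition wgt (y : omega R) (j : nat) : R := modc (y j) ^+ 2 / block2 (blk j) y ^+ 2.

Lemma wgt_ge0 y j : 0 <= wgt y j.
Proof. by rewrite divr_ge0 // sqr_ge0. Qed.

Lemma sum_wgt y n : (4 <= n)%N -> \sum_(i < J_dim n) wgt y (J_offset n + i)%N <= 1.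
Proof.
move=> n4; rewrite (eq_bigr (fun i : 'I_(J_dim n) =>
  modc (y (J_offset n + i)%N) ^+ 2 / block2 n y ^+ 2)); last first.
  by move=> i _; rewrite /wgt blkE.
rewrite -mulr_suml -sqr_block2; have [->|b0] := eqVneq (block2 n y ^+ 2) 0.
  by rewrite mul0r.
by rewrite mulfV.
Qed.

(** Sequences dominated by the conjugate weights of g, scaled by its block norms,
act on J with norm at most |g|: Hoelder on each block, Cauchy-Schwarz over the
blocks. *)
Lemma J_pairing (u g : omega R) (D : nat -> R) (c a : R) N : (4 <= N)%N -> 0 <= c -> 0 <= a ->
  (J_norm u <= c%:E)%E -> l2le g a ->
  (forall j, D j <= block2 (blk j) g * wgt g j `^ (1 - theta (blk j))) ->
  \sum_(j < J_offset N) modc (u j) * D j <= c * a.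
Proof.
move=> N4 c0 a0 /(J_norm_leP _ c0) uc /l2leP ga hD.
rewrite (sum_blocks (fun j => modc (u j) * D j)) //.
apply: (@le_trans _ _ (\sum_(4 <= n < N) J_block_norm n u * block2 n g)); last first.
  by apply: cauchy_schwarz_sum => //; exact: ga.
apply: ler_sum_nat => n /andP[n4 _].
apply: (@le_trans _ _ (\sum_(i < J_dim n) modc (u (J_offset n + i)%N) *
   (block2 n g * wgt g (J_offset n + i)%N `^ (1 - theta n)))).
  apply: ler_sum => i _; rewrite ler_wpM2l ?modc_ge0 //.
  by have := hD (J_offset n + i)%N; rewrite blkE.
rewrite (eq_bigr (fun i : 'I_(J_dim n) => block2 n g * (modc (u (J_offset n + i)%N) *
   wgt g (J_offset n + i)%N `^ (1 - theta n)))); last by move=> i _; rewrite mulrCA.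
rewrite -mulr_sumr mulrC ler_wpM2r ?block2_ge0 // /J_block_norm J_expE invrK.
apply: holder_weight; [exact: theta_gt0|exact: theta_le1|by move=> i; exact: modc_ge0|
  by move=> i; exact: wgt_ge0|exact: sum_wgt].
Qed.

End Blocks.

(** * Convergence of series *)

Section Series.
Variable R : realType.

Lemma partial_sums_le_half (a : nat -> R) (C : R) : (forall j, 0 <= a j) ->
  (forall N, (4 <= N)%N -> \sum_(j < J_offset N) a j <= C) -> forall M, \sum_(j < M) a j <= C.
Proof.
move=> a0 h M; have [N N4 MN] := J_offset_unbounded M; apply: le_trans (h N N4).
rewrite -(big_mkord xpredT a) -(big_mkord xpredT a).
by rewrite (big_cat_nat (leq0n M) MN) //= lerDl sumr_ge0.
Qed.

Lemma tail_small (b : nat -> R) (C d : R) : (forall n, 0 <= b n) ->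
  (forall N, \sum_(4 <= n < N) b n <= C) -> 0 < d ->
  exists2 N0, (4 <= N0)%N & forall N, \sum_(N0 <= n < N) b n <= d.
Proof.
move=> b0 bC d0; pose S := range (fun N => \sum_(4 <= n < N) b n).
have hs : has_sup S by split; [exists (\sum_(4 <= n < 0) b n), 0%N|exists C => _ [N _ <-]].
have [_ [N1 _ <-] hN] := sup_adherent d0 hs.
exists (maxn 4 N1); first exact: leq_maxl.
move=> N; have [NN|NN] := leqP N (maxn 4 N1); first by rewrite big_geq // ltW.
have h1 : \sum_(4 <= n < N) b n <= sup S by apply: ub_le_sup; [exact: hs.2|exists N].
rewrite (big_cat_nat (leq_maxl 4 N1) (ltnW NN)) /= in h1.
have h2 : \sum_(4 <= n < N1) b n <= \sum_(4 <= n < maxn 4 N1) b n.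
  have [N14|N14] := leqP 4 N1; last by rewrite (@big_geq _ _ _ 4 N1) ?sumr_ge0 // ltnW.
  by [].
lra.
Qed.

Lemma abs_series_cvg (a : nat -> R) (C : R) : (forall M, \sum_(j < M) `|a j| <= C) ->
  cvgn (series a).
Proof.
move=> h; apply: normed_cvg; apply: nondecreasing_is_cvgn.
  apply/nondecreasing_seqP => n; have := lerDl (\sum_(0 <= k < n) `|a k|) `|a n|.
  by rewrite -big_nat_recr //= normr_ge0.
by exists C => _ [n _ <-]; have := h n; rewrite -(big_mkord xpredT (fun j => `|a j|)).
Qed.

Lemma cabs_series_cvg (a : nat -> Cplx R) (C : R) : (forall M, \sum_(j < M) modc (a j) <= C) ->
  exists2 s : Cplx R, series a @ \oo --> s & modc s <= C.
Proof.
move=> h.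
have hr : cvgn (series (fun j => complex.Re (a j))).
  by apply: (@abs_series_cvg _ C) => M; rewrite (le_trans _ (h M)) // ler_sum // => i _; exact: normr_Re_le.
have hi : cvgn (series (fun j => complex.Im (a j))).
  by apply: (@abs_series_cvg _ C) => M; rewrite (le_trans _ (h M)) // ler_sum // => i _; exact: normr_Im_le.
have E n : series a n = (series (fun j => complex.Re (a j)) n) +i* (series (fun j => complex.Im (a j)) n).
  rewrite /series /=; elim: n => [|n IH]; first by rewrite !big_geq.
  rewrite !big_nat_recr //= IH; case: (a n) => p q.
  by apply/eqP; rewrite eq_complex /= !eqxx.
pose s : Cplx R := (limn (series (fun j => complex.Re (a j)))) +i* (limn (series (fun j => complex.Im (a j)))).
have cs : series a @ \oo --> s.
  apply/cvgc_modcP => e e0.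
  move/cvgrPdist_lt: hr => /(_ (e / 2)) hr; move/cvgrPdist_lt: hi => /(_ (e / 2)) hi.
  near=> n; rewrite E /s (le_lt_trans (modc_le_ReIm _)) //= (splitr e).
  by rewrite distrC (distrC (series (fun j => complex.Im (a j)) n)) ltrD //; near: n;
    [apply: hr|apply: hi]; rewrite divr_gt0.
exists s => //; move: s cs => s cs; apply/ler_addgt0Pr => e e0.
have /cvgc_modcP/(_ e e0) := cs; case=> n _ /(_ n (leqnn n)) hn.
have {hn}hn := ltW hn.
have -> : modc s = modc (series a n - (series a n - s)) by congr (modc _); rewrite opprB addrCA subrr addr0.
rewrite (le_trans (modcB _ _)) // lerD //.
rewrite /series /= (le_trans (modc_sum _ _ _)) //.
by rewrite big_mkord.
Unshelve. all: by end_near. Qed.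

Lemma cvge0_near (T : Type) (F : set_system T) (FF : Filter F) (f : T -> \bar R) :
  (forall t, (0 <= f t)%E) -> (forall e : R, 0 < e -> \forall t \near F, (f t <= e%:E)%E) ->
  f @ F --> (0%E : \bar R).
Proof.
move=> f0 h A /= [e e0 eA].
have := h (e / 2); rewrite divr_gt0 // => /(_ isT); apply: filterS => t ft; change (A (f t)).
have := f0 t; case: (f t) ft => [r| |] //; rewrite !lee_fin => re r0.
apply: (eA r); rewrite /ball_ /= sub0r normrN ger0_norm // (le_lt_trans re) //.
by rewrite ltr_pdivrMr // ltr_pMr // ltr1n.
Qed.

End Series.

(** * The dual norm *)

Section Dual.
Variable R : realType.
Implicit Types (u y : omega R).

Lemma space_fin u : Defs.space (@J_norm R) u -> exists2 c, 0 <= c & J_norm u = c%:E.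
Proof.
rewrite /Defs.space /=; have := J_norm_ge0 u; case: (J_norm u) => [r| |] //.
by rewrite lee_fin => r0 _; exists r.
Qed.

Lemma dual_norm_le y (M : R) : 0 <= M ->
  (forall u c, 0 <= c -> (J_norm u <= c%:E)%E -> forall N, (4 <= N)%N ->
    \sum_(j < J_offset N) modc (u j) * modc (y j) <= c * M) ->
  (dual_norm (@J_norm R) y <= M%:E)%E.
Proof.
move=> M0 h; apply: ereal_inf_lbound; exists M => //; split=> // u /space_fin[c c0 uc].
have [|s su sM] := @cabs_series_cvg R (fun j => u j * y j) (c * M).
  apply: (@partial_sums_le_half _ (fun j => modc (u j * y j))) => [j|N N4]; first exact: modc_ge0.
  rewrite (eq_bigr (fun j : 'I__ => modc (u j) * modc (y j))); last by move=> j _; rewrite modcM.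
  by apply: h => //; rewrite uc.
by exists s => //; rewrite uc -EFinM lee_fin mulrC.
Qed.

Lemma dual_norm_ge0 y : (0 <= dual_norm (@J_norm R) y)%E.
Proof. by apply: le_ereal_inf_tmp => _ [M [M0 _] <-]; rewrite lee_fin. Qed.

(** The series in the definition of the dual norm is eventually constant for a
finitely supported u, so its limit is this finite sum. *)
Lemma dual_norm_pairing y (c a : R) (L : nat) u : (dual_norm (@J_norm R) y < c%:E)%E ->
  0 <= a -> (J_norm u <= a%:E)%E -> (forall j, (L <= j)%N -> u j = 0) ->
  modc (\sum_(j < L) u j * y j) <= c * a.
Proof.
move=> /ereal_inf_lt[_ [M [M0 hM] <-]] Mc a0 ua uL; rewrite lte_fin in Mc.
have us : Defs.space (@J_norm R) u by rewrite /Defs.space /= (le_lt_trans ua) // ltry.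
have [s su sM] := hM u us.
have [b b0 ub] := space_fin us; rewrite ub lee_fin in ua; rewrite ub -EFinM lee_fin in sM.
have -> : \sum_(j < L) u j * y j = s.
  apply/eqP; rewrite -subr_eq0 -modc_eq0 eq_le modc_ge0 andbT; apply/ler_addgt0Pr => e e0.
  have /cvgc_modcP/(_ e e0)[n _ /(_ (maxn L n) (leq_maxr _ _))] /= := su.
  rewrite /series /= (big_cat_nat (leq0n L) (leq_maxl L n)) //= (@big1_seq _ _ _ _ (index_iota L _)).
    by rewrite addr0 big_mkord add0r => /ltW.
  by move=> j; rewrite mem_index_iota => /andP[_ /andP[Lj _]]; rewrite uL // mul0r.
rewrite (le_trans sM) // ler_pM // ltW //.
Qed.

End Dual.

(** * Analytic functions with a fixed majorant on the boundary *)

Section Membership.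
Variable R : realType.
Implicit Types (u y w : omega R).

Lemma J_block_mono n (x m : omega R) (k : R) : 0 <= k ->
  (forall j, modc (x j) <= k * modc (m j)) -> J_block_norm n x <= k * J_block_norm n m.
Proof.
move=> k0 h; rewrite /J_block_norm J_expE invrK.
have t0 := theta_gt0 R n; have tn : theta R n != 0 by rewrite gt_eqF.
have -> : k = (k `^ (theta R n)^-1) `^ theta R n by rewrite -powRrM mulVf // powRr1.
rewrite -powRM ?powR_ge0 //; last by apply: sumr_ge0 => ? _; exact: powR_ge0.
apply: ge0_ler_powR; rewrite ?(ltW t0) ?nnegrE //.
- by apply: sumr_ge0 => ? _; exact: powR_ge0.
- by apply: mulr_ge0; [exact: powR_ge0|apply: sumr_ge0 => ? _; exact: powR_ge0].
rewrite mulr_sumr; apply: ler_sum => i _; rewrite -powRM ?modc_ge0 //.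
by apply: ge0_ler_powR; rewrite ?invr_ge0 ?(ltW t0) ?nnegrE ?modc_ge0 ?mulr_ge0 ?modc_ge0.
Qed.

Lemma J_block_unif n (x : omega R) (k : R) : (4 <= n)%N -> 0 <= k ->
  (forall i, (i < J_dim n)%N -> modc (x (J_offset n + i)%N) <= k) ->
  J_block_norm n x <= k * (J_dim n)%:R.
Proof.
move=> n4 k0 h; have d0 : 0 < (J_dim n)%:R :> R by rewrite ltr0n expn_gt0.
have d1 : 1 <= (J_dim n)%:R :> R by rewrite ler1n expn_gt0.
apply: (@J_block_le_weight R n x (fun=> (J_dim n)%:R^-1)).
- by rewrite mulr_ge0 // (ltW d0).
- by move=> _; rewrite invr_ge0 (ltW d0).
- by rewrite sumr_const card_ord -[_ *+ _]mulr_natr mulVf // gt_eqF.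
move=> i; rewrite (le_trans (h i (ltn_ord i))) // -mulrA ler_peMr //.
rewrite -[X in X <= _](@mulfV R (J_dim n)%:R) ?gt_eqF // (ler_wpM2l (ltW d0)) //.
rewrite -[leLHS]powRr1 ?invr_ge0 ?(ltW d0) //.
rewrite /powR invr_eq0 gt_eqF // ler_expR ler_wnM2r ?theta_le1 //.
by rewrite lnV ?posrE // oppr_le0 ln_ge0.
Qed.

Lemma ler_sqr_ge0 (a b : R) : 0 <= a -> a <= b -> a ^+ 2 <= b ^+ 2.
Proof. by move=> a0 ab; rewrite ler_pXn2r ?nnegrE // (le_trans a0). Qed.

#[local] Opaque J_block_norm.

(** The moduli m act on J with norm at most c. Unlike the dual norm this is a
condition on finite sums, monotone in m. *)
Definition dual_dom (m : nat -> R) (c : R) : Prop :=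
  forall u b, 0 <= b -> (J_norm u <= b%:E)%E -> forall N, (4 <= N)%N ->
    \sum_(j < J_offset N) modc (u j) * m j <= b * c.

Lemma sum_ltn_le (C : R) M L : 0 <= C ->
  \sum_(j < M) (if (j < L)%N then C else 0) <= C * L%:R.
Proof.
move=> C0; suff -> : \sum_(j < M) (if (j < L)%N then C else 0) = C * (minn M L)%:R.
  by rewrite ler_wpM2l // ler_nat geq_minr.
elim: M => [|M IH]; first by rewrite big_ord0 min0n mulr0.
rewrite big_ord_recr /= IH; case: ltnP => h.
  by rewrite (minn_idPl h) -addn1 natrD mulrDr mulr1.
by rewrite addr0 (minn_idPr (leqW h)).
Qed.

Lemma strip_cont_ccont (f : Cplx R -> Cplx R) : (forall z, exists l, cdiff f z l) ->
  {within @strip R, continuous f}.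
Proof.
move=> h; apply: continuous_subspaceT => z; have [l /cdiff_ccont hl] := h z.
by apply/(@cvgc_modcP _ _ (nbhs z) _) => e e0; apply/nbhsc_modcP; have [d d0 dP] := hl e e0; exists d.
Qed.

Lemma coords_close (F : Cplx R -> omega R) (a t : R) (L : nat) (k : R) : 0 < k ->
  (forall j z, exists l, cdiff (fun z => F z j) z l) ->
  \forall s \near t, forall j, (j < L)%N -> modc (F (a +i* s) j - F (a +i* t) j) <= k.
Proof.
move=> k0 hd; elim: L => [|L IH]; first by near=> s.
have [l /cdiff_ccont hl] := hd L (a +i* t); have [d d0 dP] := hl k k0.
near=> s.
have IHs j : (j < L)%N -> modc (F (a +i* s) j - F (a +i* t) j) <= k by move: j; near: s.
move=> j; rewrite ltnS leq_eqVlt => /predU1P[->|]; last exact: IHs.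
rewrite ltW // dP // (le_lt_trans (modc_le_ReIm _)) //= subrr normr0 add0r.
rewrite distrC; near: s; apply/nbhs_ballP; exists d => //.
Unshelve. all: by end_near. Qed.

Section Dominated.
Variables (F : Cplx R -> omega R) (m m' : nat -> R) (c c' : R).
Hypotheses (c0 : 0 <= c) (c'0 : 0 <= c').
Hypothesis Fd : forall j z, exists l, cdiff (fun z => F z j) z l.
Hypothesis Fb : forall j, exists M : R, forall z, strip z -> modc (F z j) <= M.
Hypothesis Fm : forall j t, modc (F (0 +i* t) j) <= m j.
Hypothesis mJ : forall N, \sum_(4 <= n < N) J_block_norm n (fun j => (m j)%:C) ^+ 2 <= c ^+ 2.
Hypothesis Fm' : forall j t, modc (F (1 +i* t) j) <= m' j.
Hypothesis m'D : dual_dom m' c'.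
Hypothesis m'T : forall d, 0 < d -> exists2 N0, (4 <= N0)%N &
  dual_dom (fun j => if (blk j < N0)%N then 0 else m' j) d.

Let m0 j : 0 <= m j. Proof. exact: le_trans (modc_ge0 _) (Fm j 0). Qed.
Let bound0 t : (J_norm (F (0%R +i* t)) <= c%:E)%E.
Proof.
apply/(J_norm_leP _ c0) => N; apply: le_trans (mJ N); apply: ler_sum_nat => n _.
have H : J_block_norm n (F (0 +i* t)) <= 1 * J_block_norm n (fun j => (m j)%:C).
  apply: (@J_block_mono n _ _ 1 ler01) => j.
  by rewrite mul1r modc_real ger0_norm.
by rewrite mul1r in H; exact: ler_sqr_ge0 (J_block_norm_ge0 _ _) H.
Qed.

Let bound1 t : (dual_norm (@J_norm R) (F (1%R +i* t)) <= c'%:E)%E.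
Proof.
apply: dual_norm_le => // u b b0 ub N N4; apply: le_trans (m'D b0 ub N4).
by apply: ler_sum => j _; rewrite ler_wpM2l ?modc_ge0.
Qed.

Let cont0 t : (fun s : R => J_norm (F (0 +i* s) - F (0 +i* t))) @ t --> (0%E : \bar R).
Proof.
apply: cvge0_near => [s|e e0]; first exact: J_norm_ge0.
have [|N0 N04 hN0] := tail_small (fun n => sqr_ge0 (J_block_norm n (fun j => (m j)%:C))) mJ (_ : 0 < e ^+ 2 / 8).
  by rewrite divr_gt0 // exprn_gt0.
pose L := J_offset N0; pose S : R := \sum_(4 <= n < N0) (J_dim n)%:R ^+ 2.
have S0 : 0 <= S by apply: sumr_ge0 => n _; exact: sqr_ge0.
pose k := e / (2 * (S + 1)).
have k0 : 0 < k by rewrite divr_gt0 // mulr_gt0 // ltr_wpDl.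
near=> s.
have hs j : (j < L)%N -> modc (F (0 +i* s) j - F (0 +i* t) j) <= k.
  by move: j; near: s; exact: coords_close.
apply/(J_norm_leP _ (ltW e0)) => N; set v := (_ - _ : omega R).
have v1 n : (4 <= n < N0)%N -> J_block_norm n v ^+ 2 <= k ^+ 2 * (J_dim n)%:R ^+ 2.
  move=> /andP[n4 nN]; rewrite -exprMn ler_pXn2r ?nnegrE ?J_block_norm_ge0 ?(mulr_ge0 (ltW k0) (ler0n _ _)) //.
  apply: J_block_unif => //; first exact: ltW k0.
  move=> i iJ; apply: hs; rewrite -blk_lt // blkE //.
have v2 n : J_block_norm n v ^+ 2 <= 4 * J_block_norm n (fun j => (m j)%:C) ^+ 2.
  have -> : (4 : R) = 2 ^+ 2 by rewrite -natrX.
  rewrite -exprMn ler_pXn2r ?nnegrE ?mulr_ge0 ?J_block_norm_ge0 //.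
  apply: J_block_mono => // j; rewrite modc_real ger0_norm // (le_trans (modcB _ _)) //.
  by have := lerD (Fm j s) (Fm j t); rewrite -mulr2n -[m j *+ 2]mulr_natl.
have key : \sum_(4 <= n < N0) J_block_norm n v ^+ 2 <= e ^+ 2 / 4.
  apply: (@le_trans _ _ (k ^+ 2 * S)).
    by rewrite mulr_sumr; apply: ler_sum_nat => n hn; exact: v1.
  have -> : k ^+ 2 * S = (e ^+ 2 / 4) * (S / (S + 1) ^+ 2) by rewrite /k; field; rewrite gt_eqF // ltr_wpDl.
  rewrite ler_piMr ?divr_ge0 ?sqr_ge0 // ler_pdivrMr ?exprn_gt0 ?ltr_wpDl //; nra.
have e20 := sqr_ge0 e.
have [NN|NN] := leqP N N0.
  apply: (@le_trans _ _ (\sum_(4 <= n < N0) J_block_norm n v ^+ 2)); last by lra.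
  have [N4|N4] := leqP 4 N; last by rewrite big_geq ?sumr_ge0 // => [? _|]; rewrite ?sqr_ge0 // ltnW.
  by rewrite (big_cat_nat N4 NN) /= lerDl sumr_ge0 // => ? _; exact: sqr_ge0.
rewrite (big_cat_nat N04 (ltnW NN)) /=.
have : \sum_(N0 <= n < N) J_block_norm n v ^+ 2 <= 4 * (e ^+ 2 / 8).
  apply: (@le_trans _ _ (4 * \sum_(N0 <= n < N) J_block_norm n (fun j => (m j)%:C) ^+ 2)).
    by rewrite mulr_sumr; apply: ler_sum => n _; exact: v2.
  by rewrite ler_wpM2l // hN0.
lra.
Unshelve. all: by end_near. Qed.

Let cont1 t :
  (fun s : R => dual_norm (@J_norm R) (F (1%R +i* s) - F (1%R +i* t))) @ t --> (0%E : \bar R).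
Proof.
apply: cvge0_near => [s|e e0]; first exact: dual_norm_ge0.
have [|N0 N04 hN0] := m'T (_ : 0 < e / 4); first by rewrite divr_gt0.
pose L := J_offset N0; pose k := e / (2 * (L%:R + 1)).
have k0 : 0 < k by rewrite divr_gt0 // mulr_gt0 // ltr_wpDl.
near=> s.
have hs j : (j < L)%N -> modc (F (1 +i* s) j - F (1 +i* t) j) <= k.
  by move: j; near: s; exact: coords_close.
apply: dual_norm_le; first exact: ltW.
move=> u b b0 ub N N4.
apply: (@le_trans _ _ (\sum_(j < J_offset N) ((if (j < L)%N then b * k else 0) +
  2 * (modc (u j) * (if (blk j < N0)%N then 0 else m' j))))).
  apply: ler_sum => j _; rewrite blk_lt //; case: ifPn => jL.
    rewrite mulr0 mulr0 addr0 ler_pM ?modc_ge0 ?hs //.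
    by rewrite (le_trans (modc_le_J_block _ _)) // (J_block_le b0 ub) // blk_ge4.
  rewrite add0r mulrCA ler_wpM2l ?modc_ge0 // (le_trans (modcB _ _)) //.
  by have := lerD (Fm' j s) (Fm' j t); rewrite -mulr2n -[m' j *+ 2]mulr_natl.
rewrite big_split /= -mulr_sumr.
have h1 := hN0 u b b0 ub N N4.
have h2 := @sum_ltn_le (b * k) (J_offset N) L (mulr_ge0 b0 (ltW k0)).
rewrite (le_trans (lerD h2 (ler_wpM2l _ h1))) //.
have -> : b * k * L%:R + 2 * (b * (e / 4)) = b * (k * L%:R + e / 2) by field.
rewrite ler_wpM2l // -lerBrDr (_ : e - e / 2 = e / 2); last by field.
rewrite /k mulrAC ler_pdivrMr ?mulr_gt0 ?ltr_wpDl //.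
have -> : e / 2 * (2 * (L%:R + 1)) = e * (L%:R + 1) by field.
by rewrite ler_wpM2l ?(ltW e0) // lerDl.
Unshelve. all: by end_near. Qed.

(** Norm continuity on the boundary lines follows from coordinatewise continuity:
finitely many coordinates are uniformly close, and the tails of the majorants m
and m' are small. *)
Lemma calF_dominated : calF (@J_norm R) (dual_norm (@J_norm R)) F.
Proof.
split => //.
- by move=> j; apply: strip_cont_ccont; exact: Fd.
- by move=> j z _; have [l /cdiff_derivable] := Fd j z.
- by move=> t; rewrite /Defs.space /= (le_lt_trans (bound0 t)) // ltry.
- by move=> t; rewrite /Defs.space /= (le_lt_trans (bound1 t)) // ltry.
- by apply: (@le_lt_trans _ _ c%:E); [apply: ge_ereal_sup => _ [t _ <-]; exact: bound0|exact: ltry].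
- by apply: (@le_lt_trans _ _ c'%:E); [apply: ge_ereal_sup => _ [t _ <-]; exact: bound1|exact: ltry].
Qed.

Lemma calF_norm_dominated (d : R) : c <= d -> c' <= d ->
  (calF_norm (@J_norm R) (dual_norm (@J_norm R)) F <= d%:E)%E.
Proof.
move=> cd c'd; rewrite /calF_norm ge_max; apply/andP; split.
  by apply: ge_ereal_sup => _ [t _ <-]; rewrite (le_trans (bound0 t)) // lee_fin.
by apply: ge_ereal_sup => _ [t _ <-]; rewrite (le_trans (bound1 t)) // lee_fin.
Qed.

End Dominated.
End Membership.

(** * Extremal functions and the upper bound for the norm of Z(J) *)

Section Extremal.
Variable R : realType.
Implicit Types (u y w x : omega R).
#[local] Opaque J_block_norm.

Definition lam y j : R := ln (modc (y j) / block2 (blk j) y).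

(** The extremal function of y: on the block n, with |y| the l_2-norm there, it has
modulus |y_j| (|y_j| / |y|) ^ (2 eps_n (1 - 2 Re z)). So |ext y| ^ (p_n) for
Re z = 0, and its conjugate power for Re z = 1, are multiples of |y_j| ^ 2, and
both norms equal |y|. *)
Definition ext y (z : Cplx R) : omega R := fun j =>
  cexp ((2 * eps R (blk j) * lam y j)%:C * (1 - (2 : R)%:C * z)) * y j.

(** The derivative of ext y at 1/2, a Kalton-Peck map on each block. *)
Definition Omega y : omega R := fun j => (- (4 * eps R (blk j) * lam y j))%:C * y j.

Lemma modc_ext y z j :
  modc (ext y z j) = modc (y j) * expR (2 * eps R (blk j) * (1 - 2 * complex.Re z) * lam y j).
Proof.
rewrite /ext modcM modc_cexp mulrC; congr (_ * expR _).
by case: z => a b /=; ring.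
Qed.

Lemma half_ptE : (1 - (2 : R)%:C * half_pt R) = 0 :> R[i].
Proof.
by rewrite /half_pt; apply/eqP; rewrite eq_complex /=; apply/andP; split; apply/eqP; field.
Qed.

Lemma ext_half y : ext y (half_pt R) = y.
Proof. by apply/funext => j; rewrite /ext half_ptE mulr0 cexp0 mul1r. Qed.

Lemma cdiff_ext y j z : cdiff (fun z => ext y z j) z
  (ext y z j * (- (4 * eps R (blk j) * lam y j))%:C).
Proof.
pose r : R := 2 * eps R (blk j) * lam y j.
have H1 : cdiff (fun z : R[i] => r%:C * (1 - (2 : R)%:C * z)) z (- (2 * r))%:C.
  have := cdiffD (cdiff_cst r%:C z) (cdiffM (cdiff_cst (- (2 * r))%:C z) (cdiff_id z)).
  rewrite mul0r !add0r mulr1; apply: cdiff_eq => v; case: v => p q.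
  by apply/eqP; rewrite eq_complex /=; apply/andP; split; apply/eqP; ring.
have := cdiffM (cdiff_comp H1 (cdiff_cexp _)) (cdiff_cst (y j) z).
rewrite mulr0 addr0 -/r.
have -> : cexp (r%:C * (1 - (2 : R)%:C * z)) * (- (2 * r))%:C * y j =
  ext y z j * (- (4 * eps R (blk j) * lam y j))%:C.
  rewrite /ext -/r mulrAC; congr (_ * _); rewrite /r; congr (_%:C); ring.
by [].
Qed.

Lemma cdiff_ext_half y j : cdiff (fun z => ext y z j) (half_pt R) (Omega y j).
Proof. by have := cdiff_ext y j (half_pt R); rewrite ext_half mulrC. Qed.

Lemma block2_gt0 y j : y j != 0 -> 0 < block2 (blk j) y.
Proof. by rewrite -modc_gt0 => h; exact: lt_le_trans h (modc_le_block2 _ _). Qed.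

Lemma lam_le0 y j : lam y j <= 0.
Proof.
rewrite /lam; have [->|b0] := eqVneq (block2 (blk j) y) 0; first by rewrite invr0 mulr0 ln0.
apply: ln_le0; rewrite ler_pdivrMr ?mul1r ?modc_le_block2 //.
by rewrite lt_neqAle eq_sym b0 block2_ge0.
Qed.

Lemma expR_lam y j : y j != 0 -> expR (lam y j) = modc (y j) / block2 (blk j) y.
Proof. by move=> y0; rewrite /lam lnK // posrE divr_gt0 ?block2_gt0 ?modc_gt0. Qed.

(** On a block |y_j| is the norm times the square root of the weight, so that every
power of |y_j| / |y| is a power of the weight. *)
Lemma modc_weight y j (s : R) :
  modc (y j) * expR (s * lam y j) <= block2 (blk j) y * wgt y j `^ ((1 + s) / 2).
Proof.
have [->|y0] := eqVneq (y j) 0; first by rewrite modc0 mul0r mulr_ge0 ?block2_ge0 ?powR_ge0.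
have b0 := block2_gt0 y0.
have -> : modc (y j) = block2 (blk j) y * expR (lam y j).
  by rewrite expR_lam // mulrCA mulfV ?mulr1 // gt_eqF.
have -> : wgt y j = expR (2 * lam y j).
  by rewrite mulr_natl mulr2n expRD expR_lam // /wgt; field; rewrite gt_eqF.
rewrite -mulrA ler_pM2l // -expRD /powR gt_eqF ?expR_gt0 // expRK.
by rewrite (_ : (1 + s) / 2 * (2 * lam y j) = lam y j + s * lam y j) //; field.
Qed.

Definition majJ y j : R := modc (y j) * expR (2 * eps R (blk j) * lam y j).
Definition majD y j : R := modc (y j) * expR (- (2 * eps R (blk j)) * lam y j).

Lemma majJ_le y j : majJ y j <= block2 (blk j) y * wgt y j `^ theta R (blk j).
Proof.
by have := modc_weight y j (2 * eps R (blk j)); rewrite (_ : (1 + _) / 2 = theta R (blk j)) // /theta; field.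
Qed.

Lemma majD_le y j : majD y j <= block2 (blk j) y * wgt y j `^ (1 - theta R (blk j)).
Proof.
by have := modc_weight y j (- (2 * eps R (blk j)));
  rewrite (_ : (1 + _) / 2 = 1 - theta R (blk j)) // /theta; field.
Qed.

Lemma modc_ext0 y t j : modc (ext y (0 +i* t) j) = majJ y j.
Proof. by rewrite modc_ext /= mulr0 subr0 mulr1. Qed.

Lemma modc_ext1 y t j : modc (ext y (1 +i* t) j) = majD y j.
Proof. by rewrite modc_ext /= /majD; congr (_ * expR _); ring. Qed.

Lemma majJ_ge0 y j : 0 <= majJ y j. Proof. by rewrite mulr_ge0 ?modc_ge0 ?expR_ge0. Qed.
Lemma majD_ge0 y j : 0 <= majD y j. Proof. by rewrite mulr_ge0 ?modc_ge0 ?expR_ge0. Qed.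

Lemma ext_bounded y j z : strip z ->
  modc (ext y z j) <= modc (y j) * expR (2 * eps R (blk j) * - lam y j).
Proof.
case: z => a b /andP[/= a0 a1]; rewrite modc_ext /= ler_wpM2l ?modc_ge0 // ler_expR.
rewrite -!mulrA ler_wpM2l // ler_wpM2l ?eps_ge0 //.
by have := lam_le0 y j; nra.
Qed.

Lemma J_block_majJ y n : (4 <= n)%N ->
  J_block_norm n (fun j => (majJ y j)%:C) <= block2 n y.
Proof.
move=> n4; apply: (@J_block_le_weight R n _ (fun i => wgt y (J_offset n + i)%N)).
- exact: block2_ge0.
- by move=> i; exact: wgt_ge0.
- exact: sum_wgt.
move=> i; rewrite modc_real ger0_norm ?majJ_ge0 //.
by have := majJ_le y (J_offset n + i)%N; rewrite blkE.
Qed.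

(** The weights of y and w are both at most twice their average, which serves as
the common weight of the sum. *)
Lemma J_block_majJ2 y w n : (4 <= n)%N ->
  J_block_norm n (fun j => (majJ y j + 3 * majJ w j)%:C) <= 4 * (block2 n y + 3 * block2 n w).
Proof.
move=> n4; set S := block2 n y + 3 * block2 n w.
have S0 : 0 <= S by rewrite addr_ge0 ?mulr_ge0 ?block2_ge0.
have Sy : block2 n y <= S by rewrite lerDl mulr_ge0 ?block2_ge0.
have Sw : 3 * block2 n w <= S by rewrite lerDr block2_ge0.
pose W i := (wgt y (J_offset n + i)%N + wgt w (J_offset n + i)%N) / 2.
have W0 i : 0 <= W i by rewrite divr_ge0 // addr_ge0 ?wgt_ge0.
apply: (@J_block_le_weight R n _ W).
- by rewrite mulr_ge0.
- by [].
- rewrite -mulr_suml big_split /= ler_pdivrMr // mul1r.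
  by have := lerD (sum_wgt y n4) (sum_wgt w n4); rewrite -mulr2n.
move=> i; rewrite modc_real ger0_norm; last first.
  by apply: addr_ge0; [exact: majJ_ge0|apply: mulr_ge0 => //; exact: majJ_ge0].
have h1 := majJ_le y (J_offset n + i)%N; have h2 := majJ_le w (J_offset n + i)%N.
rewrite blkE // in h1 h2.
have t0 := theta_gt0 R n.
have two : 2 `^ theta R n <= 2.
  by rewrite -[leRHS]powRr1 // /powR gt_eqF // ler_expR ler_wpM2r ?theta_le1 // ln_ge0 // ler1n.
have P v : wgt v (J_offset n + i) <= 2 * W i ->
    wgt v (J_offset n + i) `^ theta R n <= 2 * W i `^ theta R n.
  move=> hv; apply: (@le_trans _ _ ((2 * W i) `^ theta R n)).
    by apply: (ge0_ler_powR (ltW t0)); rewrite ?nnegrE //; [exact: wgt_ge0|exact: mulr_ge0].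
  by rewrite powRM // ler_wpM2r ?powR_ge0.
have E : 2 * W i = wgt y (J_offset n + i)%N + wgt w (J_offset n + i)%N by rewrite /W; field.
have p1 := P y (_ : _ <= _); have p2 := P w (_ : _ <= _).
rewrite E lerDl wgt_ge0 in p1; rewrite E lerDr wgt_ge0 in p2.
have {}p1 := p1 isT; have {}p2 := p2 isT.
have -> : 4 * S * W i `^ theta R n = S * (2 * W i `^ theta R n) + S * (2 * W i `^ theta R n) by ring.
rewrite lerD //.
  by rewrite (le_trans h1) // ler_pM ?block2_ge0 ?powR_ge0.
apply: (@le_trans _ _ (3 * block2 n w * wgt w (J_offset n + i) `^ theta R n)).
  by rewrite -mulrA ler_wpM2l.
by apply: (ler_pM _ _ Sw p2); [apply: mulr_ge0 => //; exact: block2_ge0|exact: powR_ge0].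
Qed.

Definition trunc_tail y N0 : omega R := fun j => if (blk j < N0)%N then 0 else y j.

Lemma block2_tail y N0 n : (4 <= n)%N ->
  block2 n (trunc_tail y N0) = if (n < N0)%N then 0 else block2 n y.
Proof.
move=> n4; rewrite /block2 /trunc_tail; case: ifPn => nN.
  rewrite big1 ?sqrtr0 // => i _; by rewrite blkE // nN modc0 expr0n.
by congr Num.sqrt; apply: eq_bigr => i _; rewrite blkE // (negPf nN).
Qed.

Lemma l2_tail_small y a d : l2le y a -> 0 < d ->
  exists2 N0, (4 <= N0)%N & l2le (trunc_tail y N0) d.
Proof.
move=> ya d0; have [|||N0 N04 hN] := @tail_small R (fun n => block2 n y ^+ 2) (a ^+ 2) (d ^+ 2).
- by move=> n; exact: sqr_ge0.
- move=> N; have [N4|N4] := leqP 4 N; first exact: (l2leP _ _).1.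
  by rewrite big_geq ?sqr_ge0 // ltnW.
- by rewrite exprn_gt0.
exists N0 => //; apply/l2leP => N N4; have [NN|NN] := leqP N N0.
  rewrite big_nat_cond big1 ?sqr_ge0 // => n /andP[/andP[n4 nN] _].
  by rewrite block2_tail // (leq_trans nN) // expr0n.
rewrite (big_cat_nat N04 (ltnW NN)) /= big_nat_cond big1 ?add0r => [|n /andP[/andP[n4 nN] _]].
  apply: le_trans (hN N); apply: ler_sum_nat => n /andP[nN _].
  by rewrite block2_tail ?(leq_trans N04) // ltnNge nN.
by rewrite block2_tail // nN expr0n.
Qed.

Lemma dual_dom_majD y a : 0 <= a -> l2le y a -> dual_dom (majD y) a.
Proof.
move=> a0 ya u b b0 ub N N4; apply: (J_pairing N4 b0 a0 ub ya) => j; exact: majD_le.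
Qed.

Lemma dual_dom_majD_tail y a d : 0 <= a -> l2le y a -> 0 < d ->
  exists2 N0, (4 <= N0)%N & forall N1, (N0 <= N1)%N ->
    dual_dom (fun j => if (blk j < N1)%N then 0 else majD y j) d.
Proof.
move=> a0 ya d0; have [N0 N04 hN] := l2_tail_small ya d0; exists N0 => // N1 N01.
move=> u b b0 ub N N4.
apply: (@J_pairing R u (trunc_tail y N0) (fun j => if (blk j < N1)%N then 0 else majD y j)
  b d N N4 b0 (ltW d0) ub hN) => j.
case: ifPn => bN; first by rewrite mulr_ge0 ?block2_ge0 ?powR_ge0.
have bN0 : (blk j < N0)%N = false.
  by apply/negbTE; rewrite -leqNgt (leq_trans N01) // leqNgt.
rewrite /wgt block2_tail ?blk_ge4 // bN0 /trunc_tail bN0; exact: majD_le.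
Qed.

Lemma dual_domD m1 m2 (c1 c2 k : R) : 0 <= k -> dual_dom m1 c1 -> dual_dom m2 c2 ->
  dual_dom (fun j => m1 j + k * m2 j) (c1 + k * c2).
Proof.
move=> k0 h1 h2 u b b0 ub N N4; rewrite mulrDr mulrCA.
have H := lerD (h1 u b b0 ub N N4) (ler_wpM2l k0 (h2 u b b0 ub N N4)).
apply: le_trans H; rewrite mulr_sumr -big_split /=; apply: ler_sum => j _.
by rewrite mulrDr (mulrCA k).
Qed.

Section ExtMember.
Variables (y : omega R) (a : R).
Hypotheses (a0 : 0 <= a) (ya : l2le y a).

Let mJ N : \sum_(4 <= n < N) J_block_norm n (fun j => (majJ y j)%:C) ^+ 2 <= a ^+ 2.
Proof.
have [N4|N4] := leqP 4 N; last by rewrite big_geq ?sqr_ge0 // ltnW.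
apply: le_trans ((l2leP _ _).1 ya N N4); apply: ler_sum_nat => n /andP[n4 _].
exact: ler_sqr_ge0 (J_block_norm_ge0 _ _) (J_block_majJ y n4).
Qed.
Let h0 j t : modc (ext y (0 +i* t) j) <= majJ y j. Proof. by rewrite modc_ext0. Qed.
Let h1 j t : modc (ext y (1 +i* t) j) <= majD y j. Proof. by rewrite modc_ext1. Qed.
Let hd j z : exists l, cdiff (fun z => ext y z j) z l.
Proof. by eexists; exact: cdiff_ext. Qed.
Let hb j : exists M : R, forall z, strip z -> modc (ext y z j) <= M.
Proof. by eexists => z; exact: ext_bounded. Qed.
Let hT d : 0 < d -> exists2 N0, (4 <= N0)%N &
  dual_dom (fun j => if (blk j < N0)%N then 0 else majD y j) d.
Proof.
by move=> d0; have [N0 N04 hN] := dual_dom_majD_tail a0 ya d0; exists N0 => //; exact: hN.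
Qed.

Lemma calF_ext : calF (@J_norm R) (dual_norm (@J_norm R)) (ext y).
Proof. exact: (calF_dominated a0 a0 hd hb h0 mJ h1 (dual_dom_majD a0 ya) hT). Qed.

Lemma calF_norm_ext : (calF_norm (@J_norm R) (dual_norm (@J_norm R)) (ext y) <= a%:E)%E.
Proof. exact: (calF_norm_dominated a0 a0 h0 mJ h1 (dual_dom_majD a0 ya)). Qed.

Lemma Z_norm_Omega : (ZJ_norm (Omega y, y) <= a%:E)%E.
Proof.
apply: le_trans calF_norm_ext; apply: ereal_inf_lbound; exists (ext y) => //; split.
- exact: calF_ext.
- exact: ext_half.
- by move=> j /=; apply: cdiff_derive; exact: cdiff_ext_half.
Qed.

End ExtMember.

(** Adding phi ext w to a function leaves its value at 1/2 unchanged and adds w to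
its derivative there; phi is bounded on the strip. *)
Definition phi (z : R[i]) : R[i] := cexp (z - half_pt R) - 1.

Lemma cdiff_phi z : cdiff phi z (cexp (z - half_pt R)).
Proof.
have H : cdiff (fun v : R[i] => v + - half_pt R) z (1 + 0) by exact: cdiffD (cdiff_id _) (cdiff_cst _ _).
have := cdiffD (cdiff_comp H (cdiff_cexp _)) (cdiff_cst (- 1) z).
by rewrite !addr0 mulr1.
Qed.

Lemma phi_le3 z : strip z -> modc (phi z) <= 3.
Proof.
move=> zs; rewrite (le_trans (modcB _ _)) // modc1 modc_cexp.
suff : expR (complex.Re (z - half_pt R)) <= 2 by lra.
apply: (@le_trans _ _ (expR 2^-1)); first by rewrite ler_expR; case: z zs => p q /andP[/= ? ?]; lra.
have : 2^-1 <= expR (- 2^-1) :> R by apply: le_trans (expR_ge1Dx _); lra.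
by rewrite expRN lef_pV2 ?posrE ?expR_gt0.
Qed.

(** The competitor is ext y + phi ext w with w = x - Omega y. *)
Lemma Z_norm_upper x y a b : 0 <= a -> 0 <= b -> l2le y a ->
  l2le (fun j => x j - Omega y j) b -> (ZJ_norm (x, y) <= (8 * (a + 3 * b))%:E)%E.
Proof.
move=> a0 b0 ya wb; set w : omega R := (fun j => _) in wb.
have c0 : 0 <= a + 3 * b by rewrite addr_ge0 ?mulr_ge0.
have c80 : 0 <= 8 * (a + 3 * b) by rewrite mulr_ge0.
pose F (z : Cplx R) : omega R := fun j => ext y z j + phi z * ext w z j.
have mJ N : \sum_(4 <= n < N) J_block_norm n (fun j => (majJ y j + 3 * majJ w j)%:C) ^+ 2 <=
    (8 * (a + 3 * b)) ^+ 2.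
  have [N4|N4] := leqP 4 N; last by rewrite big_geq ?sqr_ge0 // ltnW.
  apply: (@le_trans _ _ (\sum_(4 <= n < N) (32 * block2 n y ^+ 2 + 288 * block2 n w ^+ 2))).
    apply: ler_sum_nat => n /andP[n4 _].
    apply: le_trans (ler_sqr_ge0 (J_block_norm_ge0 _ _) (J_block_majJ2 y w n4)) _.
    have := sqr_ge0 (block2 n y - 3 * block2 n w); nra.
  rewrite big_split /= -!mulr_sumr.
  have h1 := (l2leP _ _).1 ya N N4; have h2 := (l2leP _ _).1 wb N N4.
  have := mulr_ge0 a0 b0; nra.
have h0 j t : modc (F (0 +i* t) j) <= majJ y j + 3 * majJ w j.
  rewrite (le_trans (modcD _ _)) // modcM !modc_ext0 lerD2l ler_wpM2r ?majJ_ge0 //.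
  by apply: phi_le3; rewrite /strip /= lexx ler01.
have h1 j t : modc (F (1 +i* t) j) <= majD y j + 3 * majD w j.
  rewrite (le_trans (modcD _ _)) // modcM !modc_ext1 lerD2l ler_wpM2r ?majD_ge0 //.
  by apply: phi_le3; rewrite /strip /= lexx ler01.
have hd j z : exists l, cdiff (fun z => F z j) z l.
  by eexists; exact: cdiffD (cdiff_ext y j z) (cdiffM (cdiff_phi z) (cdiff_ext w j z)).
have hb j : exists M : R, forall z, strip z -> modc (F z j) <= M.
  eexists => z zs; rewrite (le_trans (modcD _ _)) // modcM.
  by apply: lerD (ext_bounded y j zs) (ler_pM _ _ (phi_le3 zs) (ext_bounded w j zs)); exact: modc_ge0.
have hD := dual_domD (ler0n R 3) (dual_dom_majD a0 ya) (dual_dom_majD b0 wb).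
have hT d : 0 < d -> exists2 N0, (4 <= N0)%N &
    dual_dom (fun j => if (blk j < N0)%N then 0 else majD y j + 3 * majD w j) d.
  move=> d0; have d4 : 0 < d / 4 by rewrite divr_gt0.
  have [N1 N14 hN1] := dual_dom_majD_tail a0 ya d4.
  have [N2 N24 hN2] := dual_dom_majD_tail b0 wb d4.
  exists (maxn N1 N2); first by rewrite leq_max N14.
  have := dual_domD (ler0n R 3) (hN1 _ (leq_maxl N1 N2)) (hN2 _ (leq_maxr N1 N2)).
  rewrite (_ : d / 4 + 3 * (d / 4) = d); last by field.
  move=> H u c cc uc N N4; apply: le_trans (H u c cc uc N N4).
  by apply: ler_sum => j _; case: ifP => _ //; rewrite !mulr0 addr0 mulr0.
apply: (@le_trans _ _ (calF_norm (@J_norm R) (dual_norm (@J_norm R)) F)).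
  apply: ereal_inf_lbound; exists F; last by reflexivity.
  split.
  - exact: (calF_dominated c80 c0 hd hb h0 mJ h1 hD hT).
  - by apply/funext => j; rewrite /F !ext_half /phi subrr cexp0 subrr mul0r addr0.
  move=> j /=; apply: cdiff_derive.
  have := cdiffD (cdiff_ext_half y j) (cdiffM (cdiff_phi (half_pt R)) (cdiff_ext_half w j)).
  rewrite ext_half {2}/phi subrr cexp0 subrr mul0r addr0 mul1r /w addrC subrK.
  by [].
apply: (calF_norm_dominated c80 c0 h0 mJ h1 hD) => //; lra.
Qed.

End Extremal.

(** * Testing against extremal functions: the lower bound for the norm *)

Section Lower.
Variable R : realType.
Implicit Types (u y w x g : omega R).
#[local] Opaque J_block_norm.

Lemma within_strip_cont (f : Cplx R -> Cplx R) : {within @strip R, continuous f} -> strip_cont f.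
Proof.
move=> /subspace_continuousP h z zs e e0; have /cvgc_modcP/(_ e e0) := h z zs.
by rewrite near_withinE => /nbhsc_modcP[d d0 dP]; exists d => // v vs vd; exact: dP.
Qed.

Lemma strip_cont_cdiff (f : R[i] -> R[i]) : (forall z, exists l, cdiff f z l) -> strip_cont f.
Proof.
move=> h z _ e e0; have [l /cdiff_ccont hl] := h z; have [d d0 dP] := hl e e0.
by exists d => // v _; exact: dP.
Qed.

Lemma strip_contM (f g : R[i] -> R[i]) : strip_cont f -> strip_cont g ->
  strip_cont (fun z => f z * g z).
Proof.
move=> hf hg z zs e e0.
have A0 : 0 < modc (g z) + 1 by rewrite ltr_wpDl ?modc_ge0.
have B0 : 0 < modc (f z) + 1 by rewrite ltr_wpDl ?modc_ge0.
have e1 : 0 < e / 2 / (modc (g z) + 1) by rewrite !divr_gt0.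
have e2 : 0 < e / 2 / (modc (f z) + 1) by rewrite !divr_gt0.
have [d1 d10 h1] := hf z zs _ e1; have [d2 d20 h2] := hg z zs _ e2.
have [d3 d30 h3] := hg z zs _ ltr01.
exists (Num.min d1 (Num.min d2 d3)); first by rewrite !lt_min d10 d20 d30.
move=> v vs; rewrite !lt_min => /andP[/(h1 _ vs) k1 /andP[/(h2 _ vs) k2 /(h3 _ vs) k3]].
have -> : f v * g v - f z * g z = (f v - f z) * g v + f z * (g v - g z) by ring.
rewrite (le_lt_trans (modcD _ _)) // !modcM (splitr e) ltrD //.
  have gv : modc (g v) <= modc (g z) + 1.
    by rewrite -[g v](subrK (g z)) addrC (le_trans (modcD _ _)) // lerD2l ltW.
  apply: (@le_lt_trans _ _ (modc (f v - f z) * (modc (g z) + 1))).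
    by rewrite ler_wpM2l ?modc_ge0.
  by rewrite -ltr_pdivlMr.
apply: (@le_lt_trans _ _ ((modc (f z) + 1) * modc (g v - g z))).
  by rewrite ler_wpM2r ?modc_ge0 // lerDl.
by rewrite mulrC -ltr_pdivlMr.
Qed.

Lemma strip_cont_sum (L : nat) (f : nat -> R[i] -> R[i]) : (forall j, strip_cont (f j)) ->
  strip_cont (fun z => \sum_(j < L) f j z).
Proof.
move=> hf; elim: L => [|L IH] z zs e e0.
  by exists 1 => // v _ _; rewrite !big_ord0 subrr modc0.
have e20 : 0 < e / 2 by rewrite divr_gt0.
have [d1 d10 h1] := IH z zs _ e20; have [d2 d20 h2] := hf L z zs _ e20.
exists (Num.min d1 d2); first by rewrite lt_min d10.
move=> v vs; rewrite lt_min => /andP[/(h1 _ vs) k1 /(h2 _ vs) k2].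
rewrite !big_ord_recr /= opprD addrACA (le_lt_trans (modcD _ _)) // (splitr e).
exact: ltrD k1 k2.
Qed.

Lemma strip_bounded_sum (L : nat) (f : nat -> R[i] -> R[i]) :
  (forall j, exists M : R, forall z, strip z -> modc (f j z) <= M) ->
  exists M : R, forall z, strip z -> modc (\sum_(j < L) f j z) <= M.
Proof.
move=> hf; elim: L => [|L [M1 h1]]; first by exists 0 => z _; rewrite big_ord0 modc0.
have [M2 h2] := hf L; exists (M1 + M2) => z zs; rewrite big_ord_recr /=.
by rewrite (le_trans (modcD _ _)) // lerD ?h1 ?h2.
Qed.

Lemma J_norm_ext0 g a t : 0 <= a -> l2le g a -> (J_norm (ext g (0%R +i* t)) <= a%:E)%E.
Proof.
move=> a0 ga; apply/(J_norm_leP _ a0) => N.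
have [N4|N4] := leqP 4 N; last by rewrite big_geq ?sqr_ge0 // ltnW.
apply: le_trans ((l2leP _ _).1 ga N N4); apply: ler_sum_nat => n /andP[n4 _].
apply: ler_sqr_ge0 (J_block_norm_ge0 _ _) _.
apply: le_trans (J_block_majJ g n4).
rewrite -[leRHS]mul1r; apply: (@J_block_mono R n _ _ 1 ler01) => j.
by rewrite mul1r modc_ext0 modc_real ger0_norm // majJ_ge0.
Qed.

Section Pairing.
Variables (F : Cplx R -> omega R) (c : R) (g : omega R) (a : R) (N : nat).
Hypothesis FF : calF (@J_norm R) (dual_norm (@J_norm R)) F.
Hypothesis c0 : 0 <= c.
Hypothesis Fc : (calF_norm (@J_norm R) (dual_norm (@J_norm R)) F <= c%:E)%E.
Hypotheses (a0 : 0 <= a) (ga : l2le g a) (N4 : (4 <= N)%N).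
Hypothesis gN : forall j, (J_offset N <= j)%N -> g j = 0.

(** The reflection z -> 1 - z exchanges the two boundary lines, so that F is
paired with an element of the dual couple on both of them. *)
Definition pairing (z : R[i]) : R[i] := \sum_(j < J_offset N) ext g (1 - z) j * F z j.

Lemma cdiff_refl j z l : cdiff (fun z => ext g z j) (1 - z) l ->
  cdiff (fun z => ext g (1 - z) j) z (- l).
Proof.
move=> h; have H : cdiff (fun v : R[i] => 1 + -1 * v) z (0 + (0 * z + -1 * 1)).
  exact: cdiffD (cdiff_cst _ _) (cdiffM (cdiff_cst _ _) (cdiff_id _)).
have E (v : R[i]) : 1 + -1 * v = 1 - v by rewrite mulN1r.
have := @cdiff_comp R (fun z => ext g z j) (fun v => 1 + -1 * v) z l _ H.
rewrite E => /(_ h); rewrite mul0r !add0r mulr1 mulrN1; apply: cdiff_eq => v.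
by rewrite E.
Qed.

Lemma cdiff_pairing z : 0 < complex.Re z < 1 -> exists l, cdiff pairing z l.
Proof.
move=> zi.
suff /choice[l hl] : forall j, exists l, cdiff (fun z => ext g (1 - z) j * F z j) z l.
  exists (\sum_(j < J_offset N) l j).
  exact: (@cdiff_sum R _ (index_enum _) (fun (j : 'I__) z => ext g (1 - z) j * F z j) z (fun j => l j)).
move=> j; have [k hk] := derivable_cdiff (calF_analytic FF (j := j) zi).
by eexists; exact: cdiffM (cdiff_refl (cdiff_ext g j (1 - z))) hk.
Qed.

Let Fc0 t : (J_norm (F (0%R +i* t)) <= c%:E)%E.
Proof.
apply: le_trans Fc; rewrite /calF_norm le_max; apply/orP; left.
by apply: ereal_sup_ubound; exists t.
Qed.

Let Fc1 t : (dual_norm (@J_norm R) (F (1%R +i* t)) <= c%:E)%E.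
Proof.
apply: le_trans Fc; rewrite /calF_norm le_max; apply/orP; right.
by apply: ereal_sup_ubound; exists t.
Qed.

(** On the line Re z = 0 the function F is in J and the reflected extremal function
in the dual space, on the other line it is the opposite; the three lines theorem
propagates the product of the bounds to the strip. *)
Lemma pairing_le z : strip z -> modc (pairing z) <= c * a.
Proof.
have onesub (r s : R) : (1 : R[i]) - (r +i* s) = (1 - r) +i* (- s).
  by apply/eqP; rewrite eq_complex /= sub0r !eqxx.
have [|M hM] := @strip_bounded_sum (J_offset N) (fun j z => ext g (1 - z) j * F z j).
  move=> j; have [M hM] := calF_bounded FF j.
  exists (modc (g j) * expR (2 * eps R (blk j) * - lam g j) * M) => v vs.
  rewrite modcM ler_pM ?modc_ge0 ?hM ?ext_bounded //.
  by case: v vs => p q; rewrite /strip /= => /andP[? ?]; apply/andP; split; lra.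
apply: (@three_lines R pairing M (c * a)).
- exact: mulr_ge0.
- exact: hM.
- apply: (@strip_cont_sum (J_offset N) (fun j z => ext g (1 - z) j * F z j)) => j.
  apply: (@strip_contM (fun z => ext g (1 - z) j) (F^~ j)).
    by apply: strip_cont_cdiff => v; eexists; exact: cdiff_refl (cdiff_ext g j (1 - v)).
  by have hc := calF_continuous FF (j := j); exact: within_strip_cont hc.
- exact: cdiff_pairing.
- move=> t; rewrite /pairing onesub subr0 (le_trans (modc_sum _ _ _)) //.
  apply: le_trans (dual_dom_majD a0 ga c0 (Fc0 t) N4).
  by apply: ler_sum => j _; rewrite modcM modc_ext1 mulrC.
move=> t; rewrite /pairing onesub subrr; apply/ler_addgt0Pr => e e0.
have a1 : 0 < a + 1 by rewrite ltr_wpDl.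
have lt : (dual_norm (@J_norm R) (F (1%R +i* t)) < (c + e / (a + 1))%:E)%E.
  by apply: le_lt_trans (Fc1 t) _; rewrite lte_fin ltrDl divr_gt0.
apply: le_trans (dual_norm_pairing lt a0 (J_norm_ext0 (- t) a0 ga) _) _.
  by move=> j Lj; rewrite /ext gN // mulr0.
rewrite mulrDl lerD2l mulrAC ler_pdivrMr // ler_wpM2l ?(ltW e0) //.
by rewrite lerDl.
Qed.

Lemma pairing_half : pairing (half_pt R) = \sum_(j < J_offset N) g j * F (half_pt R) j.
Proof.
rewrite /pairing (_ : 1 - half_pt R = half_pt R) ?ext_half //.
by apply/eqP; rewrite eq_complex /=; apply/andP; split; apply/eqP; field.
Qed.

Lemma cdiff_pairing_half (x : omega R) : (forall j, cdiff (fun z => F z j) (half_pt R) (x j)) ->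
  cdiff pairing (half_pt R)
    (\sum_(j < J_offset N) (- Omega g j * F (half_pt R) j + g j * x j)).
Proof.
move=> hx; apply: (@cdiff_sum R _ (index_enum _) (fun (j : 'I__) z => ext g (1 - z) j * F z j)
  (half_pt R) (fun j : 'I__ => - Omega g j * F (half_pt R) j + g j * x j)) => j.
have hh : 1 - half_pt R = half_pt R.
  by apply/eqP; rewrite eq_complex /=; apply/andP; split; apply/eqP; field.
have := cdiffM (@cdiff_refl j (half_pt R) (Omega g j) _) (hx j).
by rewrite hh ext_half; apply; exact: cdiff_ext_half.
Qed.

End Pairing.

(** The test sequence is the conjugate of a finite section of w. *)
Lemma l2le_test w (C : R) : 0 <= C ->
  (forall N g S, (4 <= N)%N -> 0 <= S -> l2le g S -> (forall j, (J_offset N <= j)%N -> g j = 0) ->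
    modc (\sum_(j < J_offset N) g j * w j) <= C * S) -> l2le w C.
Proof.
move=> C0 h M; have [N N4 MN] := J_offset_unbounded M.
pose T := \sum_(j < J_offset N) modc (w j) ^+ 2.
have T0 : 0 <= T by apply: sumr_ge0 => j _; exact: sqr_ge0.
pose S := Num.sqrt T; have S0 : 0 <= S by exact: sqrtr_ge0.
have S2 : S ^+ 2 = T by rewrite sqr_sqrtr.
pose g : omega R := fun j => if (j < J_offset N)%N then conjc (w j) else 0.
have gw (j : 'I_(J_offset N)) : g j * w j = (modc (w j) ^+ 2)%:C.
  by rewrite /g ltn_ord mulrC mul_conjc.
have gS : l2le g S.
  move=> M'; rewrite S2 /T.
  rewrite -(big_mkord xpredT (fun j => modc (g j) ^+ 2)) -(big_mkord xpredT (fun j => modc (w j) ^+ 2)).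
  pose L := maxn M' (J_offset N).
  apply: (@le_trans _ _ (\sum_(0 <= j < L) modc (g j) ^+ 2)).
    by rewrite (big_cat_nat (leq0n M') (leq_maxl M' _)) //= lerDl sumr_ge0 // => ? _; exact: sqr_ge0.
  rewrite (big_cat_nat (leq0n (J_offset N)) (leq_maxr M' _)) //=.
  have -> : \sum_(J_offset N <= j < maxn M' (J_offset N)) modc (g j) ^+ 2 = 0.
    rewrite big_nat_cond big1 // => j /andP[/andP[jN _] _].
    by rewrite /g ltnNge jN modc0 expr0n.
  by rewrite addr0; apply: ler_sum_nat => j /andP[_ jN]; rewrite /g jN modc_conj.
have := h N g S N4 S0 gS; rewrite (eq_bigr _ (fun j _ => gw j)).
have -> : \sum_(j < J_offset N) (modc (w j) ^+ 2)%:C = T%:C by rewrite /T raddf_sum.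
rewrite modc_real ger0_norm // -S2 => /(_ _)/wrap[].
  by move=> j jN; rewrite /g ltnNge jN.
move=> H; have SC : S <= C.
  have [->//|Sn] := eqVneq S 0; rewrite -(@ler_pM2r _ S) -?expr2 //.
  by rewrite lt_neqAle eq_sym Sn.
apply: le_trans (ler_sqr_ge0 S0 SC); rewrite S2 /T.
rewrite -(big_mkord xpredT (fun j => modc (w j) ^+ 2)) -(big_mkord xpredT (fun j => modc (w j) ^+ 2)).
by rewrite (big_cat_nat (leq0n M) MN) //= lerDl sumr_ge0 // => ? _; exact: sqr_ge0.
Qed.

(** The pairing with a test sequence g has the value sum g_j y_j at 1/2. Its
derivative there is sum (g_j x_j - (Omega g)_j y_j); the same pairing with ext y
in place of F has the derivative sum (g_j (Omega y)_j - (Omega g)_j y_j). The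
difference of the two vanishes at 1/2, is at most 2 c |g| on the strip, and
Cauchy's estimate on the circle of radius 1/4 gives the constant 8. *)
Lemma Z_norm_lower x y c : (ZJ_norm (x, y) < c%:E)%E ->
  l2le y c /\ l2le (fun j => x j - Omega y j) (8 * c).
Proof.
move=> /ereal_inf_lt[_ [F [FF Fy Fx] <-]] Fc.
have c0 : 0 < c.
  rewrite -lte_fin; apply: le_lt_trans Fc; rewrite /calF_norm le_max; apply/orP; left.
  by apply: le_trans (J_norm_ge0 (F (0%R +i* 0%R))) _; apply: ereal_sup_ubound; exists 0.
have Fc' := ltW Fc; have c0' := ltW c0.
have yc : l2le y c.
  apply: l2le_test => // N g S N4 S0 gS gN.
  have := @pairing_le F c g S N FF c0' Fc' S0 gS N4 gN (half_pt R).
  rewrite pairing_half Fy; apply; rewrite /strip /=; apply/andP; split; lra.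
split=> //; apply: l2le_test; first by rewrite mulr_ge0.
move=> N g S N4 S0 gS gN.
have BB := calF_ext c0' yc; have Bc := calF_norm_ext c0' yc.
pose H z := pairing F g N z - pairing (ext y) g N z.
have hx j : cdiff (fun z => F z j) (half_pt R) (x j).
  have h : 0 < complex.Re (half_pt R) < 1 by rewrite /=; apply/andP; split; lra.
  have [l hl] := derivable_cdiff (calF_analytic FF (j := j) h).
  by have := Fx j; rewrite (cdiff_derive hl) /= => <-.
have cdB (p q : R[i] -> R[i]) z k l : cdiff p z k -> cdiff q z l -> cdiff (fun v => p v - q v) z (k - l).
  move=> h1 h2; have := cdiffD h1 (cdiffM (cdiff_cst (-1) z) h2).
  by rewrite mul0r add0r mulN1r; apply: cdiff_eq => v; rewrite mulN1r.
have := @cauchy_at_zero R H (half_pt R) (\sum_(j < J_offset N) g j * (x j - Omega y j)) 2^-1 4^-1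
  (2 * (c * S)).
rewrite invrK (_ : 2 * (c * S) * 4 = 8 * c * S); last by ring.
have near_in z : modc (z - half_pt R) < 2^-1 -> 0 < complex.Re z < 1.
  move=> hz; have := le_lt_trans (normr_Re_le _) hz; case: z {hz} => p q /=.
  by rewrite ltr_norml => /andP[? ?]; apply/andP; split; lra.
apply.
- by rewrite invr_gt0.
- by rewrite ltf_pV2 ?posrE // ltr_nat.
- move=> z /near_in zi.
  have [k hk] := cdiff_pairing g N FF zi; have [l hl] := cdiff_pairing g N BB zi.
  by eexists; exact: cdB hk hl.
- by rewrite /H !pairing_half ext_half Fy subrr.
- have := cdB _ _ _ _ _ (cdiff_pairing_half g N hx) (cdiff_pairing_half g N (cdiff_ext_half y)).
  rewrite Fy ext_half -sumrB; set l1 := \sum_(_ < _) _; set l2 := \sum_(_ < _) _.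
  suff -> : l1 = l2 by [].
  have E (p q r s t : R[i]) : - p * q + r * s - (- p * q + r * t) = r * (s - t) by ring.
  by apply: eq_bigr => j _; exact: E.
move=> z zr; rewrite (le_trans (modcB _ _)) // mulr_natl mulr2n.
have zs : strip z.
  have /near_in/andP[z0 z1] : modc (z - half_pt R) < 2^-1.
    by rewrite zr ltf_pV2 ?posrE // ltr_nat.
  by rewrite /strip /= (ltW z0) (ltW z1).
exact: lerD (pairing_le FF c0' Fc' S0 gS N4 gN zs) (pairing_le BB c0' Bc S0 gS N4 gN zs).
Qed.

End Lower.

(** * Quasi-linearity of Omega *)

Section QuasiLinear.
Variable R : realType.
Implicit Types (u y w x v : omega R).

Lemma block2Z n (c : R[i]) y : block2 n (fun j => c * y j) = modc c * block2 n y.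
Proof.
rewrite /block2 -[modc c in RHS]ger0_norm ?modc_ge0 // -sqrtr_sqr -sqrtrM ?sqr_ge0 //.
by rewrite mulr_sumr; congr Num.sqrt; apply: eq_bigr => i _; rewrite modcM exprMn.
Qed.

Lemma OmegaZ (c : R[i]) y j : Omega (fun j => c * y j) j = c * Omega y j.
Proof.
have [->|c0] := eqVneq c 0; first by rewrite /Omega !mul0r mulr0.
rewrite /Omega /lam block2Z modcM -mulf_div mulfV ?mul1r; first by rewrite mulrCA.
by rewrite modc_eq0.
Qed.

Lemma sqr_sum_le (m : nat) (a : 'I_m -> R) :
  (\sum_i a i) ^+ 2 <= m%:R * \sum_i a i ^+ 2.
Proof.
have h0 : 0 <= \sum_i a i ^+ 2 by apply: sumr_ge0 => i _; exact: sqr_ge0.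
rewrite -[leLHS]real_normK ?num_real //.
have H (b : 'I_m -> R) : (forall i, b i ^+ 2 = a i ^+ 2) ->
    \sum_i b i <= Num.sqrt (\sum_i a i ^+ 2) * Num.sqrt m%:R.
  move=> hb; rewrite -[leLHS](eq_bigr _ (fun i _ => mulr1 (b i))).
  apply: cauchy_schwarz_sum; rewrite ?sqrtr_ge0 // sqr_sqrtr //.
    by rewrite (eq_bigr _ (fun i _ => hb i)).
  by rewrite (eq_bigr (fun=> 1)) ?sumr_const ?card_ord // => i _; rewrite expr1n.
have -> : m%:R * \sum_i a i ^+ 2 = (Num.sqrt (\sum_i a i ^+ 2) * Num.sqrt m%:R) ^+ 2.
  by rewrite exprMn !sqr_sqrtr // mulrC.
apply: ler_sqr_ge0 => //; apply: (le_trans (ler_norm_sum _ _ _)).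
by apply: H => i; rewrite real_normK ?num_real.
Qed.

Lemma modc_sum_sqr (m : nat) (a : 'I_m -> R[i]) :
  modc (\sum_i a i) ^+ 2 <= m%:R * \sum_i modc (a i) ^+ 2.
Proof.
by apply: le_trans (sqr_sum_le _); apply: ler_sqr_ge0 (modc_ge0 _) (modc_sum _ _ _).
Qed.

(** This is t |ln t| <= 1 for 0 < t <= 1. *)
Lemma mul_norm_ln_le (v A : R) : 0 < v -> v <= A -> v * `|ln (v / A)| <= A.
Proof.
move=> v0 vA; have A0 : 0 < A by exact: lt_le_trans vA.
have t0 : 0 < v / A by rewrite divr_gt0.
rewrite ler0_norm; last by apply: ln_le0; rewrite ler_pdivrMr // mul1r.
have h : - ln (v / A) <= A / v.
  have := @expR_ge1Dx R (- ln (v / A)); rewrite expRN lnK ?posrE // invf_div; lra.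
by apply: (le_trans (ler_wpM2l (ltW v0) h)); rewrite mulrCA mulfV ?mulr1 ?gt_eqF.
Qed.

(** Any majorants A of |v_j| and B of the block norm may replace them in the
logarithm. The resulting multiplier does not depend on v, and the two error terms
are of the order of A and of the normalised coordinates times B. *)
Lemma Omega_approx v j (A B : R) : modc (v j) <= A -> block2 (blk j) v <= B ->
  modc (Omega v j - (- (4 * eps R (blk j) * ln (A / B)))%:C * v j) <=
    4 * eps R (blk j) * (A + modc (v j) / block2 (blk j) v * B).
Proof.
move=> vA vB; have e0 := eps_ge0 R (blk j).
have [v0|v0] := eqVneq (v j) 0.
  rewrite /Omega v0 !mulr0 subrr modc0 mul0r mul0r addr0 !mulr_ge0 //.
  exact: le_trans (modc_ge0 _) vA.
have b0 := block2_gt0 v0; rewrite -modc_gt0 in v0.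
have A0 := lt_le_trans v0 vA; have B0 := lt_le_trans b0 vB.
have cB (a b : R) : a%:C - b%:C = (a - b)%:C by apply/eqP; rewrite eq_complex /= subrr !eqxx.
rewrite /Omega -mulrBl modcM cB modc_real.
have -> : - (4 * eps R (blk j) * lam v j) - - (4 * eps R (blk j) * ln (A / B)) =
  (4 * eps R (blk j)) * (ln (A / B) - lam v j) by ring.
have k0 : 0 <= 4 * eps R (blk j) by rewrite mulr_ge0.
rewrite normrM (ger0_norm k0) -[leLHS]mulrA (ler_wpM2l k0) //.
have -> : ln (A / B) - lam v j = ln (block2 (blk j) v / B) - ln (modc (v j) / A).
  by rewrite /lam !ln_div ?posrE //; ring.
rewrite mulrC (le_trans (ler_wpM2l (ltW v0) (ler_normB _ _))) // mulrDr addrC lerD //.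
  exact: mul_norm_ln_le.
have h := mul_norm_ln_le b0 vB.
rewrite -[leRHS]mulrA (ler_wpM2l (ltW v0)) // [leRHS]mulrC ler_pdivlMr // mulrC.
exact: h.
Qed.

(** With majorants A, B common to the m vectors and to their sum, Omega_approx
replaces Omega by one and the same multiplication operator in all the m + 1
terms, and multiplication operators are additive. *)
Lemma Omega_quasilinear_block (m : nat) (ys : 'I_m -> omega R) n : (4 <= n)%N ->
  \sum_(i < J_dim n) modc (Omega (fun j => \sum_k ys k j) (J_offset n + i)%N -
      \sum_k Omega (ys k) (J_offset n + i)%N) ^+ 2 <=
  64 * m.+1%:R ^+ 3 * eps R n ^+ 2 * \sum_k block2 n (ys k) ^+ 2.
Proof.
move=> n4; set s : omega R := fun j => \sum_k ys k j.
pose T := \sum_k block2 n (ys k) ^+ 2.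
have T0 : 0 <= T by apply: sumr_ge0 => k _; exact: sqr_ge0.
pose A j : R := Num.sqrt (m%:R * \sum_k modc (ys k j) ^+ 2).
pose B : R := Num.sqrt (m%:R * T).
have A2 j : A j ^+ 2 = m%:R * \sum_k modc (ys k j) ^+ 2.
  by rewrite sqr_sqrtr // mulr_ge0 // sumr_ge0 // => k _; exact: sqr_ge0.
have B2 : B ^+ 2 = m%:R * T by rewrite sqr_sqrtr // mulr_ge0.
have A0 j : 0 <= A j by exact: sqrtr_ge0.
have B0 : 0 <= B by exact: sqrtr_ge0.
have m1 (k : 'I_m) : 1 <= m%:R :> R by rewrite ler1n; case: m k {ys s T T0 A B A2 B2 A0 B0} => [[]|].
have le_sqr (a b : R) : 0 <= b -> a ^+ 2 <= b ^+ 2 -> a <= b.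
  by move=> b0 ab; rewrite leNgt; apply/negP => ba; move: ab; rewrite leNgt ltr_pXn2r ?ba // nnegrE // (le_trans b0) // ltW.
have yA k j : modc (ys k j) <= A j.
  apply: le_sqr => //; rewrite A2 (bigD1 k) //= mulrDr -[leLHS]addr0 lerD //.
    by rewrite ler_peMl ?sqr_ge0 ?m1.
  by rewrite mulr_ge0 // sumr_ge0 // => ? _; exact: sqr_ge0.
have sA j : modc (s j) <= A j by apply: le_sqr => //; rewrite A2; exact: modc_sum_sqr.
have yB k : block2 n (ys k) <= B.
  apply: le_sqr => //; rewrite B2 /T (bigD1 k) //= mulrDr -[leLHS]addr0 lerD //.
    by rewrite ler_peMl ?sqr_ge0 ?m1.
  by rewrite mulr_ge0 // sumr_ge0 // => ? _; exact: sqr_ge0.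
have sumA : \sum_(i < J_dim n) A (J_offset n + i)%N ^+ 2 = B ^+ 2.
  rewrite (eq_bigr _ (fun i _ => A2 _)) -mulr_sumr B2 exchange_big /=.
  by congr (_ * _); apply: eq_bigr => k _; rewrite sqr_block2.
have sB : block2 n s <= B.
  apply: le_sqr => //; rewrite sqr_block2 -sumA; apply: ler_sum => i _.
  exact: ler_sqr_ge0 (modc_ge0 _) (sA _).
pose E v i : R := A (J_offset n + i)%N ^+ 2 + wgt v (J_offset n + i)%N * B ^+ 2.
have E0 v i : 0 <= E v i by rewrite addr_ge0 ?sqr_ge0 // mulr_ge0 ?sqr_ge0 ?wgt_ge0.
have app v (i : 'I_(J_dim n)) : modc (v (J_offset n + i)%N) <= A (J_offset n + i)%N -> block2 n v <= B ->
    modc (Omega v (J_offset n + i)%N -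
      (- (4 * eps R n * ln (A (J_offset n + i)%N / B)))%:C * v (J_offset n + i)%N) ^+ 2 <=
    32 * eps R n ^+ 2 * E v i.
  move=> h1 h2; have := @Omega_approx v (J_offset n + i)%N _ B h1; rewrite blkE // => /(_ h2) h3.
  apply: le_trans (ler_sqr_ge0 (modc_ge0 _) h3) _.
  rewrite /E /wgt blkE // exprMn; set a := A _; set r := modc _ / _.
  have -> : modc (v (J_offset n + i)%N) ^+ 2 / block2 n v ^+ 2 = r ^+ 2 by rewrite expr_div_n.
  have -> : 32 * eps R n ^+ 2 * (a ^+ 2 + r ^+ 2 * B ^+ 2) =
    (4 * eps R n) ^+ 2 * (2 * (a ^+ 2 + r ^+ 2 * B ^+ 2)) by ring.
  rewrite ler_wpM2l ?sqr_ge0 // -subr_ge0.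
  have -> : 2 * (a ^+ 2 + r ^+ 2 * B ^+ 2) - (a + r * B) ^+ 2 = (a - r * B) ^+ 2 by ring.
  exact: sqr_ge0.
have sumE v : \sum_(i < J_dim n) E v i <= 2 * B ^+ 2.
  rewrite big_split /= sumA -mulr_suml mulr_natl mulr2n lerD2l ler_piMl ?sqr_ge0 //.
  exact: sum_wgt.
apply: (@le_trans _ _ (\sum_(i < J_dim n) (m.+1%:R * (32 * eps R n ^+ 2 * (E s i + \sum_k E (ys k) i))))).
  apply: ler_sum => i _; set j := (J_offset n + i)%N.
  set K := (- (4 * eps R n * ln (A j / B)))%:C.
  have -> : Omega s j - \sum_k Omega (ys k) j =
      \sum_(k < m.+1) oapp (fun k => - (Omega (ys k) j - K * ys k j)) (Omega s j - K * s j) (unlift ord0 k).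
    rewrite big_ord_recl unlift_none /=.
    have -> : \sum_(k < m) oapp (fun k => - (Omega (ys k) j - K * ys k j))
        (Omega s j - K * s j) (unlift ord0 (lift ord0 k)) =
        \sum_(k < m) (- Omega (ys k) j + K * ys k j).
      by apply: eq_bigr => k _; rewrite liftK /= opprB addrC.
    have e (p q r t : R[i]) : p - q = p - r * t + (- q + r * t) by ring.
    by rewrite big_split /= -mulr_sumr sumrN; exact: e.
  apply: le_trans (modc_sum_sqr _) _; rewrite ler_wpM2l // big_ord_recl unlift_none /= mulrDr.
  apply: lerD; first by apply: app; [exact: sA|exact: sB].
  rewrite [leRHS]mulr_sumr; apply: ler_sum => k _; rewrite liftK /= modcN.
  by apply: app; [exact: yA|exact: yB].
rewrite -mulr_sumr -mulr_sumr big_split /= exchange_big /=.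
have H : \sum_(i < J_dim n) E s i + \sum_(k < m) \sum_(i < J_dim n) E (ys k) i <= m.+1%:R * (2 * B ^+ 2).
  rewrite -addn1 natrD mulrDl mul1r addrC lerD ?sumE //.
  rewrite -[m in X in _ <= X]card_ord -sum1_card natr_sum mulr_suml; apply: ler_sum => k _.
  by rewrite mul1r sumE.
have me : 0 <= m.+1%:R * (32 * eps R n ^+ 2) :> R.
  by apply: mulr_ge0 => //; apply: mulr_ge0 => //; exact: sqr_ge0.
rewrite mulrA (le_trans (ler_wpM2l me H)) // B2.
have -> : m.+1%:R * (32 * eps R n ^+ 2) * (m.+1%:R * (2 * (m%:R * T))) =
  64 * m.+1%:R ^+ 2 * eps R n ^+ 2 * T * m%:R by ring.
have -> : 64 * m.+1%:R ^+ 3 * eps R n ^+ 2 * \sum_k block2 n (ys k) ^+ 2 =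
  64 * m.+1%:R ^+ 2 * eps R n ^+ 2 * T * m.+1%:R by rewrite /T; ring.
apply: ler_wpM2l; last by rewrite ler_nat.
apply: mulr_ge0 => //; apply: mulr_ge0; last exact: sqr_ge0.
by apply: mulr_ge0 => //; exact: sqr_ge0.
Qed.

Lemma Omega_quasilinear (m : nat) (ys : 'I_m -> omega R) (N0 N : nat) :
  (4 <= N0)%N -> (4 <= N)%N -> (forall k j, (blk j < N0)%N -> ys k j = 0) ->
  \sum_(j < J_offset N) modc (Omega (fun j => \sum_k ys k j) j - \sum_k Omega (ys k) j) ^+ 2 <=
  64 * m.+1%:R ^+ 3 / N0%:R * \sum_k \sum_(j < J_offset N) modc (ys k j) ^+ 2.
Proof.
move=> N04 N4 h0; pose D j := modc (Omega (fun j => \sum_k ys k j) j - \sum_k Omega (ys k) j) ^+ 2.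
rewrite (sum_blocks D N4).
have -> : \sum_k \sum_(j < J_offset N) modc (ys k j) ^+ 2 =
    \sum_(4 <= n < N) \sum_k block2 n (ys k) ^+ 2.
  rewrite [RHS]exchange_big /=; apply: eq_bigr => k _.
  rewrite (sum_blocks (fun j => modc (ys k j) ^+ 2) N4).
  by apply: eq_bigr => n _; rewrite sqr_block2.
rewrite mulr_sumr; apply: ler_sum_nat => n /andP[n4 _].
have N00 : 0 < N0%:R :> R by rewrite ltr0n (leq_trans _ N04).
have R0 : 0 <= \sum_k block2 n (ys k) ^+ 2 by apply: sumr_ge0 => k _; exact: sqr_ge0.
have [nN|nN] := ltnP n N0.
  rewrite big1 => [|i _].
    by rewrite !mulr_ge0 // ?invr_ge0 ?(ltW N00) // exprn_ge0.
  rewrite /D /Omega !(big1 _ _ _ (fun k _ => _)) => [|k _|k _]; rewrite ?h0 ?blkE ?mulr0 //.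
  by rewrite subrr modc0 expr0n.
apply: le_trans (Omega_quasilinear_block ys n4) _; rewrite sqr_eps ler_wpM2r //.
by rewrite ler_wpM2l ?mulr_ge0 ?exprn_ge0 // lef_pV2 ?posrE // ?ltr0n ?ler_nat // (leq_trans _ n4).
Qed.

End QuasiLinear.

(** * Orthogonalisation in l_2 *)

Section Gram.
Variable R : realType.

Lemma cvg_sum_cplx (T : Type) (F : set_system T) (FF : Filter F) (I : finType)
    (f : I -> T -> Cplx R) (l : I -> Cplx R) : (forall i, f i @ F --> l i) ->
  (fun t => \sum_i f i t) @ F --> \sum_i l i.
Proof.
move=> h; elim: (index_enum I) => [|i s IH].
  rewrite big_nil; have -> : (fun t => \sum_(i <- [::]) f i t) = (fun=> 0).
    by apply/funext => t; rewrite big_nil.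
  exact: cvg_cst.
rewrite big_cons; have -> : (fun t => \sum_(j <- i :: s) f j t) = (fun t => f i t + \sum_(j <- s) f j t).
  by apply/funext => t; rewrite big_cons.
exact: cvgD (h i) IH.
Qed.

Lemma cvg_Re (f : nat -> Cplx R) (g : nat -> R) (l : Cplx R) : f @ \oo --> l ->
  (forall n, f n = (g n)%:C) -> g @ \oo --> complex.Re l.
Proof.
move=> /cvgc_modcP h fg; apply/cvgrPdist_lt => e e0.
have := h e e0; apply: filterS => n; apply: le_lt_trans.
apply: le_trans (normr_Re_le _); rewrite fg.
by case: (l) => p q /=; rewrite distrC.
Qed.

(** Orthogonalisation of finitely many square summable sequences: the limits of
the partial Gram matrices form a Hermitian matrix, which the spectral theorem
diagonalises. *)
Lemma gram_diag (n : nat) (z : 'I_n -> nat -> R[i]) :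
  (forall k, exists C : R, forall M, \sum_(j < M) modc (z k j) ^+ 2 <= C) ->
  exists P : 'M[R[i]]_n, exists2 d : 'I_n -> R, P \in unitmx /\ (forall k, 0 <= d k) &
    forall c : 'I_n -> R[i],
      (fun M => \sum_(j < M) modc (\sum_k c k * \sum_l P k l * z l j) ^+ 2) @ \oo -->
      \sum_k modc (c k) ^+ 2 * d k.
Proof.
move=> /choice[C hC].
have [G0 hG0] : exists G : 'I_n -> 'I_n -> Cplx R, forall k l,
    series (fun j => z k j * conjc (z l j) : Cplx R) @ \oo --> G k l.
  suff /choice[G hG] : forall kl : 'I_n * 'I_n, exists s : Cplx R,
      series (fun j => z kl.1 j * conjc (z kl.2 j) : Cplx R) @ \oo --> s.
    by exists (fun k l => G (k, l)) => k l; exact: (hG (k, l)).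
  move=> [k l] /=.
  have [|s hs _] := @cabs_series_cvg R (fun j => z k j * conjc (z l j)) (C k + C l); last by exists s.
  move=> M; apply: le_trans (lerD (hC k M) (hC l M)); rewrite -big_split /=; apply: ler_sum => j _.
  rewrite modcM modc_conj; have := sqr_ge0 (modc (z k j) - modc (z l j)).
  have := sqr_ge0 (modc (z k j) + modc (z l j)); nra.
pose G : 'M[R[i]]_n := \matrix_(k, l) G0 k l.
have Gherm : G \is hermsymmx.
  apply/is_hermitianmxP; rewrite expr0 scale1r; apply/matrixP => k l; rewrite !mxE.
  apply/eqP; rewrite -subr_eq0 -modc_eq0 eq_le modc_ge0 andbT; apply/ler_addgt0Pr => e e0.
  have e2 : 0 < e / 2 by rewrite divr_gt0.
  have /cvgc_modcP/(_ _ e2)[m1 _ h1] := hG0 k l; have /cvgc_modcP/(_ _ e2)[m2 _ h2] := hG0 l k.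
  have {}h1 := h1 (maxn m1 m2) (leq_maxl _ _); have {}h2 := h2 (maxn m1 m2) (leq_maxr _ _).
  move: h1 h2; set a := series _ _; set b := series _ _ => h1 h2.
  have ab : a = conjc b.
    rewrite /a /b /series /= (big_morph _ (rmorphD _) (rmorph0 _)); apply: eq_bigr => j _.
    by rewrite rmorphM /= conjcK mulrC.
  rewrite add0r (_ : G0 k l - _ = (conjc b - conjc (G0 l k)) - (a - G0 k l)); last by rewrite ab; ring.
  rewrite (le_trans (modcB _ _)) // (splitr e) lerD ?(ltW h1) //.
  by rewrite -rmorphB modc_conj ltW.
have Gnorm := hermitian_normalmx Gherm.
have := orthomx_spectralP Gnorm; set P := spectralmx G; set sp := spectral_diag G.
have Pu := spectral_unitarymx G; rewrite -/P in Pu.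
rewrite (invmx_unitary Pu) => GE.
have main (c : 'I_n -> R[i]) :
    (fun M => \sum_(j < M) modc (\sum_k c k * \sum_l P k l * z l j) ^+ 2) @ \oo -->
      \sum_k modc (c k) ^+ 2 * complex.Re (sp ord0 k).
  pose c' l := \sum_k c k * P k l.
  have E j : \sum_k c k * \sum_l P k l * z l j = \sum_l c' l * z l j.
    rewrite (eq_bigr (fun k => \sum_l c k * P k l * z l j)); last first.
      by move=> k _; rewrite mulr_sumr; apply: eq_bigr => l _; rewrite mulrA.
    by rewrite exchange_big; apply: eq_bigr => l _; rewrite mulr_suml.
  pose f M : Cplx R := \sum_(kl : 'I_n * 'I_n) (c' kl.1 * conjc (c' kl.2)) *
    series (fun j => z kl.1 j * conjc (z kl.2 j) : Cplx R) M.
  have fE M : f M = (\sum_(j < M) modc (\sum_k c k * \sum_l P k l * z l j) ^+ 2)%:C.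
    rewrite (big_morph (real_complex R) (rmorphD _) (rmorph0 _)).
    rewrite [RHS](eq_bigr (fun j : 'I_M => \sum_(kl : 'I_n * 'I_n) (c' kl.1 * conjc (c' kl.2)) *
      (z kl.1 j * conjc (z kl.2 j)))); last first.
      move=> j _; rewrite E -mul_conjc (big_morph conjc (rmorphD _) (rmorph0 _)) big_distrl /=.
      rewrite (eq_bigr (fun k => \sum_l c' k * z k j * conjc (c' l * z l j))); last first.
        by move=> k _; rewrite mulr_sumr.
      rewrite pair_big /=; apply: eq_bigr => -[k l] _ /=; rewrite rmorphM /=; ring.
    rewrite exchange_big /=; apply: eq_bigr => kl _.
    by rewrite /series /= big_mkord mulr_sumr.
  have fl : f @ \oo --> (\sum_(kl : 'I_n * 'I_n) (c' kl.1 * conjc (c' kl.2)) * G kl.1 kl.2 : Cplx R).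
    apply: cvg_sum_cplx => -[k l] /=; rewrite mxE; apply: cvgMr; exact: hG0.
  have := cvg_Re fl fE; move/cvg_trans; apply; rewrite (_ : complex.Re _ = \sum_k modc (c k) ^+ 2 * complex.Re (sp ord0 k)) //.
  pose cv : 'rV[R[i]]_n := \row_k c k.
  have cP : cv *m P = \row_l c' l.
    by apply/rowP => l; rewrite !mxE; apply: eq_bigr => k _; rewrite mxE.
  have -> : \sum_(kl : 'I_n * 'I_n) c' kl.1 * conjc (c' kl.2) * G kl.1 kl.2 =
      (cv *m P *m G *m (map_mx Num.conj (trmx (cv *m P)))) ord0 ord0.
    rewrite cP !mxE -(pair_big xpredT xpredT (fun k l => c' k * conjc (c' l) * G k l)) /= exchange_big /=.
    apply: eq_bigr => l _; rewrite !mxE mulr_suml; apply: eq_bigr => k _; rewrite !mxE.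
    by rewrite mulrAC.
  have -> : cv *m P *m G *m (map_mx Num.conj (trmx (cv *m P))) =
      cv *m diag_mx sp *m map_mx Num.conj (trmx cv).
    rewrite trmx_mul map_mxM {1}GE !mulmxA.
    have PP : P *m map_mx Num.conj (trmx P) = 1%:M by exact/unitarymxP.
    by rewrite -(mulmxA cv P) PP mulmx1 -(mulmxA (cv *m diag_mx sp) P) PP mulmx1.
  rewrite !mxE (big_morph (@complex.Re R) (raddfD _) (raddf0 _)); apply: eq_bigr => k _.
  rewrite mul_mx_diag !mxE mulrAC mul_conjc.
  by case: (sp _ _) => p q /=; rewrite mul0r subr0.
exists P, (fun k => complex.Re (sp ord0 k)) => //; split; first exact: unitarymx_unit.
move=> k; have := main (fun l => (l == k)%:R).
have -> : \sum_k0 modc (k0 == k)%:R ^+ 2 * complex.Re (sp ord0 k0) = complex.Re (sp ord0 k).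
  rewrite (bigD1 k) //= eqxx modc1 expr1n mul1r big1 ?addr0 // => l /negPf ->.
  by rewrite modc0 expr0n mul0r.
move=> hk; rewrite -(cvg_lim _ hk) //; apply: limr_ge; first by apply/cvg_ex; eexists; exact: hk.
by near=> M; apply: sumr_ge0 => j _; exact: sqr_ge0.
Unshelve. all: by end_near. Qed.

End Gram.

(** * Z(J) as a twisted sum of two copies of l_2 *)

Section SpaceZJ.
Variable R : realType.
Notation V := (omega R * omega R)%type.
Implicit Types (u y w x : omega R) (v e : V).
#[local] Opaque J_block_norm.

(** The pair of v.2 and this sequence identifies Z(J), not linearly, with pairs of
elements of l_2. *)
Definition defect v : omega R := fun j => v.1 j - Omega v.2 j.

Definition l2_bounded (y : omega R) : Prop := exists2 c, 0 <= c & l2le y c.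

Lemma l2leD y w a b : 0 <= a -> 0 <= b -> l2le y a -> l2le w b ->
  l2le (fun j => y j + w j) (2 * (a + b)).
Proof.
move=> a0 b0 ya wb M.
apply: (@le_trans _ _ (2 * a ^+ 2 + 2 * b ^+ 2)).
  apply: (@le_trans _ _ (\sum_(j < M) (2 * modc (y j) ^+ 2 + 2 * modc (w j) ^+ 2))).
    apply: ler_sum => j _; apply: le_trans (ler_sqr_ge0 (modc_ge0 _) (modcD _ _)) _.
    by rewrite -subr_ge0 (_ : _ - _ = (modc (y j) - modc (w j)) ^+ 2) ?sqr_ge0 //; ring.
  by rewrite big_split /= -!mulr_sumr; apply: lerD; rewrite ler_wpM2l //; [exact: ya|exact: wb].
by have := mulr_ge0 a0 b0; have := sqr_ge0 a; have := sqr_ge0 b; nra.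
Qed.

Lemma l2leZ y (c : R[i]) a : l2le y a -> l2le (fun j => c * y j) (modc c * a).
Proof.
move=> ya M; rewrite (eq_bigr (fun j : 'I_M => modc c ^+ 2 * modc (y j) ^+ 2)).
  by rewrite -mulr_sumr exprMn ler_wpM2l ?sqr_ge0 //; exact: ya.
by move=> j _; rewrite modcM exprMn.
Qed.

(** Together with the converse bound ZJ_upper, this reduces estimates of the norm to
estimates in l_2. *)
Lemma ZJ_lowerP v c : (ZJ_norm v < c%:E)%E -> [/\ 0 <= c, l2le v.2 c & l2le (defect v) (8 * c)].
Proof.
case: v => x y h; have [h1 h2] := Z_norm_lower h; split => //.
rewrite ltW // -lte_fin; apply: le_lt_trans h.
apply: le_ereal_inf_tmp => _ [F [FF _ _] <-]; rewrite /calF_norm le_max; apply/orP; left.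
by apply: le_trans (J_norm_ge0 (F (0%R +i* 0%R))) _; apply: ereal_sup_ubound; exists 0.
Qed.

Lemma ZJ_norm_ge0 v : (0 <= ZJ_norm v)%E.
Proof.
apply: le_ereal_inf_tmp => _ [F [FF _ _] <-]; rewrite /calF_norm le_max; apply/orP; left.
by apply: le_trans (J_norm_ge0 (F (0%R +i* 0%R))) _; apply: ereal_sup_ubound; exists 0.
Qed.

Lemma ZJ_upper v a b : 0 <= a -> 0 <= b -> l2le v.2 a -> l2le (defect v) b ->
  (ZJ_norm v <= (8 * (a + 3 * b))%:E)%E.
Proof. by case: v => x y; exact: Z_norm_upper. Qed.

Lemma space_ZJP v : Defs.space (@ZJ_norm R) v <-> l2_bounded v.2 /\ l2_bounded (defect v).
Proof.
rewrite /Defs.space /=; split=> [h|[[a a0 ya] [b b0 xb]]]; last first.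
  by apply: le_lt_trans (ZJ_upper a0 b0 ya xb) _; exact: ltry.
have := ZJ_norm_ge0 v; case E : (ZJ_norm v) h => [r| |] // _; rewrite lee_fin => r0.
have [|h0 h1 h2] := @ZJ_lowerP v (r + 1); first by rewrite E lte_fin ltrDl.
by split; [exists (r + 1)|exists (8 * (r + 1)); rewrite ?mulr_ge0].
Qed.

Lemma l2_bounded_lin (c : R[i]) y w : l2_bounded y -> l2_bounded w ->
  l2_bounded (fun j => c * y j + w j).
Proof.
move=> [a a0 ya] [b b0 wb]; exists (2 * (modc c * a + b)).
  by rewrite mulr_ge0 // addr_ge0 // mulr_ge0 ?modc_ge0.
by apply: l2leD (l2leZ c ya) wb => //; rewrite mulr_ge0 ?modc_ge0.
Qed.

Lemma l2_boundedP y : l2_bounded y <-> exists C : R, forall M, \sum_(j < M) modc (y j) ^+ 2 <= C.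
Proof.
split=> [[c c0 yc]|[C hC]]; first by exists (c ^+ 2).
have C0 : 0 <= C by have := hC 0%N; rewrite big_ord0.
by exists (Num.sqrt C); rewrite ?sqrtr_ge0 // => M; rewrite sqr_sqrtr.
Qed.

Lemma l2_bounded_ext (y w : omega R) : (forall j, y j = w j) -> l2_bounded y -> l2_bounded w.
Proof. by move=> /funext ->. Qed.

(** Quasi-linearity on all blocks: this makes Z(J) closed under addition. *)
Lemma l2_bounded_OmegaD y w : l2_bounded y -> l2_bounded w ->
  l2_bounded (fun j => Omega (fun j => y j + w j) j - (Omega y j + Omega w j)).
Proof.
move=> /l2_boundedP[C1 h1] /l2_boundedP[C2 h2]; apply/l2_boundedP.
exists (64 * 3%:R ^+ 3 / 4%:R * (C1 + C2)) => M.
have [N N4 MN] := J_offset_unbounded M.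
pose ys (k : 'I_2) : omega R := if k == ord0 then y else w.
have E2 (T : nmodType) (f : 'I_2 -> T) : \sum_k f k = f ord0 + f (lift ord0 ord0).
  by rewrite big_ord_recl big_ord1.
have yw : (fun j => \sum_k ys k j) = (fun j => y j + w j) by apply/funext => j; rewrite E2.
have h0 : forall k j, (blk j < 4)%N -> ys k j = 0.
  by move=> k j; rewrite ltnNge blk_ge4.
have := @Omega_quasilinear R 2 ys 4 N isT N4 h0.
rewrite yw E2 /= => H.
rewrite -(big_mkord xpredT (fun j => modc (Omega (fun j => y j + w j) j - (Omega y j + Omega w j)) ^+ 2)).
apply: (@le_trans _ _ (\sum_(j < J_offset N)
   modc (Omega (fun j => y j + w j) j - \sum_k Omega (ys k) j) ^+ 2)).
  rewrite -(big_mkord xpredT (fun j => modc (Omega (fun j => y j + w j) j - \sum_k Omega (ys k) j) ^+ 2)).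
  rewrite (big_cat_nat (leq0n M) MN) /= ler_wpDr //; first by apply: sumr_ge0 => ? _; exact: sqr_ge0.
  by apply: ler_sum => j _; rewrite E2.
apply: (le_trans H); rewrite ler_wpM2l ?mulr_ge0 ?invr_ge0 ?exprn_ge0 //.
by apply: lerD; [exact: h1|exact: h2].
Qed.

Lemma space_ZJ_lin (c : R[i]) v e : Defs.space (@ZJ_norm R) v -> Defs.space (@ZJ_norm R) e ->
  Defs.space (@ZJ_norm R) (c *: v + e).
Proof.
move=> /space_ZJP[v2 dv] /space_ZJP[e2 de]; apply/space_ZJP; split.
  exact: l2_bounded_ext (l2_bounded_lin c v2 e2).
have cv2 : l2_bounded (fun j => c * v.2 j).
  by have [a a0 ya] := v2; exists (modc c * a); [rewrite mulr_ge0 ?modc_ge0|exact: l2leZ].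
have H := l2_bounded_lin (-1) (l2_bounded_OmegaD cv2 e2) (l2_bounded_lin c dv de).
apply: l2_bounded_ext H => j; rewrite OmegaZ /defect /=.
have E (p q r s t a : R[i]) : -1 * (p - (a * q + r)) + (a * (s - q) + (t - r)) = a * s + t - p by ring.
exact: E.
Qed.

Lemma ZJ_norm0 : ZJ_norm (0 : V) = 0%E.
Proof.
have l20 : l2le (0 : omega R) 0 by move=> M; rewrite big1 ?expr0n // => j _; rewrite modc0 expr0n.
have d0 : defect 0 = 0.
  apply/funext => j.
  transitivity (0 - (- (4 * eps R (blk j) * lam (0 : omega R) j))%:C * 0 : R[i]) => //.
  by rewrite mulr0 subrr.
apply/eqP; rewrite eq_le ZJ_norm_ge0 andbT.
have := @ZJ_upper (0 : V) 0 0 (lexx 0) (lexx 0) l20.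
by rewrite d0 mulr0 addr0 mulr0; apply.
Qed.

Lemma space_ZJ0 : Defs.space (@ZJ_norm R) 0.
Proof. by rewrite /Defs.space /= ZJ_norm0. Qed.

Lemma lincomb1 n (b : 'I_n -> V) c j : (lincomb b c).1 j = \sum_k c k * (b k).1 j.
Proof.
rewrite /lincomb; elim: (index_enum _) => [|k s IH]; first by rewrite !big_nil.
by rewrite !big_cons -IH.
Qed.

Lemma lincomb2 n (b : 'I_n -> V) c j : (lincomb b c).2 j = \sum_k c k * (b k).2 j.
Proof.
rewrite /lincomb; elim: (index_enum _) => [|k s IH]; first by rewrite !big_nil.
by rewrite !big_cons -IH.
Qed.

Lemma space_ZJ_lincomb n (b : 'I_n -> V) c : (forall k, Defs.space (@ZJ_norm R) (b k)) ->
  Defs.space (@ZJ_norm R) (lincomb b c).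
Proof.
move=> hb; rewrite /lincomb; elim: (index_enum _) => [|k s IH].
  by rewrite big_nil; exact: space_ZJ0.
by rewrite big_cons; exact: space_ZJ_lin.
Qed.

Lemma lincomb_mx n (b : 'I_n -> V) (P : 'M[R[i]]_n) c :
  lincomb (fun k => lincomb b (P k)) c = lincomb b (fun l => \sum_k c k * P k l).
Proof.
have E (f : 'I_n -> R[i]) : \sum_k c k * \sum_l P k l * f l = \sum_l (\sum_k c k * P k l) * f l.
  rewrite (eq_bigr (fun k => \sum_l c k * P k l * f l)); last first.
    by move=> k _; rewrite mulr_sumr; apply: eq_bigr => l _; rewrite mulrA.
  by rewrite exchange_big; apply: eq_bigr => l _; rewrite mulr_suml.
rewrite [LHS]surjective_pairing [RHS]surjective_pairing; congr pair; apply/funext => j.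
  rewrite !lincomb1 -E; apply: eq_bigr => k _; by rewrite lincomb1.
by rewrite !lincomb2 -E; apply: eq_bigr => k _; rewrite lincomb2.
Qed.

Definition independent n (b : 'I_n -> V) := forall c, lincomb b c = 0 -> forall i, c i = 0.

Lemma change_basis n (b : 'I_n -> V) (P : 'M[R[i]]_n) : P \in unitmx -> independent b ->
  independent (fun k => lincomb b (P k)) /\
  range (lincomb (fun k => lincomb b (P k))) = range (lincomb b).
Proof.
move=> Pu hb; split=> [c|].
  rewrite lincomb_mx => /hb h k.
  have h0 : (\row_k c k) *m P = 0.
    by apply/rowP => l; rewrite !mxE -[RHS](h l); apply: eq_bigr => i _; rewrite mxE.
  have : (\row_k c k) *m P *m invmx P = 0 by rewrite h0 mul0mx.
  by rewrite mulmxK // => /rowP/(_ k); rewrite !mxE.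
apply/seteqP; split=> _ [c _ <-]; first by rewrite lincomb_mx; eexists.
exists (fun k => ((\row_k c k) *m invmx P) ord0 k) => //; rewrite lincomb_mx; congr (lincomb b).
apply/funext => l; have : ((\row_k c k) *m invmx P *m P) ord0 l = c l by rewrite mulmxKV // mxE.
by rewrite mxE.
Qed.

Lemma nondecreasing_sum_le (f : nat -> R) (L : R) : (forall j, 0 <= f j) ->
  (fun M => \sum_(j < M) f j) @ \oo --> L -> forall M, \sum_(j < M) f j <= L.
Proof.
move=> f0 fL M; rewrite -(cvg_lim _ fL) //.
have := @nondecreasing_cvgn_le R (fun M => \sum_(j < M) f j); apply.
  by apply/nondecreasing_seqP => n; rewrite big_ord_recr lerDl.
by apply/cvg_ex; exists L.
Qed.

Lemma lim_sum_le (f : nat -> R) (L C : R) : (forall M, \sum_(j < M) f j <= C) ->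
  (fun M => \sum_(j < M) f j) @ \oo --> L -> L <= C.
Proof.
move=> fC fL; rewrite -(cvg_lim _ fL) //; apply: limr_le; first by apply/cvg_ex; exists L.
by near=> M; exact: fC.
Unshelve. all: by end_near. Qed.

Lemma cvg_seq_eq (f g : nat -> R) (l : R) : (forall M, f M = g M) ->
  f @ \oo --> l -> g @ \oo --> l.
Proof. by move=> /funext ->. Qed.

End SpaceZJ.

(** * Euclidean coordinates on subspaces of remote tails *)

Section Frame.
Variable R : realType.
Notation V := (omega R * omega R)%type.
Implicit Types (e : V).
#[local] Opaque J_block_norm.

Definition tail_space (N0 : nat) : set V :=
  [set v | Defs.space (@ZJ_norm R) v /\ forall j, (blk j < N0)%N -> v.1 j = 0 /\ v.2 j = 0].

Lemma lincomb_pick n (b : 'I_n -> V) k : lincomb b (fun l => (l == k)%:R) = b k.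
Proof.
rewrite /lincomb (bigD1 k) //= eqxx scale1r big1 ?addr0 // => l /negPf ->.
by rewrite scale0r.
Qed.

(** After orthogonalising the second components, the linear map that agrees with
Omega on the basis approximates Omega on the whole subspace: the error is bounded
by the orthogonal sum of the squares, with a factor that the remoteness of the
tail makes at most 1. *)
Lemma linearizing_basis n (N0 : nat) (E : set V) : (4 <= N0)%N -> (64 * n.+1 ^ 3 <= N0)%N ->
  E `<=` tail_space N0 -> has_dim E n ->
  exists b1 : 'I_n -> V, [/\ independent b1, E = range (lincomb b1) &
    forall c a, 0 <= a -> l2le (lincomb b1 c).2 a ->
      l2le (fun j => Omega (lincomb b1 c).2 j - \sum_k c k * Omega (b1 k).2 j) a].
Proof.
move=> N04 N0n EY [b0 [b0i Eb0]].
have basisE (b : 'I_n -> V) k : E = range (lincomb b) -> E (b k).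
  by move=> ->; exists (fun l => (l == k)%:R) => //; exact: lincomb_pick.
have sp e : E e -> l2_bounded e.2 by move=> /EY[/space_ZJP[]].
have [|P1 [d1 [P1u d10] hd1]] := @gram_diag R n (fun k => (b0 k).2).
  by move=> k; apply/(l2_boundedP ((b0 k).2)); exact: (sp _ (basisE _ k Eb0)).
pose b1 k : V := lincomb b0 (P1 k).
have [b1i Eb1] : independent b1 /\ range (lincomb b1) = E by rewrite Eb0; exact: change_basis.
have {}Eb1 := esym Eb1.
have hd1' c : (fun M => \sum_(j < M) modc ((lincomb b1 c).2 j) ^+ 2) @ \oo -->
    \sum_k modc (c k) ^+ 2 * d1 k.
  apply: cvg_seq_eq (hd1 c) => M; apply: eq_bigr => j _.
  by rewrite lincomb2; congr (modc _ ^+ _); apply: eq_bigr => k _; rewrite lincomb2.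
exists b1; split => // c a a0 ya M.
pose ys k : omega R := fun j => c k * (b1 k).2 j.
have ysE : (fun j => \sum_k ys k j) = (lincomb b1 c).2 by apply/funext => j; rewrite lincomb2.
have h0 k j : (blk j < N0)%N -> ys k j = 0.
  by move=> /((EY _ (basisE _ k Eb1)).2 j)[_]; rewrite /ys => ->; rewrite mulr0.
have [N N4 MN] := J_offset_unbounded M.
have := Omega_quasilinear N04 N4 h0; rewrite ysE => H.
pose f j := modc (Omega (lincomb b1 c).2 j - \sum_k c k * Omega (b1 k).2 j) ^+ 2.
apply: (@le_trans _ _ (\sum_(j < J_offset N) f j)).
  rewrite -(big_mkord xpredT f) -(big_mkord xpredT f) (big_cat_nat (leq0n M) MN) /=.
  by rewrite lerDl; apply: sumr_ge0 => ? _; exact: sqr_ge0.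
have -> : \sum_(j < J_offset N) f j = \sum_(j < J_offset N)
    modc (Omega (lincomb b1 c).2 j - \sum_k Omega (ys k) j) ^+ 2.
  apply: eq_bigr => j _; rewrite /f; congr (modc (_ - _) ^+ _).
  by apply: eq_bigr => k _; rewrite OmegaZ.
apply: (le_trans H).
have q1 : \sum_k modc (c k) ^+ 2 * d1 k <= a ^+ 2.
  exact: (@lim_sum_le R (fun j => modc ((lincomb b1 c).2 j) ^+ 2) _ _ ya (hd1' c)).
apply: le_trans q1; rewrite -[leRHS]mul1r; apply: ler_pM.
- by rewrite divr_ge0 // mulr_ge0 // exprn_ge0.
- by apply: sumr_ge0 => k _; apply: sumr_ge0 => j _; exact: sqr_ge0.
- rewrite ler_pdivrMr ?ltr0n ?(leq_trans _ N04) // mul1r.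
  by rewrite -natrX -natrM ler_nat.
apply: ler_sum => k _.
rewrite (eq_bigr (fun j : 'I_(J_offset N) => modc (c k) ^+ 2 * modc ((b1 k).2 j) ^+ 2)); last first.
  by move=> j _; rewrite /ys modcM exprMn.
rewrite -mulr_sumr ler_wpM2l ?sqr_ge0 //.
have := hd1' (fun l => (l == k)%:R); rewrite lincomb_pick (bigD1 k) //= eqxx modc1 expr1n mul1r big1 ?addr0; last first.
  by move=> l /negPf ->; rewrite modc0 expr0n mul0r.
move=> hk; apply: (@nondecreasing_sum_le R (fun j => modc ((b1 k).2 j) ^+ 2)) hk _.
by move=> j; exact: sqr_ge0.
Qed.

(** On an n-dimensional subspace of a sufficiently remote tail, Omega differs
little from a linear map, so that the norm of Z(J) is equivalent, with universal
constants, to the euclidean norm with squares sum |c_k| ^ 2 d_k. *)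
Lemma euclidean_frame n (N0 : nat) (E : set V) : (4 <= N0)%N -> (64 * n.+1 ^ 3 <= N0)%N ->
  E `<=` tail_space N0 -> has_dim E n ->
  exists b : 'I_n -> V, exists d : 'I_n -> R,
    [/\ independent b, E = range (lincomb b), forall k, 0 < d k &
     forall c, let e := lincomb b c in let q := \sum_k modc (c k) ^+ 2 * d k in
       [/\ l2le e.2 (Num.sqrt q), l2le (defect e) (2 * Num.sqrt q) &
           forall a a', 0 <= a -> 0 <= a' -> l2le e.2 a -> l2le (defect e) a' ->
             q <= 2 * a' ^+ 2 + 3 * a ^+ 2]].
Proof.
move=> N04 N0n EY hdim; have [b1 [b1i Eb1 approx0]] := linearizing_basis N04 N0n EY hdim.
have basisE (b : 'I_n -> V) k : E = range (lincomb b) -> E (b k).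
  by move=> ->; exists (fun l => (l == k)%:R) => //; exact: lincomb_pick.
have sp e : E e -> l2_bounded e.2 /\ l2_bounded (defect e) by move=> /EY[/space_ZJP].
pose w k : omega R := defect (b1 k).
pose W (c : 'I_n -> R[i]) : omega R := fun j => \sum_k c k * w k j.
pose L (c : 'I_n -> R[i]) : omega R := fun j => \sum_k c k * Omega (b1 k).2 j.
have WL c j : (lincomb b1 c).1 j = W c j + L c j.
  rewrite lincomb1 /W /L -big_split /=; apply: eq_bigr => k _.
  by rewrite -mulrDr /w /defect subrK.
have approx c a : 0 <= a -> l2le (lincomb b1 c).2 a ->
  l2le (fun j => Omega (lincomb b1 c).2 j - L c j) a by exact: approx0.
(* The form |y| ^ 2 + |W| ^ 2 is the Gram form of the interleaved sequences. *)
pose z k (j : nat) : R[i] := if odd j then w k j./2 else (b1 k).2 j./2.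
have zsum (c : 'I_n -> R[i]) M : \sum_(j < M.*2) modc (\sum_k c k * z k j) ^+ 2 =
    \sum_(j < M) (modc ((lincomb b1 c).2 j) ^+ 2 + modc (W c j) ^+ 2).
  elim: M => [|M IH]; first by rewrite !big_ord0.
  rewrite doubleS !big_ord_recr /= IH -addrA lincomb2 /W /z odd_double doubleK /=.
  by rewrite uphalf_double odd_double.
have [|P2 [d [P2u d0] hd]] := @gram_diag R n z.
  move=> k; have [] := sp _ (basisE _ k Eb1).
  move=> /l2_boundedP[C1 h1] /l2_boundedP[C2 h2]; exists (C1 + C2) => M.
  have MM : (M <= M.*2)%N by rewrite -addnn leq_addr.
  pose ck (l : 'I_n) : R[i] := (l == k)%:R.
  have sel (f : 'I_n -> R[i]) : \sum_l ck l * f l = f k.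
    rewrite (bigD1 k) //= /ck eqxx mul1r big1 ?addr0 // => l /negPf ->; by rewrite mul0r.
  apply: (@le_trans _ _ (\sum_(j < M.*2) modc (z k j) ^+ 2)).
    rewrite -(big_mkord xpredT (fun j => modc (z k j) ^+ 2)) -(big_mkord xpredT (fun j => modc (z k j) ^+ 2)).
    by rewrite (big_cat_nat (leq0n M) MM) /= lerDl; apply: sumr_ge0 => ? _; exact: sqr_ge0.
  have := zsum ck M; rewrite (eq_bigr (fun j : 'I_M.*2 => modc (z k j) ^+ 2)); last first.
    by move=> j _; rewrite sel.
  move=> ->; apply: le_trans (lerD (h1 M) (h2 M)); rewrite -big_split /=; apply: ler_sum => j _.
  by rewrite lincomb2 /W !sel.
pose b k : V := lincomb b1 (P2 k).
have [bi Eb] : independent b /\ range (lincomb b) = E by rewrite Eb1; exact: change_basis.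
have {}Eb := esym Eb.
pose c1 (c : 'I_n -> R[i]) l := \sum_k c k * P2 k l.
have bE c : lincomb b c = lincomb b1 (c1 c) by exact: lincomb_mx.
pose S c M : R := \sum_(j < M) (modc ((lincomb b c).2 j) ^+ 2 + modc (W (c1 c) j) ^+ 2).
have Slim c : S c @ \oo --> \sum_k modc (c k) ^+ 2 * d k.
  have dbl : (fun M => M.*2) @ \oo --> \oo.
    move=> A [m _ hA]; exists m => // k /= mk; apply: hA => /=.
    by rewrite (leq_trans mk) // -addnn leq_addr.
  apply: cvg_seq_eq (cvg_comp _ _ dbl (hd c)) => M /=.
  rewrite /S bE -zsum; apply: eq_bigr => j _; congr (modc _ ^+ _).
  rewrite (eq_bigr (fun k => \sum_l c k * P2 k l * z l j)); last first.
    by move=> k _; rewrite mulr_sumr; apply: eq_bigr => l _; rewrite mulrA.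
  by rewrite exchange_big; apply: eq_bigr => l _; rewrite mulr_suml.
have Sle c M : S c M <= \sum_k modc (c k) ^+ 2 * d k.
  apply: (@nondecreasing_sum_le R (fun j => modc ((lincomb b c).2 j) ^+ 2 + modc (W (c1 c) j) ^+ 2) _ _ (Slim c)) => j.
  by rewrite addr_ge0 ?sqr_ge0.
have q0 c : 0 <= \sum_k modc (c k) ^+ 2 * d k.
  by apply: sumr_ge0 => k _; rewrite mulr_ge0 ?sqr_ge0.
have parta c : l2le (lincomb b c).2 (Num.sqrt (\sum_k modc (c k) ^+ 2 * d k)).
  move=> M; rewrite sqr_sqrtr //; apply: le_trans (Sle c M).
  by apply: ler_sum => j _; rewrite lerDl sqr_ge0.
have sq2 (p r : R[i]) : modc (p + r) ^+ 2 <= 2 * (modc p ^+ 2 + modc r ^+ 2).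
  apply: le_trans (ler_sqr_ge0 (modc_ge0 _) (modcD _ _)) _.
  by rewrite -subr_ge0 (_ : _ - _ = (modc p - modc r) ^+ 2) ?sqr_ge0 //; ring.
have defW c j : defect (lincomb b c) j =
    W (c1 c) j + - (Omega (lincomb b1 (c1 c)).2 j - L (c1 c) j).
  by rewrite bE /defect WL; ring.
have partb c : l2le (defect (lincomb b c)) (2 * Num.sqrt (\sum_k modc (c k) ^+ 2 * d k)).
  have ya := parta c; rewrite bE in ya.
  have := approx _ _ (sqrtr_ge0 _) ya => ap M; rewrite exprMn sqr_sqrtr //.
  set q := \sum_k _ in ap *.
  apply: (@le_trans _ _ (\sum_(j < M) 2 * (modc (W (c1 c) j) ^+ 2 +
     modc (Omega (lincomb b1 (c1 c)).2 j - L (c1 c) j) ^+ 2))).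
    by apply: ler_sum => j _; rewrite defW; apply: le_trans (sq2 _ _) _; rewrite modcN.
  rewrite -mulr_sumr big_split /=.
  have := ap M; rewrite sqr_sqrtr; last exact: q0.
  have : \sum_(j < M) modc (W (c1 c) j) ^+ 2 <= q.
    by apply: le_trans (Sle c M); apply: ler_sum => j _; rewrite lerDr sqr_ge0.
  by rewrite (_ : 2 ^+ 2 = 4 :> R) ?natrX //; lra.
have partc c a a' : 0 <= a -> 0 <= a' -> l2le (lincomb b c).2 a -> l2le (defect (lincomb b c)) a' ->
    \sum_k modc (c k) ^+ 2 * d k <= 2 * a' ^+ 2 + 3 * a ^+ 2.
  move=> a0 a'0 ya xa; apply: (@lim_sum_le R (fun j => modc ((lincomb b c).2 j) ^+ 2 + modc (W (c1 c) j) ^+ 2) _ _ _ (Slim c)) => M.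
  rewrite big_split /=.
  have ya' := ya; rewrite bE in ya'.
  have ap := approx _ _ a0 ya'.
  have : \sum_(j < M) modc (W (c1 c) j) ^+ 2 <= 2 * a' ^+ 2 + 2 * a ^+ 2.
    apply: (@le_trans _ _ (\sum_(j < M) 2 * (modc (defect (lincomb b c) j) ^+ 2 +
       modc (Omega (lincomb b1 (c1 c)).2 j - L (c1 c) j) ^+ 2))).
      apply: ler_sum => j _.
      rewrite (_ : W (c1 c) j = defect (lincomb b c) j + (Omega (lincomb b1 (c1 c)).2 j - L (c1 c) j)) ?sq2 //.
      by rewrite defW; ring.
    rewrite -mulr_sumr big_split /= mulrDr lerD // ler_wpM2l //; [exact: xa|exact: ap].
  by have := ya M; lra.
exists b, d; split => // [k|c]; last by split; [exact: parta|exact: partb|exact: partc].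
rewrite lt_neqAle d0 andbT; apply/negP => /eqP dk.
pose ck (l : 'I_n) : R[i] := (l == k)%:R.
have qk : \sum_l modc (ck l) ^+ 2 * d l = 0.
  rewrite (bigD1 k) //= -dk mulr0 add0r big1 // => l /negPf lk.
  by rewrite /ck lk modc0 expr0n mul0r.
have zero0 (y : omega R) : l2le y 0 -> forall j, y j = 0.
  by move=> h j; apply/eqP; rewrite -modc_eq0 eq_le modc_ge0 (l2le_coord j (lexx 0) h).
have := parta ck; rewrite qk sqrtr0 => /zero0 y00.
have := partb ck; rewrite qk sqrtr0 mulr0 => /zero0 x00.
have : lincomb b ck = 0.
  rewrite [LHS]surjective_pairing; congr pair; apply/funext => j; last exact: y00.
  have := x00 j; rewrite /defect /Omega y00 mulr0 subr0; exact.
by move=> /bi/(_ k)/eqP; rewrite /ck eqxx oner_eq0.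
Qed.

End Frame.

(** * Z(J) is asymptotically Hilbertian *)

Section AsymptoticallyHilbertian.
Variable R : realType.
Notation V := (omega R * omega R)%type.
Implicit Types (e v : V).
#[local] Opaque J_block_norm.

Lemma ell2_normE n (a : 'rV[R[i]]_n) : ell2_norm a = (Num.sqrt (\sum_i modc (a ord0 i) ^+ 2))%:E.
Proof. by []. Qed.

Lemma op_norm_le (U W : lmodType R[i]) (N : U -> \bar R) (M : W -> \bar R) (E : set U)
    (T : U -> W) (c : R) :
  (forall x, E x -> (N x <= 1)%E -> (M (T x) <= c%:E)%E) -> (op_norm N M E T <= c%:E)%E.
Proof. by move=> h; apply: ge_ereal_sup => _ [x [Ex Nx] <-]; exact: h. Qed.

Lemma ell2_norm_sq_le n (a : 'rV[R[i]]_n) (c : R) : 0 <= c ->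
  (ell2_norm a <= c%:E)%E = (\sum_i modc (a ord0 i) ^+ 2 <= c ^+ 2).
Proof.
move=> c0; rewrite ell2_normE lee_fin.
rewrite -[X in _ <= X]ger0_norm // -sqrtr_sqr ler_sqrt ?sqr_ge0 //.
Qed.

(** T and S are the coordinates in the euclidean frame. A vector of norm at most 1
has norm less than 2, hence |y|_2 <= 2 and |x - Omega y|_2 <= 16, and
2 * 16 ^ 2 + 3 * 2 ^ 2 <= 23 ^ 2; conversely 8 (1 + 3 * 2) = 56. *)
Lemma hilbert_dist_tail n (N0 : nat) (E : set V) : (4 <= N0)%N -> (64 * n.+1 ^ 3 <= N0)%N ->
  E `<=` tail_space N0 -> has_dim E n -> (hilbert_dist (@ZJ_norm R) E n <= (23 * 56)%:E)%E.
Proof.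
move=> N04 N0n EY hdim; have [b [d [bi Eb d0 hb]]] := euclidean_frame N04 N0n EY hdim.
have rd k : (Num.sqrt (d k))%:C != 0 :> R[i].
  by rewrite -modc_gt0 modc_real ger0_norm ?sqrtr_ge0 // sqrtr_gt0 d0.
have [co hco] : exists co : V -> 'I_n -> R[i], forall e, E e -> lincomb b (co e) = e.
  suff /choice[co hco] : forall e, exists c, E e -> lincomb b c = e by exists co.
  move=> e; have [Ee|nE] := pselect (E e); last by exists (fun=> 0).
  by move: Ee; rewrite Eb => -[c _ <-]; exists c.
have linD (a : R[i]) c c' : lincomb b (fun k => a * c k + c' k) = a *: lincomb b c + lincomb b c'.
  rewrite /lincomb scaler_sumr -big_split /=; apply: eq_bigr => k _.
  by rewrite scalerDl scalerA.
have uniq c c' : lincomb b c = lincomb b c' -> c = c'.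
  move=> cc; apply/funext => k; apply/eqP; rewrite -subr_eq0; apply/eqP.
  have := linD (-1) c' c; rewrite cc scaleN1r addNr => /bi/(_ k).
  by rewrite mulN1r addrC.
have ELin a x y : E x -> E y -> E (a *: x + y).
  by rewrite Eb => -[c _ <-] [c' _ <-]; rewrite -linD; eexists.
pose T e : 'rV[R[i]]_n := \row_k (co e k * (Num.sqrt (d k))%:C).
pose S (a : 'rV[R[i]]_n) : V := lincomb b (fun k => a ord0 k / (Num.sqrt (d k))%:C).
have ST e : E e -> S (T e) = e.
  move=> Ee; rewrite -[RHS](hco e Ee); congr (lincomb b); apply/funext => k.
  by rewrite mxE mulfK.
have TS a : T (S a) = a.
  apply/rowP => k; rewrite mxE.
  have ES : E (S a) by rewrite Eb; eexists.
  by rewrite (uniq _ _ (hco _ ES)) divfK.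
have sqT e : \sum_k modc (T e ord0 k) ^+ 2 = \sum_k modc (co e k) ^+ 2 * d k.
  apply: eq_bigr => k _; rewrite mxE modcM exprMn modc_real ger0_norm ?sqrtr_ge0 //.
  by rewrite sqr_sqrtr // ltW.
have hT : (op_norm (@ZJ_norm R) (@ell2_norm R n) E T <= 23%:E)%E.
  apply: op_norm_le => e Ee Ne; rewrite ell2_norm_sq_le // sqT.
  have [|_ y2 x16] := @ZJ_lowerP R e 2; first by apply: le_lt_trans Ne _; rewrite lte_fin ltr1n.
  have [_ _ h] := hb (co e); rewrite hco // in h.
  have := h 2 (8 * 2) (ler0n R 2) (mulr_ge0 (ler0n R 8) (ler0n R 2)) y2 x16.
  by move=> H'; apply: (le_trans H'); lra.
have hS : (op_norm (@ell2_norm R n) (@ZJ_norm R) [set: 'rV[R[i]]_n] S <= 56%:E)%E.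
  apply: op_norm_le => a _; rewrite ell2_norm_sq_le // expr1n => a1.
  have [ya xa _] := hb (fun k => a ord0 k / (Num.sqrt (d k))%:C).
  move: ya xa; rewrite -/(S a); set q := \sum_k _ => ya xa.
  have qa : q = \sum_k modc (a ord0 k) ^+ 2.
    apply: eq_bigr => k _; rewrite modcM modcV modc_real ger0_norm ?sqrtr_ge0 //.
    by rewrite exprMn exprVn sqr_sqrtr ?(ltW (d0 k)) // divfK // gt_eqF.
  have q1 : Num.sqrt q <= 1 by rewrite -[1]sqrtr1 ler_sqrt // qa.
  have := ZJ_upper (ler01 : 0 <= 1 :> R) (ler0n R 2) (l2leW (sqrtr_ge0 _) q1 ya)
    (l2leW (mulr_ge0 (ler0n R 2) (sqrtr_ge0 _)) (_ : _ <= 2) xa).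
  rewrite (_ : 8 * (1 + 3 * 2) = 56 :> R); last by ring.
  by apply; rewrite ler_piMr.
have E0 : E 0.
  by rewrite Eb; exists (fun=> 0) => //; rewrite /lincomb big1 // => k _; rewrite scale0r.
have T0 : (0 <= op_norm (@ZJ_norm R) (@ell2_norm R n) E T)%E.
  apply: (@le_trans _ _ (ell2_norm (T 0))); first by rewrite ell2_normE lee_fin sqrtr_ge0.
  by apply: ereal_sup_ubound; exists 0 => //; split => //=; rewrite ZJ_norm0.
have S0 : (0 <= op_norm (@ell2_norm R n) (@ZJ_norm R) [set: 'rV[R[i]]_n] S)%E.
  apply: (@le_trans _ _ (ZJ_norm (S 0))); first exact: ZJ_norm_ge0.
  apply: ereal_sup_ubound; exists 0 => //; split=> //=.
  rewrite ell2_norm_sq_le // expr1n big1 // => k _; by rewrite mxE modc0 expr0n.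
apply: (@le_trans _ _ (op_norm (@ZJ_norm R) (@ell2_norm R n) E T *
    op_norm (@ell2_norm R n) (@ZJ_norm R) [set: 'rV[R[i]]_n] S)%E).
  apply: ereal_inf_lbound; exists T, S; split.
  - move=> a x y Ex Ey; apply/rowP => k; rewrite !mxE.
    have -> : co (a *: x + y) = (fun k => a * co x k + co y k).
      by apply: uniq; rewrite linD !hco //; exact: ELin.
    by rewrite mulrDl mulrA.
  - by move=> x Ex; split => //; exact: ST.
  - by move=> a _; split; [rewrite Eb; eexists|exact: TS].
  - by split; [apply: le_lt_trans hT _|apply: le_lt_trans hS _]; exact: ltry.
  - by [].
by rewrite EFinM; apply: lee_pmul.
Qed.

(** Norm convergence implies convergence of v.2 in each coordinate. It also implies
it for v.1 where v.2 vanishes, because Omega vanishes there. *)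
Lemma closed_tail N0 : closed_in (@ZJ_norm R) (tail_space N0).
Proof.
move=> us v hu vs hcv; split => // j jN.
have small (t : R) : 0 < t -> exists2 w : V, w.1 j = 0 /\ w.2 j = 0 & (ZJ_norm (w - v)%R < t%:E)%E.
  move=> t0; have : nbhs (0%E : \bar R) [set s | (s < t%:E)%E].
    exists t => // r /=; rewrite sub0r normrN lte_fin; exact: le_lt_trans (ler_norm _).
  move=> /hcv[m _ /(_ m (leqnn m)) h]; exists (us m) => //.
  by have [_ /(_ j jN)] := hu m.
have v2 : v.2 j = 0.
  apply/eqP; rewrite -modc_eq0 eq_le modc_ge0 andbT; apply/ler_addgt0Pr => t t0; rewrite add0r.
  have [w [_ w2] /ZJ_lowerP[t0' h _]] := small t t0.
  have := l2le_coord j t0' h; rewrite (_ : (w - v).2 j = - v.2 j) ?modcN //.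
  by transitivity (w.2 j - v.2 j) => //; rewrite w2 sub0r.
split => //; apply/eqP; rewrite -modc_eq0 eq_le modc_ge0 andbT; apply/ler_addgt0Pr => t t0.
have t8 : 0 < t / 8 by rewrite divr_gt0.
have [w [w1 w2] /ZJ_lowerP[t0' _ h]] := small _ t8.
have t1 : 0 <= 8 * (t / 8) by rewrite mulr_ge0.
have := l2le_coord j t1 h.
have -> : defect (w - v) j = - v.1 j.
  rewrite /defect /Omega (_ : (w - v).2 j = 0); last first.
    by transitivity (w.2 j - v.2 j) => //; rewrite w2 v2 subrr.
  by rewrite mulr0 subr0; transitivity (w.1 j - v.1 j) => //; rewrite w1 sub0r.
by rewrite modcN add0r (_ : 8 * (t / 8) = t) //; field.
Qed.

Lemma Omega_unit j : Omega (unit_vec R j) = 0 :> omega R.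
Proof.
apply/funext => k; rewrite /Omega; have [->|kj] := eqVneq k j; last first.
  by rewrite /unit_vec (negPf kj) mulr0.
have b1 : block2 (blk j) (unit_vec R j) = 1.
  have [i iJ E] := blk_offset j.
  rewrite /block2 (bigD1 (Ordinal iJ)) //= -E {1}/unit_vec eqxx modc1 expr1n big1 ?addr0 ?sqrtr1 //.
  move=> l li; rewrite /unit_vec (_ : (_ == j) = false) ?modc0 ?expr0n //.
  by apply/negbTE; apply: contraNneq li => h; apply/eqP/val_inj/(@addnI (J_offset (blk j))); rewrite /= h -E.
by rewrite /lam b1 /unit_vec eqxx modc1 divr1 ln1 mulr0 oppr0 mul0r.
Qed.

Lemma l2le_unit j : l2le (unit_vec R j) 1.
Proof.
move=> M; rewrite expr1n; have [jM|Mj] := ltnP j M; last first.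
  rewrite big1 // => i _; rewrite /unit_vec (_ : (_ == j) = false) ?modc0 ?expr0n //.
  by apply/negbTE; rewrite neq_ltn (leq_trans (ltn_ord i)).
rewrite (bigD1 (Ordinal jM)) //= {1}/unit_vec eqxx modc1 expr1n big1 ?addr0 // => i ij.
rewrite /unit_vec (_ : (_ == j) = false) ?modc0 ?expr0n //.
by apply/negbTE; apply: contraNneq ij => ij; apply/eqP/val_inj.
Qed.

Lemma ZJ_norm_unit2 j : (ZJ_norm (0%R : omega R, unit_vec R j) <= 1)%E.
Proof. by have := Z_norm_Omega ler01 (@l2le_unit j); rewrite Omega_unit. Qed.

Lemma space_unit1 j : Defs.space (@ZJ_norm R) (unit_vec R j, 0).
Proof.
apply/space_ZJP; split => /=.
  by exists 0 => // M; rewrite big1 ?expr0n // => i _; rewrite modc0 expr0n.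
exists 1 => //; have -> : defect (unit_vec R j, 0) = unit_vec R j; last exact: l2le_unit.
apply/funext => k; rewrite /defect /Omega /=.
transitivity (unit_vec R j k - (- (4 * eps R (blk k) * lam (0 : omega R) k))%:C * 0 : R[i]) => //.
by rewrite mulr0 subr0.
Qed.

Lemma finite_codim_tail N0 : (4 <= N0)%N -> finite_codim (@ZJ_norm R) (tail_space N0).
Proof.
move=> N04; pose L := J_offset N0.
pose w (i : 'I_(L + L)) : V := match fintype.split i with
  | inl a => (unit_vec R a, 0) | inr a => (0, unit_vec R a) end.
have ws i : Defs.space (@ZJ_norm R) (w i).
  rewrite /w; case: (fintype.split i) => a; first exact: space_unit1.
  by apply: le_lt_trans (ZJ_norm_unit2 a) _; exact: ltry.
exists (L + L)%N, w; split => // v vs.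
pose c (i : 'I_(L + L)) : R[i] := match fintype.split i with inl a => v.1 a | inr a => v.2 a end.
have pick (f : omega R) j : (j < L)%N -> \sum_(i < L) f i * unit_vec R i j = f j :> R[i].
  move=> jL; rewrite (bigD1 (Ordinal jL)) //= /unit_vec eqxx mulr1 big1 ?addr0 // => i ij.
  rewrite (_ : (j == i) = false) ?mulr0 //; apply/negbTE.
  by apply: contraNneq ij => ij; apply/eqP/val_inj.
exists c; split.
  have := space_ZJ_lin (-1) (space_ZJ_lincomb c ws) vs.
  by rewrite scaleN1r addrC.
move=> j; rewrite blk_lt // => jL.
have E1 : (lincomb w c).1 j = v.1 j.
  rewrite lincomb1 big_split_ord /= [X in _ + X]big1 ?addr0; last first.
    by move=> i _; rewrite /w -/(unsplit (inr i)) unsplitK /= mulr0.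
  rewrite -[RHS](pick v.1 j jL); apply: eq_bigr => i _.
  by rewrite /w /c -/(unsplit (inl i)) unsplitK.
have E2 : (lincomb w c).2 j = v.2 j.
  rewrite lincomb2 big_split_ord /= [X in X + _]big1 ?add0r; last first.
    by move=> i _; rewrite /w -/(unsplit (inl i)) unsplitK /= mulr0.
  rewrite -[RHS](pick v.2 j jL); apply: eq_bigr => i _.
  by rewrite /w /c -/(unsplit (inr i)) unsplitK.
split.
  by transitivity (v.1 j - (lincomb w c).1 j) => //; rewrite E1 subrr.
by transitivity (v.2 j - (lincomb w c).2 j) => //; rewrite E2 subrr.
Qed.

Lemma ZJ_asymptotically_hilbertian : asymptotically_hilbertian (@ZJ_norm R).
Proof.
exists (23 * 56); split; first by rewrite mulr_gt0.
move=> n; pose N0 := (64 * n.+1 ^ 3)%N.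
have N04 : (4 <= N0)%N by rewrite (leq_trans (_ : 4 <= 64 * 1)%N) // leq_mul2l expn_gt0.
exists (tail_space N0); split.
- by move=> v [].
- split; first by split => //; exact: space_ZJ0.
  move=> a x y [xs x0] [ys y0]; split; first exact: space_ZJ_lin.
  move=> j jN; have [x1 x2] := x0 j jN; have [y1 y2] := y0 j jN; split.
    by transitivity (a * x.1 j + y.1 j) => //; rewrite x1 y1 mulr0 addr0.
  by transitivity (a * x.2 j + y.2 j) => //; rewrite x2 y2 mulr0 addr0.
- exact: closed_tail.
- exact: finite_codim_tail.
- by move=> E EY hdim; exact: (hilbert_dist_tail N04 (leqnn _) EY hdim).
Qed.

End AsymptoticallyHilbertian.

(** * Khinchine's inequality *)

Section Khinchine.
Variable R : realType.

Definition upd (s : nat -> R) (m : nat) (v : R) : nat -> R := fun i => if i == m then v else s i.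

(** The expectation of Phi over independent random signs at the indices below m,
by recursion, so that moments are computed one sign at a time. *)
Fixpoint sign_mean (m : nat) (Phi : (nat -> R) -> R) : R :=
  if m is m'.+1 then
    (sign_mean m' (fun s => Phi (upd s m' 1)) + sign_mean m' (fun s => Phi (upd s m' (-1)))) / 2
  else Phi (fun=> 1).

Lemma sign_mean_le m (Phi Psi : (nat -> R) -> R) : (forall s, Phi s <= Psi s) ->
  sign_mean m Phi <= sign_mean m Psi.
Proof.
elim: m Phi Psi => [|m IH] Phi Psi h /=; first exact: h.
by rewrite ler_wpM2r // lerD // IH.
Qed.

Lemma sign_mean_le_cst m (Phi : (nat -> R) -> R) B :
  (forall s, (forall i, `|s i| = 1) -> Phi s <= B) -> sign_mean m Phi <= B.
Proof.
elim: m Phi => [|m IH] Phi h /=; first by apply: h => i; rewrite normr1.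
have H v : `|v| = 1 -> sign_mean m (fun s => Phi (upd s m v)) <= B.
  by move=> v1; apply: IH => s hs; apply: h => i; rewrite /upd; case: eqP.
have h1 := H 1 (normr1 _); have h2 := H (-1) (normrN1 _); lra.
Qed.

Lemma sign_meanD m (Phi Psi : (nat -> R) -> R) (a : R) :
  sign_mean m (fun s => Phi s + a * Psi s) = sign_mean m Phi + a * sign_mean m Psi.
Proof. by elim: m Phi Psi => [//|m IH] Phi Psi /=; rewrite !IH; ring. Qed.

Lemma sign_mean0 m : sign_mean m (fun=> 0) = 0.
Proof. by elim: m => [//|m /= ->]; rewrite addr0 mul0r. Qed.

Lemma sign_mean_sum m k (Phi : nat -> (nat -> R) -> R) :
  sign_mean m (fun s => \sum_(j < k) Phi j s) = \sum_(j < k) sign_mean m (Phi j).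
Proof.
elim: k => [|k IH].
  rewrite big_ord0; have -> : (fun s => \sum_(j < 0) Phi j s) = (fun s => 0 + 0 * 0).
    by apply/funext => s; rewrite big_ord0 mul0r addr0.
  by rewrite mul0r addr0; exact: sign_mean0.
rewrite big_ord_recr /= -IH -[sign_mean m (Phi k)]mul1r -sign_meanD; congr sign_mean.
by apply/funext => s; rewrite big_ord_recr mul1r.
Qed.

Let upd_sum (f : nat -> R[i]) s m v x :
  x + \sum_(i < m.+1) (upd s m v i)%:C * f i = (x + v%:C * f m) + \sum_(i < m) (s i)%:C * f i.
Proof.
rewrite big_ord_recr /= {2}/upd eqxx -addrA; congr (_ + _); rewrite addrC; congr (_ + _).
by apply: eq_bigr => i _; rewrite /upd ltn_eqF.
Qed.

Let paral (x y : R[i]) : modc (x + y) ^+ 2 + modc (x - y) ^+ 2 = 2 * (modc x ^+ 2 + modc y ^+ 2).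
Proof. by rewrite !sqr_modc; case: x => a b; case: y => c d /=; ring. Qed.

Let paral4 (x y : R[i]) : modc (x + y) ^+ 4 + modc (x - y) ^+ 4 <=
  2 * (modc x ^+ 4 + 6 * modc x ^+ 2 * modc y ^+ 2 + modc y ^+ 4).
Proof.
have E (z : R[i]) : modc z ^+ 4 = (modc z ^+ 2) ^+ 2 by rewrite -exprM.
rewrite !E !sqr_modc; case: x => a b; case: y => c d /=; rewrite -subr_ge0.
rewrite (_ : _ - _ = 8 * (a * d - b * c) ^+ 2); last by ring.
by rewrite mulr_ge0 // sqr_ge0.
Qed.

Lemma sign_mean_sqr m (f : nat -> R[i]) x :
  sign_mean m (fun s => modc (x + \sum_(i < m) (s i)%:C * f i) ^+ 2) =
  modc x ^+ 2 + \sum_(i < m) modc (f i) ^+ 2.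
Proof.
elim: m x => [|m IH] x /=; first by rewrite !big_ord0 !addr0.
have E v : (fun s => modc (x + \sum_(i < m.+1) (upd s m v i)%:C * f i) ^+ 2) =
    (fun s => modc ((x + v%:C * f m) + \sum_(i < m) (s i)%:C * f i) ^+ 2).
  by apply/funext => s; rewrite upd_sum.
rewrite !E !IH big_ord_recr /=.
have -> : x + (1 : R)%:C * f m = x + f m by rewrite mul1r.
have -> : x + (-1 : R)%:C * f m = x - f m by rewrite rmorphN mulN1r.
have := paral x (f m); lra.
Qed.

Lemma sign_mean_pow4 m (f : nat -> R[i]) x :
  sign_mean m (fun s => modc (x + \sum_(i < m) (s i)%:C * f i) ^+ 4) <=
  modc x ^+ 4 + 6 * modc x ^+ 2 * (\sum_(i < m) modc (f i) ^+ 2) +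
  3 * (\sum_(i < m) modc (f i) ^+ 2) ^+ 2.
Proof.
elim: m x => [|m IH] x /=; first by rewrite !big_ord0 mulr0 expr0n mulr0 !addr0.
have E v : (fun s => modc (x + \sum_(i < m.+1) (upd s m v i)%:C * f i) ^+ 4) =
    (fun s => modc ((x + v%:C * f m) + \sum_(i < m) (s i)%:C * f i) ^+ 4).
  by apply/funext => s; rewrite upd_sum.
rewrite !E big_ord_recr /=.
have -> : x + (1 : R)%:C * f m = x + f m by rewrite mul1r.
have -> : x + (-1 : R)%:C * f m = x - f m by rewrite rmorphN mulN1r.
set S := \sum_(i < m) _.
have S0 : 0 <= S by apply: sumr_ge0 => i _; exact: sqr_ge0.
have h1 := IH (x + f m); have h2 := IH (x - f m); rewrite -/S in h1 h2.
have p2 := paral x (f m); have p4 := paral4 x (f m).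
have E4 (z : R) : z ^+ 4 = (z ^+ 2) ^+ 2 by rewrite -exprM.
move: h1 h2 p2 p4; rewrite !E4.
move: (modc (x + f m) ^+ 2) (modc (x - f m) ^+ 2) (modc x ^+ 2) (modc (f m) ^+ 2) (sqr_ge0 (modc (f m))).
move: (sign_mean _ _) (sign_mean _ _) => A B p q X Y _ h1 h2 p2 p4.
have -> : X ^+ 2 + 6 * X * (S + Y) + 3 * (S + Y) ^+ 2 =
  (X ^+ 2 + 6 * X * Y + Y ^+ 2) + 6 * (X + Y) * S + 3 * S ^+ 2 + 2 * Y ^+ 2 by ring.
have e : 6 * (X + Y) * S = 3 * (p * S + q * S) by rewrite -mulrDl p2; ring.
have Y2 := sqr_ge0 Y.
have h3 := lerD h1 h2.
rewrite e; lra.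
Qed.

(** Khinchine's inequality between the first and second moments. With the second
moment normalised to 1 the fourth is at most 3, and integrating the inequality
t >= t ^ 2 - (4/27) t ^ 4, an equality at t = 3/2, gives 1 - 12/27 = 5/9. *)
Lemma khinchine m (f : nat -> R[i]) :
  5 * Num.sqrt (\sum_(i < m) modc (f i) ^+ 2) <=
  9 * sign_mean m (fun s => modc (\sum_(i < m) (s i)%:C * f i)).
Proof.
set S := \sum_(i < m) _; set r := Num.sqrt S.
have S0 : 0 <= S by apply: sumr_ge0 => i _; exact: sqr_ge0.
have M0 : 0 <= sign_mean m (fun s => modc (\sum_(i < m) (s i)%:C * f i)).
  have := @sign_mean_le m (fun=> 0) (fun s => modc (\sum_(i < m) (s i)%:C * f i)) (fun s => modc_ge0 _).
  by rewrite sign_mean0.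
have [r0|r0] := eqVneq r 0; first by rewrite r0 mulr0 mulr_ge0.
have {r0}r0 : 0 < r by rewrite lt_neqAle eq_sym r0 sqrtr_ge0.
have r2 : r ^+ 2 = S by rewrite sqr_sqrtr.
have pt (t : R) : 0 <= t -> t ^+ 2 / r + (- (4 / 27) / r ^+ 3) * t ^+ 4 <= t.
  move=> t0; rewrite -subr_ge0.
  have -> : t - (t ^+ 2 / r + (- (4 / 27) / r ^+ 3) * t ^+ 4) =
      (4 / 27 * t * (t - 3 / 2 * r) ^+ 2 * (t + 3 * r)) / r ^+ 3.
    by field; rewrite gt_eqF.
  apply: divr_ge0; last by rewrite exprn_ge0 // ltW.
  apply: mulr_ge0; last by rewrite addr_ge0 // mulr_ge0 // ltW.
  by apply: mulr_ge0; [rewrite mulr_ge0|exact: sqr_ge0].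
have m2 := @sign_mean_sqr m f 0; have m4 := @sign_mean_pow4 m f 0.
have E0 (p : nat) : (fun s : nat -> R => modc (0 + \sum_(i < m) (s i)%:C * f i) ^+ p) =
    (fun s : nat -> R => modc (\sum_(i < m) (s i)%:C * f i) ^+ p) by apply/funext => s; rewrite add0r.
rewrite !E0 !modc0 !expr0n /= -/S in m2 m4.
rewrite mulr0 mul0r !add0r in m4; rewrite add0r in m2.
have H := @sign_mean_le m _ _ (fun s => pt _ (modc_ge0 (\sum_(i < m) (s i)%:C * f i))).
rewrite sign_meanD in H.
have E1 : sign_mean m (fun s => modc (\sum_(i < m) (s i)%:C * f i) ^+ 2 / r) = S / r.
  have := sign_meanD m (fun=> 0) (fun s => modc (\sum_(i < m) (s i)%:C * f i) ^+ 2) r^-1.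
  rewrite m2 sign_mean0 add0r (mulrC r^-1) => <-; congr sign_mean; apply/funext => s.
  by rewrite add0r mulrC.
rewrite E1 in H.
have H2 : - (4 / 27) / r ^+ 3 * (3 * S ^+ 2) <=
   - (4 / 27) / r ^+ 3 * sign_mean m (fun s => modc (\sum_(i < m) (s i)%:C * f i) ^+ 4).
  rewrite !mulNr lerN2 ler_wpM2l // divr_ge0 // exprn_ge0 // ltW //.
have := le_trans (lerD (lexx (S / r)) H2) H.
rewrite -r2 (_ : r ^+ 2 / r + _ = 5 / 9 * r); last by field; rewrite gt_eqF.
lra.
Qed.

End Khinchine.

(** * The l_1-norm on a block *)

Section OneNormBound.
Variable R : realType.
Notation V := (omega R * omega R)%type.
#[local] Opaque J_block_norm.

Definition l1cst : R := 12 / ln 2.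
Definition l1fac (n : nat) : R := l1cst * Num.sqrt ((J_dim n)%:R / n%:R).

Lemma ln2_gt0 : 0 < ln 2 :> R. Proof. by rewrite ln_gt0 // ltr1n. Qed.

Lemma ln2_le1 : ln 2 <= 1 :> R.
Proof.
rewrite -[leRHS]expRK ler_ln ?posrE ?expR_gt0 //.
by apply: le_trans (expR_ge1Dx 1); lra.
Qed.

Lemma l1fac_ge0 n : 0 <= l1fac n.
Proof. by rewrite mulr_ge0 ?sqrtr_ge0 // divr_ge0 // ltW // ln2_gt0. Qed.

(** If v / S <= exp (- L), the logarithm has modulus at least L; otherwise
v <= exp L v ^ 2 / S. *)
Lemma split_log (v S L : R) : 0 < L -> 0 <= v -> v <= S ->
  v <= v * `|ln (v / S)| * L^-1 + expR L * (v ^+ 2 / S).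
Proof.
move=> L0 v0 vS; have [->|vn] := eqVneq v 0; first by rewrite !mul0r expr0n mul0r mulr0 addr0.
have {vn}v0 : 0 < v by rewrite lt_neqAle eq_sym vn.
have S0 := lt_le_trans v0 vS.
have t0 : 0 < v / S by rewrite divr_gt0.
have A0 : 0 <= v * `|ln (v / S)| * L^-1 by rewrite mulr_ge0 ?invr_ge0 ?(ltW L0) // mulr_ge0 // ltW.
have B0 : 0 <= expR L * (v ^+ 2 / S) by rewrite mulr_ge0 ?expR_ge0 // divr_ge0 ?sqr_ge0 // ltW.
have [h|h] := leP (v / S) (expR (- L)).
  apply: (@le_trans _ _ (v * `|ln (v / S)| * L^-1)); last by rewrite lerDl.
  rewrite -mulrA ler_peMr ?(ltW v0) // ler_pdivlMr // mul1r.
  have : ln (v / S) <= - L by rewrite -[- L]expRK ler_ln ?posrE ?expR_gt0.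
  by move=> h'; rewrite -normrN (le_trans _ (ler_norm _)) // lerNr.
apply: (@le_trans _ _ (expR L * (v ^+ 2 / S))); last by rewrite lerDr.
have -> : expR L * (v ^+ 2 / S) = v * (expR L * (v / S)) by ring.
rewrite ler_peMr ?(ltW v0) //.
apply: (@le_trans _ _ (expR L * expR (- L))); first by rewrite -expRD subrr expR0.
by rewrite ler_wpM2l ?expR_ge0 // ltW.
Qed.

(** Coordinates that are smaller than 2 ^ (- n / 4) relatively to the block norm
come with a logarithm of order n, hence are controlled, with a gain of sqrt n
over Cauchy-Schwarz, by Omega y = - defect (0, y). The others contribute at most
2 ^ (n / 4) times the block norm, which is below sqrt (k / n) up to a constant. *)
Lemma l1_block n (y : omega R) c : (4 <= n)%N -> (ZJ_norm (0%R : omega R, y) <= c%:E)%E ->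
  \sum_(i < J_dim n) modc (y (J_offset n + i)%N) <= l1fac n * c.
Proof.
move=> n4 hc; apply/ler_addgt0Pr => e e0; set f := l1fac n.
have f0 : 0 <= f by exact: l1fac_ge0.
have f1 : 0 < f + 1 by rewrite ltr_wpDl.
have : (ZJ_norm (0%R : omega R, y) < (c + e / (f + 1))%:E)%E.
  by apply: le_lt_trans hc _; rewrite lte_fin ltrDl divr_gt0.
pose a := c + e / (f + 1); have aE : c + e / (f + 1) = a by [].
rewrite -/a => /ZJ_lowerP[a0 /= ya ha].
apply: (@le_trans _ _ (f * a)); last first.
  rewrite -aE mulrDr lerD2l mulrCA -[leRHS]mulr1 ler_wpM2l ?(ltW e0) //.
  by rewrite ler_pdivrMr // mul1r lerDl.
have n0 : 0 < n%:R :> R by rewrite ltr0n (leq_trans _ n4).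
(* The threshold exp (- L) is 2 ^ (- n / 4). *)
pose b : R := ln 2 / 4; have b0 : 0 < b by rewrite divr_gt0 // ln2_gt0.
have b1 : b <= 1 by have := ln2_le1; rewrite /b; lra.
pose L : R := n%:R * b; have L0 : 0 < L by rewrite mulr_gt0.
pose v (i : 'I_(J_dim n)) := modc (y (J_offset n + i)%N).
pose S := block2 n y.
have Sa : S <= a.
  have h := (l2leP _ _).1 ya n.+1 (leqW n4); rewrite big_nat_recr //= in h.
  rewrite leNgt; apply/negP => aS.
  have : a ^+ 2 < S ^+ 2 by rewrite ltr_pXn2r ?nnegrE // block2_ge0.
  rewrite ltNge => /negP; apply; apply: le_trans h; rewrite lerDr.
  by apply: sumr_ge0 => ? _; exact: sqr_ge0.
have S0 : 0 <= S := block2_ge0 _ _.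
have vS i : v i <= S by have := modc_le_block2 y (J_offset n + i)%N; rewrite blkE.
have sqv : \sum_i v i ^+ 2 = S ^+ 2 by rewrite sqr_block2.
have sqlog : \sum_i (v i * `|ln (v i / S)|) ^+ 2 <= (2 * a * Num.sqrt n%:R) ^+ 2.
  have -> : (2 * a * Num.sqrt n%:R) ^+ 2 = n%:R / 16 * (8 * a) ^+ 2.
    by rewrite !exprMn sqr_sqrtr //; field.
  apply: (@le_trans _ _ (n%:R / 16 * \sum_(i < J_dim n) modc (defect (0%R : omega R, y) (J_offset n + i)%N) ^+ 2)).
    rewrite mulr_sumr; apply: ler_sum => i _.
    have -> : modc (defect (0%R : omega R, y) (J_offset n + i)%N) = 4 * eps R n * (v i * `|ln (v i / S)|).
      transitivity (modc (- Omega y (J_offset n + i)%N)).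
        by congr modc; exact: sub0r.
      rewrite modcN /Omega modcM modc_real /lam blkE // normrN !normrM (ger0_norm (eps_ge0 _ _)).
      by rewrite ger0_norm // -/(v i) -/S; ring.
    rewrite [X in _ <= _ * X]exprMn [(4 * eps R n) ^+ 2]exprMn sqr_eps mulrA.
    by rewrite (_ : n%:R / 16 * (4 ^+ 2 * n%:R^-1) = 1) ?mul1r //; field; rewrite gt_eqF.
  rewrite ler_wpM2l ?divr_ge0 //.
  have h := (l2leP _ _).1 ha n.+1 (leqW n4); rewrite big_nat_recr //= sqr_block2 in h.
  apply: le_trans h; rewrite lerDr; apply: sumr_ge0 => ? _; exact: sqr_ge0.
pose k : R := (J_dim n)%:R.
have k0 : 0 < k by rewrite ltr0n expn_gt0.
have CS : \sum_i v i * `|ln (v i / S)| <= (2 * a * Num.sqrt n%:R) * Num.sqrt k.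
  rewrite -[leLHS](eq_bigr _ (fun i _ => mulr1 (v i * `|ln (v i / S)|))).
  apply: cauchy_schwarz_sum; rewrite ?sqrtr_ge0 ?mulr_ge0 ?sqrtr_ge0 //.
  rewrite sqr_sqrtr ?(ltW k0) // (eq_bigr (fun=> 1)) => [|i _]; last by rewrite expr1n.
  by rewrite sumr_const card_ord.
have pt i := split_log L0 (modc_ge0 _) (vS i).
apply: (le_trans (ler_sum _ (fun i _ => pt i))).
rewrite big_split /= -mulr_suml -mulr_sumr -mulr_suml sqv.
have S2 : S ^+ 2 / S <= a.
  have [->|Sn] := eqVneq S 0; first by rewrite expr0n mul0r.
  by rewrite expr2 mulfK.
have eL : expR L <= b^-1 * Num.sqrt (k / n%:R).
  rewrite -ler_pdivrMl ?invr_gt0 // invrK.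
  have bL0 : 0 <= b * expR L by rewrite mulr_ge0 ?expR_ge0 // ltW.
  rewrite -[leLHS]ger0_norm // -sqrtr_sqr ler_sqrt ?divr_ge0 ?(ltW k0) ?(ltW n0) //.
  rewrite ler_pdivlMr // exprMn.
  have e2 : expR L ^+ 2 = expR (2 * L) by rewrite expr2 -expRD -mulr2n mulr_natl.
  have e4 : expR (2 * L) * expR (2 * L) <= k.
    rewrite -expRD (_ : 2 * L + 2 * L = n%:R * ln 2); last by rewrite /L /b; field.
    rewrite mulr_natl -lnXn // lnK ?posrE ?exprn_gt0 // /k /J_dim -natrX ler_nat.
    by rewrite leq_exp2l.
  rewrite e2; apply: le_trans e4.
  rewrite (_ : b ^+ 2 * expR (2 * L) * n%:R = expR (2 * L) * (b * L)); last by rewrite /L; ring.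
  rewrite ler_wpM2l ?expR_ge0 //; apply: le_trans (expR_ge1Dx _).
  have : b * L <= L by rewrite ler_piMl // ltW.
  by lra.
have r1 : (\sum_i v i * `|ln (v i / S)|) * L^-1 <= 2 * b^-1 * Num.sqrt (k / n%:R) * a.
  apply: (@le_trans _ _ ((2 * a * Num.sqrt n%:R) * Num.sqrt k * L^-1)).
    by rewrite ler_wpM2r // invr_ge0 ltW.
  rewrite le_eqVlt; apply/orP; left; apply/eqP.
  rewrite sqrtrM ?(ltW k0) // sqrtrV ?(ltW n0) // /L.
  have sn : Num.sqrt n%:R != 0 :> R by rewrite gt_eqF // sqrtr_gt0.
  have -> : n%:R = Num.sqrt n%:R * Num.sqrt n%:R :> R by rewrite -expr2 sqr_sqrtr // ltW.
  rewrite [Num.sqrt (Num.sqrt _ * _)](_ : _ = Num.sqrt n%:R); last first.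
    by rewrite -expr2 sqrtr_sqr ger0_norm // sqrtr_ge0.
  by field; rewrite sn gt_eqF.
have r2 : expR L * (S ^+ 2 / S) <= b^-1 * Num.sqrt (k / n%:R) * a.
  by apply: ler_pM => //; rewrite ?expR_ge0 // divr_ge0 ?sqr_ge0.
have -> : f = 3 * b^-1 * Num.sqrt (k / n%:R).
  by rewrite /f /l1fac /l1cst /b; congr (_ * _); field; rewrite gt_eqF // ln2_gt0.
apply: (le_trans (lerD r1 r2)); rewrite le_eqVlt; apply/orP; left; apply/eqP; ring.
Qed.

End OneNormBound.

(** * Failure of the E(n, n, K)-property and of the property (H) *)

Section Failures.
Variable R : realType.
Notation V := (omega R * omega R)%type.
#[local] Opaque J_block_norm.

(** If m unit vectors, at least a proportion delta of those of the block n, have a sum of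
norm at most D sqrt m, then l1_block bounds the l_1-norm m of this sum as in the
last hypothesis, and n is bounded. *)
Lemma block_count_bound n m (D delta : R) : (0 < n)%N -> 0 <= D -> 0 < delta ->
  delta * (J_dim n)%:R <= m%:R -> m%:R <= l1fac R n * (D * Num.sqrt m%:R) ->
  delta * n%:R <= (l1cst R * D) ^+ 2.
Proof.
move=> n0 D0 d0 hk hm.
have k0 : 0 < (J_dim n)%:R :> R by rewrite ltr0n expn_gt0.
have m0 : 0 < m%:R :> R by apply: lt_le_trans hk; rewrite mulr_gt0.
have n0' : 0 < n%:R :> R by rewrite ltr0n.
have s0 : 0 < Num.sqrt m%:R :> R by rewrite sqrtr_gt0.
have h1 : Num.sqrt m%:R <= l1fac R n * D.
  have := hm; rewrite -{1}(sqr_sqrtr (ltW m0)) expr2 mulrA ler_pM2r //.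
have h2 : m%:R <= l1cst R ^+ 2 * ((J_dim n)%:R / n%:R) * D ^+ 2.
  rewrite -(sqr_sqrtr (ltW m0)); apply: (le_trans (ler_sqr_ge0 (sqrtr_ge0 _) h1)).
  by rewrite !exprMn sqr_sqrtr // divr_ge0 // ltW.
have h3 := le_trans hk h2.
rewrite -(ler_pM2r k0) exprMn.
rewrite (_ : delta * n%:R * _ = delta * (J_dim n)%:R * n%:R); last by ring.
apply: le_trans (ler_wpM2r (ltW n0') h3) _.
rewrite le_eqVlt; apply/orP; left; apply/eqP; field; rewrite gt_eqF //.
Qed.

Lemma large_nat (x : R) : 0 <= x -> exists2 n, (4 <= n)%N & x < n%:R.
Proof.
move=> x0; exists (maxn 4 (Num.bound x)); first by rewrite leq_maxl.
by apply: lt_le_trans (archi_boundP x0) _; rewrite ler_nat leq_maxr.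
Qed.

Lemma sum_pair2 (I : Type) (s : seq I) (y : I -> omega R) (f : omega R):
  (forall j, f j = \sum_(i <- s) y i j) ->
  \sum_(i <- s) (0, y i) = (0, f) :> V.
Proof.
move=> /funext ->; elim: s => [|i s IH].
  by rewrite big_nil; congr pair; apply/funext => j; rewrite big_nil.
rewrite big_cons IH [LHS]surjective_pairing /= addr0; congr pair.
by apply/funext => j; rewrite big_cons.
Qed.

Lemma Z_basis_odd j : Z_basis R j.*2.+1 = (0, unit_vec R j).
Proof. by rewrite /Z_basis /= odd_double /= uphalf_double. Qed.

(** Of the 2 ^ (n + 1) second-component vectors of the block n at least 2 ^ n
remain when 2 ^ n indices are removed. The property for m = 2 ^ n bounds the norm
of the sum of 2 ^ n of them by K sqrt m. *)
Lemma not_E_property : ~ (exists K : R, 1 <= K /\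
  forall n : nat, E_property (@ZJ_norm R) (@Z_basis R) n n K).
Proof.
move=> [K [K1 H]]; have K0 : 0 <= K := le_trans ler01 K1.
have [n n4 hn] := large_nat (mulr_ge0 (ler0n R 2) (sqr_ge0 (l1cst R * K))).
pose m := (2 ^ n)%N; have [I [Im eu]] := H m.
(* The index in Z_basis of the vector (0, e_j), j being the coordinate i of the
   block. *)
pose g i := (J_offset n + i).*2.+1.
have g_inj : injective g by move=> i j [] /double_inj /addnI.
pose B := [seq i <- iota 0 (J_dim n) | g i \notin I].
have sB : (m <= size B)%N.
  rewrite size_filter; have := count_predC (fun i => g i \in I) (iota 0 (J_dim n)).
  rewrite size_iota /J_dim expnS mul2n -addnn -/m => e.
  have h : (count (fun i => g i \in I) (iota 0 (m + m)) <= m)%N.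
    rewrite -size_filter -(size_map g) -Im; apply: uniq_leq_size.
      by rewrite map_inj_uniq // filter_uniq // iota_uniq.
    by move=> _ /mapP[i + ->]; rewrite mem_filter => /andP[].
  by rewrite -(leq_add2l (count (fun i => g i \in I) (iota 0 (m + m)))) e leq_add2r.
pose A0 := take m B; have sA : size A0 = m by rewrite size_takel.
have uA : uniq A0 by rewrite take_uniq // filter_uniq // iota_uniq.
have AB i : i \in A0 -> (i < J_dim n)%N /\ g i \notin I.
  by move=> /mem_take; rewrite mem_filter mem_iota => /andP[-> ].
pose A : {fset nat} := seq_fset tt (map g A0).
have pA : perm_eq A (map g A0).
  by apply: perm_trans (seq_fset_perm _ _) _; rewrite undup_id // map_inj_uniq.
have cA : #|` A| = m by rewrite size_seq_fset undup_id ?map_inj_uniq // size_map.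
have AI : [set` A] `<=` ~` [set` I].
  move=> j /=; rewrite seq_fsetE => /mapP[i iA ->]; have [_ h] := AB i iA.
  exact/negP.
have [_] := eu A AI (eq_leq cA) (fun=> 1).
rewrite !(perm_big _ pA) /= !big_map.
have -> : Num.sqrt (\sum_(j <- A0) modc (1 : R[i]) ^+ 2) = Num.sqrt m%:R.
  by rewrite (eq_bigr (fun=> 1)) => [|i _]; rewrite ?modc1 ?expr1n // big_const_seq count_predT sA iter_addr_0.
pose y : omega R := fun j => \sum_(i <- A0) unit_vec R (J_offset n + i) j.
rewrite (eq_bigr (fun i => (0, unit_vec R (J_offset n + i)))); last first.
  by move=> i _; rewrite scale1r Z_basis_odd.
rewrite (@sum_pair2 _ _ _ y) // => /(l1_block n4).
have yE (i : 'I_(J_dim n)) : modc (y (J_offset n + i)%N) = (val i \in A0)%:R.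
  rewrite /y (eq_bigr (fun l => (val i == l)%:R)); last first.
    by move=> l _; rewrite /unit_vec eqn_add2l.
  have [iA|iA] := boolP (val i \in A0).
    rewrite (bigD1_seq (val i)) //= eqxx big1 ?addr0 ?modc1 // => l.
    by rewrite eq_sym => /negPf ->.
  rewrite big_seq big1 ?modc0 // => l lA; case: eqP => // il.
  by rewrite il lA in iA.
rewrite (eq_bigr _ (fun i _ => yE i)) -(big_mkord xpredT (fun i => (i \in A0)%:R)).
rewrite -natr_sum.
have -> : (\sum_(0 <= i < J_dim n) (i \in A0))%N = m.
  rewrite (eq_bigr (fun i => if i \in A0 then 1%N else 0%N)) => [|i _]; last by case: (_ \in _).
  rewrite -big_mkcond sum1_count -size_filter -sA; apply: perm_size; apply: uniq_perm => //.
    by rewrite filter_uniq // iota_uniq.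
  move=> i; rewrite mem_filter mem_index_iota; apply: andb_idr => iA.
  by have [] := AB i iA.
move=> hm.
have : 2^-1 * (J_dim n)%:R <= m%:R :> R.
  by rewrite /J_dim expnS natrM mulrA mulVf ?mul1r.
move=> /block_count_bound/(_ hm) h.
have := h (ltnW (ltnW (ltnW n4))) K0; rewrite invr_gt0 => /(_ (ltr0n R 2)).
by rewrite mulrC ler_pdivrMr // => /(lt_le_trans hn); rewrite mulrC ltxx.
Qed.

(** Omega commutes with coordinatewise multipliers of constant modulus, since the
logarithm depends only on the quotients |y_j| / |y|. Passing through the
equivalent norm costs the factor 200 = 8 (1 + 3 * 8). *)
Lemma ZJ_norm_multiplier (e : nat -> R[i]) (a r : R) v : 0 <= a -> 0 <= r ->
  (forall j, modc (e j) = a) -> (ZJ_norm v <= r%:E)%E ->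
  (ZJ_norm ((fun j => (e j * v.1 j)%R, fun j => (e j * v.2 j)%R) : V) <= (200 * a * r)%:E)%E.
Proof.
move=> a0 r0 ea vr; apply/lee_addgt0Pr => t t0.
pose t' := t / (200 * (a + 1)).
have a1 : 0 < 200 * (a + 1) by rewrite mulr_gt0 // ltr_wpDl.
have [|q0 v2 dv] := @ZJ_lowerP R v (r + t').
  by apply: le_lt_trans vr _; rewrite lte_fin ltrDl divr_gt0.
set w : V := (_, _).
have mul (y : omega R) c : l2le y c -> l2le (fun j => e j * y j) (a * c).
  move=> yc M; rewrite (eq_bigr (fun j : 'I_M => a ^+ 2 * modc (y j) ^+ 2)) => [|j _].
    by rewrite -mulr_sumr exprMn ler_wpM2l ?sqr_ge0 //; exact: yc.
  by rewrite modcM ea exprMn.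
have OmE (y : omega R) : Omega (fun j => e j * y j) = (fun j => e j * Omega y j).
  have b2 n : block2 n (fun j => e j * y j) = a * block2 n y.
    rewrite /block2 -[a in RHS]ger0_norm // -sqrtr_sqr -sqrtrM ?sqr_ge0 //.
    by rewrite mulr_sumr; congr Num.sqrt; apply: eq_bigr => i _; rewrite modcM exprMn ea.
  apply/funext => j; have [e0|en] := eqVneq (e j) 0; first by rewrite /Omega e0 !mul0r mulr0.
  rewrite /Omega /lam b2 modcM ea -mulf_div mulfV ?mul1r; first by rewrite mulrCA.
  by rewrite -(ea j) modc_eq0.
have w2 : l2le w.2 (a * (r + t')) by exact: mul.
have dw : l2le (defect w) (a * (8 * (r + t'))).
  have -> : defect w = (fun j => e j * defect v j); last exact: mul.
  by apply/funext => j; rewrite /defect /w /= OmE mulrBr.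
have ge1 : 0 <= a * (r + t') by rewrite mulr_ge0.
have ge2 : 0 <= a * (8 * (r + t')) by rewrite mulr_ge0 // mulr_ge0.
apply: (le_trans (ZJ_upper ge1 ge2 w2 dw)).
rewrite -EFinD lee_fin (_ : 8 * (a * (r + t') + _) = 200 * a * r + 200 * a * t'); last by ring.
rewrite lerD2l /t' mulrA ler_pdivrMr // mulrC ler_wpM2l ?(ltW t0) //.
by rewrite ler_wpM2l // lerDl.
Qed.

Definition block_vec n (i : 'I_(J_dim n)) : V := (0, unit_vec R (J_offset n + i)%N).

Lemma lincomb_block_vec n c (i : 'I_(J_dim n)) :
  (lincomb (@block_vec n) c).2 (J_offset n + i)%N = c i.
Proof.
rewrite lincomb2 (bigD1 i) //= /unit_vec eqxx mulr1 big1 ?addr0 // => l li.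
by rewrite eqn_add2l eq_sym (_ : (_ == _) = false) ?mulr0 //; exact: negbTE.
Qed.

Lemma lincomb_block_vec1 n c : (lincomb (@block_vec n) c).1 = 0.
Proof. by apply/funext => j; rewrite lincomb1 big1 // => i _; rewrite mulr0. Qed.

Lemma ZJ_norm_block_vec n (i : 'I_(J_dim n)) : ZJ_norm (block_vec i) = 1%E.
Proof.
apply/eqP; rewrite eq_le ZJ_norm_unit2 /= leNgt; apply/negP => h.
have f : ZJ_norm (block_vec i) \is a fin_num.
  by rewrite ge0_fin_numE ?ZJ_norm_ge0 // (lt_trans h) // ltry.
move: h; rewrite -(fineK f) lte_fin; set r := fine _ => r1.
have [|c0 h _] := @ZJ_lowerP R (block_vec i) ((r + 1) / 2).
  by rewrite -(fineK f) -/r lte_fin; lra.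
have := l2le_coord (J_offset n + i)%N c0 h.
by rewrite /= /unit_vec eqxx modc1; lra.
Qed.

Lemma block_vec_unconditional n : unconditional (@ZJ_norm R) 200 (@block_vec n).
Proof.
move=> a e e1; set v := lincomb _ a.
have [vfin|] := boolP (ZJ_norm v \is a fin_num); last first.
  rewrite ge0_fin_numE ?ZJ_norm_ge0 // -leNgt leye_eq => /eqP ->.
  by rewrite gt0_muley ?leey // lte_fin.
have v0 : 0 <= fine (ZJ_norm v) by rewrite fine_ge0 // ZJ_norm_ge0.
(* Below the block the truncated subtraction selects e 0; the vectors vanish
   there. *)
pose e' j : R[i] := oapp e 1 (insub (j - J_offset n)%N).
have e'1 j : modc (e' j) = 1 by rewrite /e'; case: (insub _) => [i|] /=; [exact: e1|exact: modc1].
have := ZJ_norm_multiplier ler01 v0 e'1 (_ : ZJ_norm v <= _)%E.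
rewrite fineK // => /(_ (lexx _)); rewrite mulr1 EFinM fineK //.
apply: le_trans; rewrite le_eqVlt; apply/orP; left; apply/eqP; congr (ZJ_norm _).
rewrite [LHS]surjective_pairing; congr pair; apply/funext => j.
  by rewrite /v !lincomb_block_vec1 mulr0.
rewrite /v !lincomb2 mulr_sumr; apply: eq_bigr => i _; rewrite /= /unit_vec.
case: eqP => [->|_]; last by rewrite !mulr0.
by rewrite !mulr1 /e' addKn valK.
Qed.

(** The vectors (0, e_j) of a whole block, which are 200-unconditional. *)
Lemma not_property_H : ~ property_H (@ZJ_norm R).
Proof.
move=> /(_ 200)[|K [K0 H]]; first by rewrite ltr1n.
have [n n4 hn] := large_nat (sqr_ge0 (l1cst R * K)).
have [_] := H _ (@block_vec n) (@ZJ_norm_block_vec n) (@block_vec_unconditional n).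
have -> : \sum_(i < J_dim n) block_vec i = (0, (lincomb (@block_vec n) (fun=> 1)).2) :> V.
  rewrite -(@lincomb_block_vec1 n (fun=> 1)) -surjective_pairing.
  by apply: eq_bigr => i _; rewrite scale1r.
move=> /(l1_block n4); rewrite (eq_bigr (fun=> 1)) => [|i _]; last first.
  by rewrite lincomb_block_vec modc1.
rewrite sumr_const card_ord => hm.
have hk : 1 * (J_dim n)%:R <= (J_dim n)%:R :> R by rewrite mul1r.
have := block_count_bound (ltnW (ltnW (ltnW n4))) (ltW K0) ltr01 hk hm.
by rewrite mul1r leNgt hn.
Qed.

End Failures.

(** * Failure of the weak Hilbert property *)

Section WeakHilbert.
Variable R : realType.
Notation V := (omega R * omega R)%type.
#[local] Opaque J_block_norm.

Lemma linear_lincomb (U W : lmodType R[i]) (E : set U) (T : U -> W) n (x : 'I_n -> U)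
    (c : 'I_n -> R[i]) :
  linear_subspace E -> linear_on E T -> (forall i, E (x i)) ->
  E (lincomb x c) /\ T (lincomb x c) = lincomb (fun i => T (x i)) c.
Proof.
move=> [E0 El] Tl Ex.
have T0 : T 0 = 0 by have := Tl (-1) 0 0 E0 E0; rewrite !scaleN1r oppr0 addr0 addNr.
rewrite /lincomb; elim: (index_enum _) => [|i s [IH1 IH2]]; first by rewrite !big_nil.
by rewrite !big_cons; split; [exact: El|rewrite Tl // IH2].
Qed.

Lemma has_dim_subspace (U : lmodType R[i]) (E : set U) n : has_dim E n -> linear_subspace E.
Proof.
move=> [b [_ ->]]; split; first by exists (fun=> 0) => //; rewrite /lincomb big1 // => i _; rewrite scale0r.
move=> a _ _ [c _ <-] [c' _ <-]; exists (fun i => a * c i + c' i) => //.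
rewrite /lincomb scaler_sumr -big_split /=; apply: eq_bigr => i _.
by rewrite scalerDl scalerA.
Qed.

(** The trace of the identity of l_2^m factored through k coordinates, estimated
by Cauchy-Schwarz at each coordinate. *)
Lemma l2norm_trace (k m : nat) (U : 'I_m -> 'I_k -> R[i]) (W : 'I_k -> 'I_m -> R[i]) (h : R) :
  (forall i, \sum_j U i j * W j i = 1) -> 0 <= h ->
  (forall j, \sum_i modc (W j i) ^+ 2 <= h ^+ 2) ->
  m%:R <= h * \sum_j Num.sqrt (\sum_i modc (U i j) ^+ 2).
Proof.
move=> UW h0 hW.
have -> : m%:R = modc (\sum_(i < m) \sum_j U i j * W j i).
  rewrite (eq_bigr (fun=> 1)) // sumr_const card_ord.
  by rewrite -(rmorph_nat (real_complex R)) modc_real ger0_norm.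
rewrite exchange_big mulr_sumr; apply: (le_trans (modc_sum _ _ _)); apply: ler_sum => j _.
apply: (le_trans (modc_sum _ _ _)); rewrite mulrC.
rewrite (eq_bigr (fun i => modc (U i j) * modc (W j i))) => [|i _]; last by rewrite modcM.
apply: cauchy_schwarz_sum; rewrite ?sqrtr_ge0 //.
by rewrite sqr_sqrtr // sumr_ge0 // => i _; rewrite sqr_ge0.
Qed.

(** Khinchine's inequality at each coordinate j bounds the square functions by the
mean over the signs, hence by the largest l_1-norm of a signed sum of the rows. *)
Lemma columns_le (k m : nat) (U : 'I_m -> 'I_k -> R[i]) (B : R) :
  (forall s : 'I_m -> R, (forall i, `|s i| = 1) ->
    \sum_j modc (\sum_i (s i)%:C * U i j) <= B) ->
  5 * \sum_j Num.sqrt (\sum_i modc (U i j) ^+ 2) <= 9 * B.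
Proof.
move=> hB; pose f (j i : nat) : R[i] :=
  oapp (fun j => oapp (fun i => U i j) 0 (insub i)) 0 (insub j).
have fE (j : 'I_k) (i : 'I_m) : f j i = U i j by rewrite /f !valK.
apply: (@le_trans _ _ (\sum_(j < k) 9 * sign_mean m (fun s => modc (\sum_(i < m) (s i)%:C * f j i)))).
  rewrite mulr_sumr; apply: ler_sum => j _; apply: le_trans (khinchine m (f j)).
  by rewrite le_eqVlt; apply/orP; left; apply/eqP; congr (_ * Num.sqrt _); apply: eq_bigr => i _; rewrite fE.
rewrite -mulr_sumr ler_wpM2l // -(sign_mean_sum m k (fun j s => modc (\sum_(i < m) (s i)%:C * f j i))).
apply: sign_mean_le_cst => s s1; apply: le_trans (hB s (fun i => s1 i)).
by rewrite le_eqVlt; apply/orP; left; apply/eqP; apply: eq_bigr => j _; congr modc; apply: eq_bigr => i _; rewrite fE.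
Qed.

(** Isomorphisms almost attaining the distance have finite operator norms. *)
Lemma hilbert_dist_isom (E : set V) m (C : R) : (hilbert_dist (@ZJ_norm R) E m <= C%:E)%E ->
  linear_subspace E ->
  exists (T : V -> 'rV[R[i]]_m) (S : 'rV[R[i]]_m -> V) (t s : R),
    [/\ linear_on E T, forall x, E x -> S (T x) = x,
        forall a, E (S a) /\ T (S a) = a,
        (forall x, E x -> (ZJ_norm x <= 1)%E -> (ell2_norm (T x) <= t%:E)%E) /\
        (forall a, (ell2_norm a <= 1)%E -> (ZJ_norm (S a) <= s%:E)%E) &
        [/\ 0 <= t, 0 <= s & t * s <= C + 1]].
Proof.
move=> hC [E0 _].
have [|_ [T [S [Tl TG SG [ht hs] ->]]] hd] := @ereal_inf_lt R _ (C + 1)%:E (le_lt_trans hC _).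
  by rewrite lte_fin ltrDl.
have T0 : T 0 = 0 by have := Tl (-1) 0 0 E0 E0; rewrite !scaleN1r oppr0 addr0 addNr.
have S0 : S 0 = 0 by rewrite -T0; have [] := TG 0 E0.
set t := op_norm _ _ _ _ in ht hd; set s := op_norm _ _ _ _ in hs hd.
have ub1 x : E x -> (ZJ_norm x <= 1)%E -> (ell2_norm (T x) <= t)%E.
  by move=> Ex x1; apply: ereal_sup_ubound; exists x.
have ub2 a : (ell2_norm a <= 1)%E -> (ZJ_norm (S a) <= s)%E.
  by move=> a1; apply: ereal_sup_ubound; exists a.
have l20 : (ell2_norm (0 : 'rV[R[i]]_m) <= 1)%E.
  by rewrite ell2_norm_sq_le // big1 ?expr1n // => i _; rewrite mxE modc0 expr0n.
have s0 : (0 <= s)%E := le_trans (ZJ_norm_ge0 _) (ub2 _ l20).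
have z0 : (ZJ_norm (0 : V)%R <= 1)%E by rewrite ZJ_norm0.
have t0 : (0 <= t)%E.
  by apply: le_trans (ub1 _ E0 z0); rewrite ell2_normE lee_fin sqrtr_ge0.
have tf : t \is a fin_num by rewrite ge0_fin_numE.
have sf : s \is a fin_num by rewrite ge0_fin_numE.
exists T, S, (fine t), (fine s); split.
- by [].
- by move=> x /TG[].
- by move=> a; exact: SG.
- by rewrite !fineK.
- split; rewrite ?fine_ge0 //.
  by move: hd; rewrite -(fineK tf) -(fineK sf) -EFinM lte_fin => /ltW.
Qed.

(** E is the span of the block n, G the complemented euclidean subspace, and the
identity of l_2^m is T P S. In the coordinates of the block, S has the matrix U
and T P the matrix W. The rows of W are bounded because the vectors of the block
have norm 1. Signed sums of the rows of U are the images under S of vectors of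
l_2-norm sqrt m, so l1_block and columns_le bound the sum of the norms of the
columns of U by a multiple of sqrt m sqrt (k / n). The trace yields
m <= const sqrt m sqrt (k / n). *)
Lemma not_weak_hilbert : ~ weak_hilbert (@ZJ_norm R).
Proof.
move=> [delta [C [d0 _ H]]].
pose C1 := Num.max C 1.
have C10 : 0 < C1 by apply: (lt_le_trans ltr01); rewrite le_max lexx orbT.
(* Constants with an equation instead of a body, which keeps numerals folded. *)
have [q q0 qE] : exists2 q : R, 0 < q & q = 200 by exists 200; rewrite ?ltr0n.
have qC0 : 0 < q * C1 by exact: mulr_gt0.
have [B B0 BE] : exists2 B : R, 0 <= B & B = 9 / 5 * (q * C1) * (Num.max C 0 + 1).
  eexists; last by reflexivity.
  apply: mulr_ge0; first by apply: mulr_ge0 (ltW qC0); exact: divr_ge0.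
  by rewrite addr_ge0 // le_max lexx orbT.
have [n n4 hn] := large_nat (divr_ge0 (sqr_ge0 (l1cst R * B)) (ltW d0)).
pose k := J_dim n; pose b := @block_vec R n; pose E := range (lincomb b).
have bs i : Defs.space (@ZJ_norm R) (b i) by rewrite /Defs.space /= ZJ_norm_block_vec ltry.
have Es : E `<=` Defs.space (@ZJ_norm R) by move=> _ [c _ <-]; exact: space_ZJ_lincomb.
have bi : independent b.
  by move=> c c0 i; rewrite -(lincomb_block_vec c i) -/b c0.
have [G [m [GE Gm km hd [P [Pl PG Pid hP]]]]] := H E k Es (ex_intro _ b (conj bi erefl)).
have Gl := has_dim_subspace Gm.
have [T [S [t [s [Tl ST TS [hT hS] [t0 s0 ts]]]]]] := hilbert_dist_isom hd Gl.
have k0 : 0 < k%:R :> R by rewrite ltr0n expn_gt0.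
have m0 : 0 < m%:R :> R by apply: lt_le_trans km; rewrite mulr_gt0.
have sl : linear_subspace (Defs.space (@ZJ_norm R)).
  by split; [exact: space_ZJ0|move=> a x y; exact: space_ZJ_lin].
pose de (i : 'I_m) : 'rV[R[i]]_m := delta_mx ord0 i.
pose U i (j : 'I_k) : R[i] := (S (de i)).2 (J_offset n + j)%N.
pose W (j : 'I_k) i : R[i] := T (P (b j)) ord0 i.
have SU i : S (de i) = lincomb b (U i).
  have [GS _] := TS (de i); have [c _ cE] := GE _ GS.
  rewrite -cE; congr (lincomb b); apply/funext => j.
  by rewrite /U -cE lincomb_block_vec.
have trUW i : \sum_j U i j * W j i = 1.
  have [GS TSi] := TS (de i).
  have [_ e1] := linear_lincomb (U i) sl Pl bs.
  have Pb j : G (P (b j)) by exact: PG.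
  have [_ e2] := linear_lincomb (U i) Gl Tl Pb.
  move: TSi; rewrite -{1}(Pid _ GS) SU e1 e2 => TSi.
  rewrite -[RHS](_ : de i ord0 i = 1); last by rewrite mxE !eqxx.
  rewrite -TSi /lincomb summxE.
  by apply: eq_bigr => j _; rewrite mxE.
have hW j : \sum_i modc (W j i) ^+ 2 <= (q * C1 * t) ^+ 2.
  have r0 : 0 < (q * C1)^-1 by rewrite invr_gt0.
  have Pb1 : (ZJ_norm (P (b j)) <= C1%:E)%E.
    apply: (@le_trans _ _ C%:E); last by rewrite lee_fin le_max lexx.
    apply: le_trans hP; apply: ereal_sup_ubound; exists (b j) => //; split; first exact: bs.
    by rewrite /= ZJ_norm_block_vec.
  pose x := (q * C1)^-1%:C *: P (b j).
  have Gx : G x by rewrite -[x]addr0; apply: Gl.2 => //; [exact: PG|exact: Gl.1].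
  have x1 : (ZJ_norm x <= 1)%E.
    have := ZJ_norm_multiplier (ltW r0) (ltW C10) (fun=> _ : modc (q * C1)^-1%:C = _) Pb1.
    rewrite -qE mulrAC mulfV ?gt_eqF //; apply.
    by rewrite modc_real ger0_norm // ltW.
  have := hT x Gx x1; rewrite ell2_norm_sq_le //.
  have -> : T x = (q * C1)^-1%:C *: T (P (b j)).
    have := linear_lincomb (fun=> (q * C1)^-1%:C) Gl Tl (fun _ : 'I_1 => PG _ (bs j)).
    by rewrite /lincomb !big_ord1 => -[].
  rewrite (eq_bigr (fun i => (q * C1)^-1 ^+ 2 * modc (W j i) ^+ 2)) => [|i _]; last first.
    by rewrite mxE modcM exprMn modc_real ger0_norm // ltW.
  by rewrite -mulr_sumr exprVn ler_pdivrMl ?exprn_gt0 // -exprMn.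
have hU (sg : 'I_m -> R) : (forall i, `|sg i| = 1) ->
    \sum_(j < k) modc (\sum_i (sg i)%:C * U i j) <= Num.sqrt m%:R * l1fac R n * s.
  move=> sg1; have sm : 0 < Num.sqrt m%:R :> R by rewrite sqrtr_gt0.
  pose c i : R[i] := (sg i / Num.sqrt m%:R)%:C.
  have [GS e] := linear_lincomb c Gl Tl (fun i => (TS (de i)).1).
  pose a : 'rV[R[i]]_m := \row_i c i.
  have Sa : S a = lincomb (fun i => S (de i)) c.
    rewrite -(ST _ GS) e; congr S; apply/rowP => i; rewrite mxE /lincomb summxE.
    rewrite (bigD1 i) //= (TS _).2 !mxE !eqxx mulr1 big1 ?addr0 // => l li.
    by rewrite (TS _).2 !mxE eqxx /= eq_sym (negPf li) mulr0.
  have a1 : (ell2_norm a <= 1)%E.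
    rewrite ell2_norm_sq_le // expr1n (eq_bigr (fun=> m%:R^-1)) => [|i _]; last first.
      rewrite mxE modc_real normrM sg1 mul1r normrV ?unitfE ?gt_eqF // ger0_norm ?(ltW sm) //.
      by rewrite exprVn sqr_sqrtr // ltW.
    by rewrite sumr_const card_ord -[X in X <= _]mulr_natl mulfV ?gt_eqF.
  have hs := hS a a1.
  have Sa1 : S a = (0%R : omega R, (S a).2).
    have [c' _ <-] := GE _ (TS a).1.
    by rewrite [LHS]surjective_pairing lincomb_block_vec1.
  rewrite Sa1 in hs; have := l1_block n4 hs.
  rewrite (eq_bigr (fun j : 'I_k => (Num.sqrt m%:R)^-1 * modc (\sum_i (sg i)%:C * U i j))) => [|j _].
    by rewrite -mulr_sumr ler_pdivrMl // mulrA.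
  have -> : (S a).2 (J_offset n + j)%N = (Num.sqrt m%:R)^-1%:C * \sum_i (sg i)%:C * U i j.
    rewrite Sa lincomb2 mulr_sumr; apply: eq_bigr => i _.
    by rewrite mulrA /c rmorphM /= [X in X * _ = _]mulrC.
  by rewrite modcM modc_real ger0_norm // invr_ge0 ltW.
have h0 : 0 <= q * C1 * t := mulr_ge0 (ltW qC0) t0.
have tr := l2norm_trace trUW h0 hW.
have col := columns_le hU.
have hm : m%:R <= l1fac R n * (B * Num.sqrt m%:R).
  set F := \sum_j _ in tr col; set sm := Num.sqrt m%:R in col *; set f := l1fac R n in col *.
  have sf : 0 <= sm * f by rewrite mulr_ge0 ?sqrtr_ge0 // l1fac_ge0.
  apply: (le_trans tr); apply: (@le_trans _ _ (q * C1 * t * (9 / 5 * (sm * f * s)))).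
    by apply: (ler_wpM2l h0); lra.
  rewrite (_ : q * C1 * t * _ = 9 / 5 * (q * C1) * (t * s) * (sm * f)); last by field.
  rewrite (_ : f * _ = B * (sm * f)); last by ring.
  rewrite BE; apply: (ler_wpM2r sf); apply: ler_wpM2l.
    by apply: mulr_ge0 (ltW qC0); exact: divr_ge0.
  by apply: (le_trans ts); rewrite lerD2r le_max lexx.
have := block_count_bound (ltnW (ltnW (ltnW n4))) B0 d0 km hm.
by rewrite mulrC -ler_pdivlMr // leNgt hn.
Qed.

End WeakHilbert.

Theorem theorem1 (R : realType) :
  [/\ asymptotically_hilbertian (@ZJ_norm R),
      ~ (exists K : R, 1 <= K /\
           forall n : nat, E_property (@ZJ_norm R) (@Z_basis R) n n K),
      ~ property_H (@ZJ_norm R) &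
      ~ weak_hilbert (@ZJ_norm R)].
Proof.
split; [exact: ZJ_asymptotically_hilbertian|exact: not_E_property|
  exact: not_property_H|exact: not_weak_hilbert].
Qed.
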